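(* Let $H>0$, $\alpha>1$, $q\in\mathbb{N}$, and let $W(\alpha^k)=\big(W^0(\alpha^k),W^1(\alpha^k),\ldots,W^{q-1}(\alpha^k)\big)$, $k\in\mathbb{Z}$, be a zero-mean discrete time $q$-dimensional self-similar process with index $H$ and parameter space $\{\alpha^k:k\in\mathbb{Z}\}$. Then: (i) The harmonic like representation of $W^j(\alpha^k)$, $j=0,\ldots,q-1$, is $$W^j(\alpha^k)=\alpha^{kH}\int_0^{2\pi}e^{i\omega k}\,d\varphi_j(\omega),\qquad k\in\mathbb{Z},$$ where $\varphi_j$ is the corresponding spectral measure, for which, for $j,r=0,1,\ldots,q-1$, $E[d\varphi_j(\omega)\overline{d\varphi_r(\omega')}]=dD^H_{jr}(\omega)$ when $\omega=\omega'$ and is $0$ when $\omega\neq\omega'$. $D^H_{jr}(\omega)$ is called the spectral distribution function of the process. (ii) The corresponding spectral density matrix of $\{W(\alpha^k),k\in\mathbb{Z}\}$ is ${\bf d}^H(\omega)=[{\bf d}^H_{jr}(\omega)]_{j,r=0,\ldots,q-1}$, where $${\bf d}^H_{jr}(\omega)=\frac{1}{2\pi}\sum_{n=-\infty}^{\infty}\alpha^{-nH}e^{-i\omega n}Q^H_{jr}(\alpha^n)$$ and $Q^H_{jr}(\alpha^n)$ is the covariance function of $W^j(\alpha^n)$ and $W^r(1)$.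
   Context: Let $\check T\subset(0,\infty)$ be a finite or countable set of distinct points. A process $\{X(k),k\in\check T\}$ is discrete time self-similar (DT-SS), in the wide sense, with index $H>0$ and parameter space $\check T$ if for all $k,k_1\in\check T$ and all $a>0$ with $ak,ak_1\in\check T$: $E[X^2(k)]<\infty$; $E[X(ak)]=a^HE[X(k)]$; $E[X(ak)X(ak_1)]=a^{2H}E[X(k)X(k_1)]$. A process $U(t)=(U^0(t),\ldots,U^{q-1}(t))$, $t\in\check T$, is a $q$-dimensional discrete time self-similar process (in the wide sense) with index $H$ and parameter space $\check T$ if (a) each $U^j$, $j=0,\ldots,q-1$, is DT-SS with index $H$ and parameter space $\check T$; and (b) $\mathrm{Cov}(U^i(ts),U^j(tr))=t^{2H}\,\mathrm{Cov}(U^i(s),U^j(r))$ for all $i,j=0,\ldots,q-1$ whenever $s,r,ts,tr\in\check T$. The spectral measure $\varphi_j$ is the random spectral measure on $[0,2\pi)$ associated with the $j$th component $\xi^j(k)=\alpha^{-kH}W^j(\alpha^k)$, $k\in\mathbb{Z}$, of the stationary counterpart of $W$, i.e. $\xi^j(k)=\int_0^{2\pi}e^{i\omega k}\,d\varphi_j(\omega)$. The relation $E[d\varphi_j(\omega)\overline{d\varphi_r(\omega')}]=dD^H_{jr}(\omega)$ for $\omega=\omega'$, and $0$ for $\omega\neq\omega'$, means that $E[\varphi_j(\Delta)\overline{\varphi_r(\Delta)}]=D^H_{jr}(\Delta)$ for Borel sets $\Delta$, where $D^H_{jr}$ is a complex-valued $\sigma$-additive set function of bounded variation, and $E[\varphi_j(\Delta)\overline{\varphi_r(\Delta')}]=0$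 for disjoint Borel sets $\Delta,\Delta'$. The covariance is $Q^H_{jr}(\alpha^n)=E[W^j(\alpha^n)\overline{W^r(1)}]$. The spectral density matrix has entries ${\bf d}^H_{jr}(\omega)=D^H_{jr}(d\omega)/d\omega$, that is, the limit of $D^H_{jr}\big((\omega,\omega+d\omega]\big)/d\omega$ as $d\omega\to0$.
   Formalization: Part (ii) is asserted at each ω where the density (as a two-sided limit dω→0 on the circle) exists and the symmetric partial sums converge; existence of both is asserted when Σ α^{-nH}|Q_jr(α^n)| < ∞, since for W(α^k)=α^{kH}Z the series diverges. *)

(* Defs.v *)
From HB Require Import structures.
From mathcomp Require Import all_boot all_order all_algebra.
From mathcomp Require Import all_classical all_reals all_analysis.
From mathcomp Require Import complex.

Set Implicit Arguments.
Unset Strict Implicit.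
Unset Printing Implicit Defensive.

Import Order.TTheory GRing.Theory Num.Theory.
Import numFieldNormedType.Exports.

Local Open Scope classical_set_scope.
Local Open Scope complex_scope.
Local Open Scope ring_scope.

(** Processes are real valued; [X : R -> {RV P >-> R}] is only ever evaluated
    on the parameter space [Tc], so that its values elsewhere are irrelevant. *)
Section self_similarity.
Context d (T : measurableType d) (R : realType) (P : probability T R).
Implicit Types (H : R) (Tc : set R).

Definition parameter_space Tc :=
  countable Tc /\ (forall k, Tc k -> 0 < k).

Definition dt_self_similar H Tc (X : R -> {RV P >-> R}) :=
  [/\ 0 < H,
      parameter_space Tc,
      forall k, Tc k -> ('E_P[fun w => (X k w ^+ 2)%R] < +oo)%E,
      forall k a : R, 0 < a -> Tc k -> Tc (a * k) ->
        ('E_P[X (a * k)%R] = ((a `^ H)%R)%:E * 'E_P[X k])%E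
    & forall k k1 a : R, 0 < a -> Tc k -> Tc k1 -> Tc (a * k) -> Tc (a * k1) ->
        ('E_P[fun w => (X (a * k) w * X (a * k1) w)%R] =
         ((a `^ (2 * H))%R)%:E * 'E_P[fun w => (X k w * X k1 w)%R])%E].

Definition multi_dt_self_similar (q : nat) H Tc
    (U : 'I_q -> R -> {RV P >-> R}) :=
  (forall j, dt_self_similar H Tc (U j)) /\
  (forall i j (t s r : R), 0 < t -> Tc s -> Tc r -> Tc (t * s) -> Tc (t * r) ->
     (covariance P (U i (t * s)%R) (U j (t * r)%R) =
      ((t `^ (2 * H))%R)%:E * covariance P (U i s) (U j r))%E).

End self_similarity.

Definition geometric_space (R : realType) (alpha : R) : set R :=
  range (fun k : int => alpha ^ k).

Section complex_random_variables.
Context d (T : measurableType d) (R : realType) (P : probability T R).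
Implicit Types X Y : T -> R[i].

Definition cexpectation X : R[i] :=
  fine 'E_P[fun w => complex.Re (X w)] +i* fine 'E_P[fun w => complex.Im (X w)].

Definition sqmod (z : R[i]) : R := complex.Re z ^+ 2 + complex.Im z ^+ 2.

Definition mean_square X : \bar R := 'E_P[fun w => sqmod (X w)].

Definition square_integrable X :=
  [/\ measurable_fun setT (fun w => complex.Re (X w)),
      measurable_fun setT (fun w => complex.Im (X w))
    & (mean_square X < +oo)%E].

Definition cvg_mean_square (X : nat -> T -> R[i]) Y :=
  mean_square (fun w => X n w - Y w) @[n --> \oo] --> 0%E.

End complex_random_variables.

Section spectral_measures.
Context (R : realType).

Definition spectral_interval : set R := `[0, 2 * pi[.

Definition spectral_set (A : set R) :=
  measurable (A : set (measurableTypeR R)) /\ A `<=` spectral_interval.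

Definition expi (x : R) : R[i] := cos x +i* sin x.

(** Step functions on [0, 2 pi[; the sets need not be disjoint. *)
Record step_function := StepFunction {
  step_size : nat;
  step_coef : 'I_step_size -> R[i];
  step_set : 'I_step_size -> set R;
  step_setP : forall i, spectral_set (step_set i) }.

Definition step_value (s : step_function) (x : R) : R[i] :=
  \sum_(i < step_size s) step_coef i * (\1_(@step_set s i) x)%:C.

Context d (T : measurableType d) (P : probability T R).
Implicit Types phi : set R -> T -> R[i].

(** Random set functions are constrained on spectral sets only. *)
Definition random_spectral_measure phi :=
  [/\ forall A, spectral_set A -> square_integrable P (phi A),
      forall F : nat -> set R, (forall n, spectral_set (F n)) ->
        trivIset setT F ->
        cvg_mean_square P (fun n w => \sum_(i < n) phi (F i) w)
          (phi (\bigcup_n F n))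
    & forall A B, spectral_set A -> spectral_set B -> A `&` B = set0 ->
        cexpectation P (fun w => phi A w * conjc (phi B w)) = 0].

Definition step_integral phi (s : step_function) (w : T) : R[i] :=
  \sum_(i < step_size s) step_coef i * phi (@step_set s i) w.

Definition control_measure phi (A : set (measurableTypeR R)) : \bar R :=
  mean_square P (phi (A `&` spectral_interval)).

(** [Y] is the integral of [f] against [phi] over [0, 2 pi[: the mean-square
    limit of the integrals of step functions tending to [f] in
    L^2(control_measure phi). *)
Definition is_spectral_integral phi (f : R -> R[i]) (Y : T -> R[i]) :=
  square_integrable P Y /\
  exists s : nat -> step_function,
    (\int[control_measure phi]_(x in spectral_interval)
        (sqmod (f x - step_value (s n) x))%:E)%E @[n --> \oo] --> 0%E /\
    cvg_mean_square P (fun n => step_integral phi (s n)) Y.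

Definition stationary_counterpart (alpha H : R) (X : R -> {RV P >-> R})
    (k : int) (w : T) : R :=
  alpha `^ (- (k%:~R * H)) * X (alpha ^ k) w.

Definition spectral_measure_of (xi : int -> T -> R) phi :=
  random_spectral_measure phi /\
  forall k : int, exists Y : T -> R[i],
    is_spectral_integral phi (fun x => expi (x * k%:~R)) Y /\
    {ae P, forall w, (xi k w)%:C = Y w}.

End spectral_measures.

Section spectral_distribution.
Context (R : realType).
Implicit Types D : set R -> R[i].

(** Limits of complex-valued functions are taken in [R[i]^o], which carries
    the usual topology of the plane. *)
Definition complex_measure D :=
  (forall F : nat -> set R, (forall n, spectral_set (F n)) ->
     trivIset setT F ->
     (\sum_(i < n) D (F i) : R[i]^o) @[n --> \oo] -->
       (D (\bigcup_n F n) : R[i]^o)) /\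
  (exists M : R, forall (n : nat) (A : 'I_n -> set R),
     (forall i, spectral_set (A i)) -> trivIset setT A ->
     \sum_(i < n) ComplexField.Normc.normc (D (A i)) <= M).

(** The half-open arc ]a, b] of the circle R / 2 pi Z, the circle being
    identified with [0, 2 pi[. *)
Definition arc (a b : R) : set R :=
  [set x | spectral_interval x /\
           exists m : int, a < x + 2 * pi * m%:~R <= b].

(** D(]x, x + h]), where ]x, x + h] is counted negatively when h < 0. *)
Definition increment D (x h : R) : R[i] :=
  if 0 <= h then D (arc x (x + h)) else - D (arc (x + h) x).

Definition is_spectral_density D (x : R) (l : R[i]) :=
  (increment D x h / h%:C : R[i]^o) @[h --> 0^'] --> (l : R[i]^o).

End spectral_distribution.

Section spectral_density_series.
Context d (T : measurableType d) (R : realType) (P : probability T R).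
Context (q : nat) (alpha H : R) (W : 'I_q -> R -> {RV P >-> R}).

Definition spectral_distribution (phi : 'I_q -> set R -> T -> R[i])
    (D : 'I_q -> 'I_q -> set R -> R[i]) :=
  forall j r,
    [/\ complex_measure (D j r),
        forall A, spectral_set A ->
          cexpectation P (fun w => phi j A w * conjc (phi r A w)) = D j r A
      & forall A B, spectral_set A -> spectral_set B -> A `&` B = set0 ->
          cexpectation P (fun w => phi j A w * conjc (phi r B w)) = 0].

Definition cov_fun (j r : 'I_q) (n : int) : R[i] :=
  cexpectation P (fun w => (W j (alpha ^ n) w)%:C * conjc (W r 1 w)%:C).

Definition density_term (j r : 'I_q) (x : R) (n : int) : R[i] :=
  (alpha `^ (- (n%:~R * H)))%:C * expi (- (x * n%:~R)) * cov_fun j r n.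

(** (2 pi)^-1 times the sum of the terms of index - N <= n <= N. *)
Definition density_partial_sum (j r : 'I_q) (x : R) (N : nat) : R[i] :=
  ((2 * pi)^-1)%:C * \sum_(i < (2 * N).+1) density_term j r x (i%:Z - N%:Z).

Definition density_series_sums_to (j r : 'I_q) (x : R) (l : R[i]) :=
  (density_partial_sum j r x N : R[i]^o) @[N --> \oo] --> (l : R[i]^o).

Definition summable_covariance (j r : 'I_q) :=
  summable [set: int]
    (fun n => (alpha `^ (- (n%:~R * H)) * ComplexField.Normc.normc (cov_fun j r n))%:E).

End spectral_density_series.

(* Main.v *)
(* The process [xi^j k = alpha^(-kH) W^j (alpha^k)] is stationary, with cross-covariances
   [gamma_jr n = alpha^(-nH) Q_jr(alpha^n)].  Its periodograms are discrete measures on the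
   circle whose limit [mu] has Fourier coefficients [gamma_jj] (Herglotz), so that
   [e^(ikx) |-> xi^j k] extends to an isometry of [L^2(mu)], and [phi_j A] is the image of the
   indicator of [A].

   Stationarity gives [E[phi_j A conj(phi_r B)] = 0] for disjoint [A] and [B], hence
   [D_jr A = E[xi^j 0 conj(phi_r A)]]: the set function [D_jr] is the image of a vector
   measure under a continuous linear form, and its Fourier coefficients are [gamma_jr].

   If the arcs at [x] have density [dx] for [D_jr], the means of [D_jr] against the
   de la Vallee-Poussin kernels at [x] converge to [dx] (Fatou), while by Abel summation
   they are averages of the partial sums of the Fourier series at [x]; so that series
   can only converge to [dx].  When [gamma_jr] is summable, [D_jr] is within
   [tail_N * length] of the measure whose density is the [N]-th partial sum, whence the
   existence of the density. *)

Require Import Defs.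
From HB Require Import structures.
From mathcomp Require Import all_boot all_order all_algebra.
From mathcomp Require Import all_classical all_reals all_analysis.
From mathcomp Require Import measurable_realfun complex.
From mathcomp Require Import ring lra zify.

Set Implicit Arguments.
Unset Strict Implicit.
Unset Printing Implicit Defensive.

Import Order.TTheory GRing.Theory Num.Theory.
Import numFieldNormedType.Exports.
Import ComplexField.Normc.

Local Open Scope classical_set_scope.
Local Open Scope complex_scope.
Local Open Scope ring_scope.

Local Notation Re := complex.Re.
Local Notation Im := complex.Im.
Local Notation arc := Defs.arc.
Local Notation cindic A := (fun x => (\1_A x)%:C).
Local Notation expk k := (fun x => expi (x * k%:~R)).
Local Notation measureR R := {measure set (measurableTypeR R) -> \bar R}.

(** Square-integrable functions are not identified almost everywhere, and a random spectral measure
    is known only through its mean-square properties. Isometries are therefore relations between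
    representatives, closed in both coordinates; the same device builds [phi] and analyses an
    arbitrary one.

    The control measures are arbitrary finite measures on the circle, and trigonometric polynomials
    must be dense in [L2] of each. It is enough to reach indicators of arcs, pointwise and
    boundedly.

    The uniqueness half assumes no summability: the series may converge only conditionally, and only
    at the given point. The kernel has to be nonnegative, a trigonometric polynomial, and monotone
    on each side of its peak, for then a control of the increments at [x] alone survives a summation
    by parts. The Fejer kernel is not monotone, hence the choice of the de la Vallee-Poussin kernel.

    Nothing is integrated directly against a complex set function: [ip P (xi1 0) Y], with [Y] the
    integral of [f] against [phi2], stands for the integral of the conjugate of [f]. *)

Lemma divD1_mul_le (R : realFieldType) (e K : R) : 0 <= e -> 0 <= K -> e / (K + 1) * K <= e.
Proof.
by move=> e0 K0; rewrite mulrAC ler_pdivrMr ?ltr_wpDl// ler_wpM2l// lerDl.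
Qed.

(** * Complex numbers and their squared modulus *)

Section complex_numbers.
Context (R : realType).
Implicit Types (x y z : R[i]) (a b : R).

Lemma ReD x y : Re (x + y) = Re x + Re y. Proof. by case: x y => [? ?] []. Qed.
Lemma ImD x y : Im (x + y) = Im x + Im y. Proof. by case: x y => [? ?] []. Qed.
Lemma ReN x : Re (- x) = - Re x. Proof. by case: x. Qed.
Lemma ImN x : Im (- x) = - Im x. Proof. by case: x. Qed.
Lemma ReM x y : Re (x * y) = Re x * Re y - Im x * Im y.
Proof. by case: x y => [? ?] []. Qed.
Lemma ImM x y : Im (x * y) = Re x * Im y + Im x * Re y.
Proof. by case: x y => [? ?] []. Qed.
Lemma ReJ x : Re (conjc x) = Re x. Proof. by case: x. Qed.
Lemma ImJ x : Im (conjc x) = - Im x. Proof. by case: x. Qed.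

Lemma conjcD x y : conjc (x + y) = conjc x + conjc y.
Proof. exact: rmorphD. Qed.
Lemma conjcN x : conjc (- x) = - conjc x.
Proof. exact: rmorphN. Qed.
Lemma conjcM x y : conjc (x * y) = conjc x * conjc y.
Proof. exact: rmorphM. Qed.
Lemma conjc_sum (I : Type) (s : seq I) (P : pred I) (F : I -> R[i]) :
  conjc (\sum_(i <- s | P i) F i) = \sum_(i <- s | P i) conjc (F i).
Proof. exact: rmorph_sum. Qed.

Definition reimE := (ReD, ImD, ReN, ImN, ReM, ImM, ReJ, ImJ).

Lemma complexP x y : Re x = Re y -> Im x = Im y -> x = y.
Proof. by case: x y => [? ?] [? ?] /= -> ->. Qed.

Lemma sqmod_ge0 x : 0 <= sqmod x.
Proof. by rewrite addr_ge0// sqr_ge0. Qed.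

Lemma normcE x : normc x = Num.sqrt (sqmod x). Proof. by case: x. Qed.

Lemma normc_ge0 x : 0 <= normc x. Proof. by rewrite normcE sqrtr_ge0. Qed.

Lemma sqmodE x : sqmod x = normc x ^+ 2.
Proof. by rewrite normcE sqr_sqrtr// sqmod_ge0. Qed.

Lemma sqmodM x y : sqmod (x * y) = sqmod x * sqmod y.
Proof. by rewrite /sqmod !reimE; ring. Qed.

Lemma sqmodJ x : sqmod (conjc x) = sqmod x.
Proof. by rewrite /sqmod !reimE; ring. Qed.

Lemma normcJ x : normc (conjc x) = normc x.
Proof. by rewrite !normcE sqmodJ. Qed.

Lemma normcR a : normc (a%:C) = `|a|.
Proof. by rewrite normcE /sqmod /= expr0n addr0 sqrtr_sqr. Qed.

Lemma sqmodR a : sqmod (a%:C) = a ^+ 2.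
Proof. by rewrite /sqmod /= expr0n addr0. Qed.

Lemma mulcJ x : x * conjc x = (sqmod x)%:C.
Proof. by apply: complexP; rewrite !reimE /= /sqmod; ring. Qed.

Lemma normcB x y : normc (x - y) = normc (y - x).
Proof. by rewrite -normcN opprB. Qed.

Lemma le_normc_sum (I : Type) (s : seq I) (P : pred I) (F : I -> R[i]) :
  normc (\sum_(i <- s | P i) F i) <= \sum_(i <- s | P i) normc (F i).
Proof.
elim/big_ind2 : _ => [|x a y b xa yb|//]; first by rewrite normc0.
by rewrite (le_trans (le_normcD _ _))// lerD.
Qed.

Lemma Re_le_normc x : `|Re x| <= normc x.
Proof.
by rewrite normcE -sqrtr_sqr ler_wsqrtr// /sqmod lerDl sqr_ge0.
Qed.

Lemma Im_le_normc x : `|Im x| <= normc x.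
Proof.
by rewrite normcE -sqrtr_sqr ler_wsqrtr// /sqmod lerDr sqr_ge0.
Qed.

Lemma normc_le_ReIm x : normc x <= `|Re x| + `|Im x|.
Proof.
rewrite -ler_sqr ?nnegrE ?normc_ge0 ?addr_ge0// -sqmodE /sqmod.
by rewrite sqrrD !real_normK ?num_real// -addrA lerD2l lerDr mulrn_wge0// mulr_ge0.
Qed.

Lemma normc_le_eps x : (forall e, 0 < e -> normc x <= e) -> x = 0.
Proof.
move=> xe; apply/eq0_normc/eqP; rewrite eq_le normc_ge0 andbT.
by apply/ler_addgt0Pl => e e0; rewrite addr0 xe.
Qed.

Lemma normc_indic_le1 (U : Type) (A : set U) (u : U) : normc ((\1_A u)%:C : R[i]) <= 1.
Proof. by rewrite normcR indicE; case: (_ \in _); rewrite ?normr1 ?normr0. Qed.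

Lemma sqmodD_le x y : sqmod (x + y) <= 2 * (sqmod x + sqmod y).
Proof.
rewrite -subr_ge0 /sqmod !reimE.
rewrite (_ : _ - _ = (Re x - Re y) ^+ 2 + (Im x - Im y) ^+ 2); last by ring.
by rewrite addr_ge0// sqr_ge0.
Qed.

End complex_numbers.

Lemma cvgn0P (R : realType) (u : nat -> R) :
  u @ \oo --> 0 <->
  (forall e, 0 < e -> exists N, forall n, (N <= n)%N -> `|u n| < e).
Proof.
split=> [/cvgrPdist_lt h e e0|h].
  have [N _ hN] := h e e0; exists N => n Nn.
  by have := hN n Nn; rewrite /= sub0r normrN.
apply/cvgrPdist_lt => e e0; have [N hN] := h e e0.
by exists N => // n /= /hN; rewrite sub0r normrN.
Qed.

(** * Complex-valued square-integrable functions *)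

Section L2.
Context d (T : measurableType d) (R : realType).
Variable m : {measure set T -> \bar R}.
Implicit Types (X Y Z : T -> R[i]) (f g : T -> R).

Definition cmeas X :=
  measurable_fun setT (fun w => Re (X w)) /\
  measurable_fun setT (fun w => Im (X w)).

Definition nsq X : \bar R := \int[m]_w (sqmod (X w))%:E.

Definition L2 X :=
  [/\ measurable_fun setT (fun w => Re (X w)),
      measurable_fun setT (fun w => Im (X w)) & (nsq X < +oo)%E].

(** As [fine] sends infinity to 0, this is the norm only under [L2 X]. *)
Definition nrm X : R := Num.sqrt (fine (nsq X)).

Definition ip X Y : R[i] :=
  (\int[m]_w Re (X w * conjc (Y w)))%R +i* (\int[m]_w Im (X w * conjc (Y w)))%R.

Lemma L2_cmeas X : L2 X -> cmeas X. Proof. by case. Qed.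

Lemma cmeasD X Y : cmeas X -> cmeas Y -> cmeas (fun w => X w + Y w).
Proof.
by move=> [X1 X2] [Y1 Y2]; split; under eq_fun do rewrite reimE; exact: measurable_funD.
Qed.

Lemma cmeasM X Y : cmeas X -> cmeas Y -> cmeas (fun w => X w * Y w).
Proof.
move=> [X1 X2] [Y1 Y2]; split; under eq_fun do rewrite reimE.
  by apply: measurable_funB; exact: measurable_funM.
by apply: measurable_funD; exact: measurable_funM.
Qed.

Lemma cmeasJ X : cmeas X -> cmeas (fun w => conjc (X w)).
Proof.
move=> [X1 X2]; split; under eq_fun do rewrite reimE; first exact: X1.
exact: measurable_funN.
Qed.

Lemma cmeas_cst (c : R[i]) : cmeas (fun=> c).
Proof. by split; exact: measurable_cst. Qed.

Lemma cmeasN X : cmeas X -> cmeas (fun w => - X w).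
Proof.
by move=> mX; under eq_fun do rewrite -mulN1r; apply: cmeasM => //; exact: cmeas_cst.
Qed.

Lemma cmeas_real f : measurable_fun setT f -> cmeas (fun w => (f w)%:C).
Proof. by move=> mf; split => //=; exact: measurable_cst. Qed.

Lemma measurable_sqmod X : cmeas X -> measurable_fun setT (fun w => sqmod (X w)).
Proof. by move=> [X1 X2]; apply: measurable_funD; exact: measurable_funX. Qed.

Lemma nsq_ge0 X : (0 <= nsq X)%E.
Proof. by apply: integral_ge0 => w _; rewrite lee_fin sqmod_ge0. Qed.

Lemma nrm_ge0 X : 0 <= nrm X. Proof. exact: sqrtr_ge0. Qed.

Lemma sqr_nrm X : nrm X ^+ 2 = fine (nsq X).
Proof. by rewrite sqr_sqrtr// fine_ge0// nsq_ge0. Qed.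

Lemma nsqE X : L2 X -> nsq X = (nrm X ^+ 2)%:E.
Proof.
by move=> [_ _ h]; rewrite sqr_nrm fineK// ge0_fin_numE// nsq_ge0.
Qed.

Lemma L2_intsq X : L2 X <-> cmeas X /\ m.-integrable setT (fun w => (sqmod (X w))%:E).
Proof.
split.
  move=> [X1 X2 h]; split => //; apply/integrableP; split.
    by apply/measurable_EFinP; apply: measurable_sqmod.
  by under eq_integral do rewrite gee0_abs ?lee_fin ?sqmod_ge0//.
move=> [[X1 X2]] /integrableP [_]; split => //.
rewrite /nsq; move: b; under eq_integral do rewrite gee0_abs ?lee_fin ?sqmod_ge0//.
by [].
Qed.

Lemma L2_le X f : cmeas X -> m.-integrable setT (EFin \o f) ->
  (forall w, sqmod (X w) <= f w) -> L2 X.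
Proof.
move=> mX fi Xf; apply/L2_intsq; split => //; apply: le_integrable fi => //.
  by apply/measurable_EFinP; apply: measurable_sqmod.
move=> w _ /=; rewrite lee_fin !ger0_norm ?sqmod_ge0//.
exact: le_trans (sqmod_ge0 _) (Xf w).
Qed.

Lemma L2D X Y : L2 X -> L2 Y -> L2 (fun w => X w + Y w).
Proof.
move=> /L2_intsq[mX iX] /L2_intsq[mY iY].
apply: (@L2_le _ (fun w => 2 * (sqmod (X w) + sqmod (Y w)))).
- exact: cmeasD.
- rewrite [X in _.-integrable _ X](_ : _ =
     (fun w => 2%:E * ((fun w => (sqmod (X w))%:E) \+ (fun w => (sqmod (Y w))%:E)) w)%E);
   last by apply/funext => w /=; rewrite EFinM EFinD.
  by apply: integrableZl => //; apply: integrableD.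
- by move=> w; exact: sqmodD_le.
Qed.

Lemma L2Z c X : L2 X -> L2 (fun w => c * X w).
Proof.
move=> /L2_intsq[mX iX]; apply: (@L2_le _ (fun w => sqmod c * sqmod (X w))).
- by apply: cmeasM => //; exact: cmeas_cst.
- by rewrite [X in _.-integrable _ X](_ : _ =
     (fun w => (sqmod c)%:E * (sqmod (X w))%:E)%E)//; apply: integrableZl.
- by move=> w; rewrite sqmodM.
Qed.

Lemma L2N X : L2 X -> L2 (fun w => - X w).
Proof. by move=> /(L2Z (-1)); under eq_fun do rewrite mulN1r. Qed.

Lemma L2B X Y : L2 X -> L2 Y -> L2 (fun w => X w - Y w).
Proof. by move=> LX /L2N; exact: L2D. Qed.

Lemma L20 : L2 (fun=> 0).
Proof.
apply: (@L2_le _ (cst 0)); first exact: cmeas_cst.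
  exact: integrable0.
by move=> w; rewrite sqmodE normc0 expr0n.
Qed.

Lemma L2_sum (I : Type) (s : seq I) (P : pred I) (F : I -> T -> R[i]) :
  (forall i, L2 (F i)) -> L2 (fun w => \sum_(i <- s | P i) F i w).
Proof.
move=> LF; elim: s => [|i s ih].
  by under eq_fun do rewrite big_nil; exact: L20.
under eq_fun do rewrite big_cons.
by case: (P i) => //; exact: L2D.
Qed.

Lemma L2_bounded X (C : R) : (m setT < +oo)%E -> cmeas X ->
  (forall w, normc (X w) <= C) -> L2 X.
Proof.
move=> mT mX XC; apply: (@L2_le _ (cst (C ^+ 2))) => //.
  apply: measurable_bounded_integrable => //; exists (C ^+ 2); split.
    by rewrite num_real.
  by move=> ? ? ? _ /=; rewrite ger0_norm ?sqr_ge0// ltW.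
by move=> w; rewrite sqmodE /= ler_sqr ?nnegrE ?normc_ge0 ?(le_trans (normc_ge0 (X w))).
Qed.

Lemma L2_indic (A : set T) : (m setT < +oo)%E -> measurable A ->
  L2 (cindic A).
Proof.
move=> mT mA; apply: (L2_bounded (C := 1) mT) => [|w]; last exact: normc_indic_le1.
exact: cmeas_real.
Qed.

Lemma measure_lty (A : set T) : (m setT < +oo)%E -> measurable A -> (m A < +oo)%E.
Proof.
by move=> mT mA; apply: le_lt_trans mT; apply: le_measure; rewrite ?inE//; exact: measurableT.
Qed.

Lemma integrable_ReM X Y : L2 X -> L2 Y ->
  m.-integrable setT (EFin \o (fun w => Re (X w * conjc (Y w)))).
Proof.
move=> /L2_intsq[mX iX] /L2_intsq[mY iY].
apply: (@le_integrable _ _ _ _ _ _ _ (EFin \o (fun w => sqmod (X w) + sqmod (Y w)))) => //.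
- by apply/measurable_EFinP; case: (cmeasM mX (cmeasJ mY)).
- move=> w _ /=; rewrite lee_fin (ger0_norm (addr_ge0 (sqmod_ge0 _) (sqmod_ge0 _))).
  apply: (le_trans (Re_le_normc _)).
  rewrite normcM normcJ !sqmodE.
  have := sqr_ge0 (normc (X w) - normc (Y w)).
  have := normc_ge0 (X w); have := normc_ge0 (Y w); nra.
- by rewrite (_ : EFin \o _ = (fun w => (sqmod (X w))%:E) \+ (fun w => (sqmod (Y w))%:E))%E//;
    apply: integrableD.
Qed.

Lemma integrable_ImM X Y : L2 X -> L2 Y ->
  m.-integrable setT (EFin \o (fun w => Im (X w * conjc (Y w)))).
Proof.
(* [Im z] is the real part of [- 'i * z]. *)
move=> LX LY; have := integrable_ReM (L2Z (- 'i) LX) LY.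
apply: eq_integrable => // w _ /=; rewrite !reimE/=; congr EFin; ring.
Qed.

Lemma ipDl X Y Z : L2 X -> L2 Y -> L2 Z ->
  ip (fun w => X w + Y w) Z = ip X Z + ip Y Z.
Proof.
move=> LX LY LZ; apply: complexP; rewrite reimE /=.
  rewrite -RintegralD//; [|exact: integrable_ReM..].
  by apply: eq_Rintegral => w _; rewrite mulrDl reimE.
rewrite -RintegralD//; [|exact: integrable_ImM..].
by apply: eq_Rintegral => w _; rewrite mulrDl reimE.
Qed.

Lemma ipZl c X Y : L2 X -> L2 Y -> ip (fun w => c * X w) Y = c * ip X Y.
Proof.
move=> LX LY; have iR := integrable_ReM LX LY; have iI := integrable_ImM LX LY.
have integrableZ k f : m.-integrable setT (EFin \o f) ->
    m.-integrable setT (EFin \o (fun x => k * f x)).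
  by move=> fi; rewrite [X in _.-integrable _ X](_ : _ = (fun w => k%:E * (f w)%:E)%E)//;
    apply: integrableZl.
apply: complexP; rewrite reimE /=.
  rewrite -!RintegralZl// -RintegralB//; [|exact: integrableZ..].
  by apply: eq_Rintegral => w _; rewrite -mulrA reimE.
rewrite -!RintegralZl// -RintegralD//; [|exact: integrableZ..].
by apply: eq_Rintegral => w _; rewrite -mulrA reimE.
Qed.

Lemma ipJ X Y : L2 X -> L2 Y -> ip Y X = conjc (ip X Y).
Proof.
move=> LX LY; apply: complexP; rewrite reimE/=.
  by apply: eq_Rintegral => w _; rewrite !reimE; ring.
rewrite /Rintegral -fineN; congr fine.
rewrite -integralN; last first.
  by apply: (integrable_add_def measurableT); exact: (integrable_ImM LX LY).
by apply: eq_integral => w _; rewrite -EFinN !reimE; congr EFin; ring.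
Qed.

Lemma ipDr X Y Z : L2 X -> L2 Y -> L2 Z ->
  ip X (fun w => Y w + Z w) = ip X Y + ip X Z.
Proof.
move=> LX LY LZ; rewrite ipJ//; last exact: L2D.
by rewrite ipDl// conjcD -!ipJ.
Qed.

Lemma ipZr c X Y : L2 X -> L2 Y -> ip X (fun w => c * Y w) = conjc c * ip X Y.
Proof.
move=> LX LY; rewrite ipJ//; last exact: L2Z.
by rewrite ipZl// conjcM -ipJ.
Qed.

Lemma ipNr X Y : L2 X -> L2 Y -> ip X (fun w => - Y w) = - ip X Y.
Proof.
move=> LX LY; under eq_fun do rewrite -mulN1r.
by rewrite ipZr// conjcN conjc1 mulN1r.
Qed.

Lemma ipNl X Y : L2 X -> L2 Y -> ip (fun w => - X w) Y = - ip X Y.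
Proof.
move=> LX LY; rewrite ipJ//; last exact: L2N.
by rewrite ipNr// conjcN -ipJ.
Qed.

Lemma ipBr X Y Z : L2 X -> L2 Y -> L2 Z ->
  ip X (fun w => Y w - Z w) = ip X Y - ip X Z.
Proof. by move=> *; rewrite ipDr ?ipNr//; exact: L2N. Qed.

Lemma ipBl X Y Z : L2 X -> L2 Y -> L2 Z ->
  ip (fun w => X w - Y w) Z = ip X Z - ip Y Z.
Proof. by move=> *; rewrite ipDl ?ipNl//; exact: L2N. Qed.

Lemma ip0r X : ip X (fun=> 0) = 0.
Proof.
by rewrite /ip /Rintegral !integral0_eq// => w _; rewrite conjc0 mulr0.
Qed.

Lemma ip_sumr X (I : Type) (s : seq I) (P : pred I) (F : I -> T -> R[i]) :
  L2 X -> (forall i, L2 (F i)) ->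
  ip X (fun w => \sum_(i <- s | P i) F i w) = \sum_(i <- s | P i) ip X (F i).
Proof.
move=> LX LF; elim: s => [|i s ih].
  by under eq_fun do rewrite big_nil; rewrite big_nil ip0r.
under eq_fun do rewrite big_cons.
by rewrite big_cons; case: (P i) => //; rewrite ipDr ?ih//; exact: L2_sum.
Qed.

Lemma ip_suml X (I : Type) (s : seq I) (P : pred I) (F : I -> T -> R[i]) :
  L2 X -> (forall i, L2 (F i)) ->
  ip (fun w => \sum_(i <- s | P i) F i w) X = \sum_(i <- s | P i) ip (F i) X.
Proof.
move=> LX LF; rewrite ipJ//; last exact: L2_sum.
by rewrite ip_sumr// conjc_sum; apply: eq_bigr => i _; rewrite -ipJ.
Qed.

Lemma ip_nrm X : ip X X = (nrm X ^+ 2)%:C.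
Proof.
rewrite sqr_nrm; apply: complexP => /=; rewrite /Rintegral.
  by congr fine; apply: eq_integral => w _; rewrite mulcJ.
by under eq_integral do rewrite mulcJ/=; rewrite integral_cst//= mul0e.
Qed.

Lemma nrm_sqD X Y : L2 X -> L2 Y -> nrm (fun w => X w + Y w) ^+ 2 =
  nrm X ^+ 2 + nrm Y ^+ 2 + 2 * Re (ip X Y).
Proof.
move=> LX LY; apply: complexI; rewrite -ip_nrm.
rewrite ipDl ?ipDr//; try exact: L2D.
rewrite !ip_nrm (ipJ LX LY); apply: complexP; rewrite !reimE/=; ring.
Qed.

Lemma nrmZ c X : L2 X -> nrm (fun w => c * X w) = normc c * nrm X.
Proof.
move=> LX; apply/eqP; rewrite -(@eqrXn2 _ 2)// ?mulr_ge0 ?normc_ge0 ?nrm_ge0//.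
apply/eqP/complexI; rewrite -ip_nrm ipZl ?ipZr//; last exact: L2Z.
rewrite mulrA mulcJ ip_nrm sqmodE exprMn.
by apply: complexP; rewrite !reimE /=; ring.
Qed.

Lemma nrmN X : nrm (fun w => - X w) = nrm X.
Proof.
by rewrite /nrm /nsq; under eq_integral do rewrite /sqmod !reimE !sqrrN.
Qed.

Lemma nrmB X Y : nrm (fun w => X w - Y w) = nrm (fun w => Y w - X w).
Proof. by rewrite -nrmN; under eq_fun do rewrite opprB. Qed.

Lemma nrm0 : nrm (fun=> 0) = 0.
Proof.
by rewrite /nrm /nsq; under eq_integral do rewrite sqmodE normc0 expr0n;
  rewrite integral_cst//= mul0e sqrtr0.
Qed.

(* Positivity of [||N Y * X - <X,Y> Y||^2] with [N = ||Y||^2], after division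
   by [N]; the case [N = 0] is treated with a free multiple of [<X,Y>]. *)
Lemma cauchy_schwarz X Y : L2 X -> L2 Y -> normc (ip X Y) <= nrm X * nrm Y.
Proof.
move=> LX LY.
have key (t : R) : 0 <= nrm X ^+ 2 + t ^+ 2 * sqmod (ip X Y) * nrm Y ^+ 2
    - 2 * t * sqmod (ip X Y).
  have := sqr_ge0 (nrm (fun w => X w + (- (t%:C) * ip X Y) * Y w)).
  rewrite nrm_sqD//; last exact: L2Z.
  rewrite nrmZ// ipZr// exprMn -sqmodE.
  rewrite (_ : _ + _ = nrm X ^+ 2 + t ^+ 2 * sqmod (ip X Y) * nrm Y ^+ 2
    - 2 * t * sqmod (ip X Y))//.
  rewrite /sqmod !reimE /=; ring.
rewrite -ler_sqr ?nnegrE ?mulr_ge0 ?nrm_ge0 ?normc_ge0// -sqmodE exprMn.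
have s0 := sqmod_ge0 (ip X Y); have := sqr_ge0 (nrm X).
have := sqr_ge0 (nrm Y); rewrite le_eqVlt => /predU1P[y0|y0] x0.
  have := key ((nrm X ^+ 2 + 1) / (2 * sqmod (ip X Y))).
  rewrite -y0 mulr0 addr0 mulr0; have [->//|sn0] := eqVneq (sqmod (ip X Y)) 0.
  have -> : 2 * ((nrm X ^+ 2 + 1) / (2 * sqmod (ip X Y))) * sqmod (ip X Y) = nrm X ^+ 2 + 1.
    by field.
  by lra.
have := key (1 / nrm Y ^+ 2).
have -> : (1 / nrm Y ^+ 2) ^+ 2 * sqmod (ip X Y) * nrm Y ^+ 2 =
   sqmod (ip X Y) / nrm Y ^+ 2 by field; move: y0; rewrite lt0r sqrf_eq0 => /andP[].
rewrite -(pmulr_lge0 _ y0).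
have -> : (nrm X ^+ 2 + sqmod (ip X Y) / nrm Y ^+ 2 - 2 * (1 / nrm Y ^+ 2) * sqmod (ip X Y))
   * nrm Y ^+ 2 = nrm X ^+ 2 * nrm Y ^+ 2 - sqmod (ip X Y).
  by field; move: y0; rewrite lt0r sqrf_eq0 => /andP[].
by lra.
Qed.

Lemma nrmD_le X Y : L2 X -> L2 Y -> nrm (fun w => X w + Y w) <= nrm X + nrm Y.
Proof.
move=> LX LY.
rewrite -ler_sqr ?nnegrE ?addr_ge0 ?nrm_ge0// nrm_sqD//.
have := cauchy_schwarz LX LY; have := Re_le_normc (ip X Y).
have := ler_norm (Re (ip X Y)); rewrite sqrrD; lra.
Qed.

Lemma nrm_triangle Y X Z : L2 X -> L2 Y -> L2 Z ->
  nrm (fun w => X w - Z w) <= nrm (fun w => X w - Y w) + nrm (fun w => Y w - Z w).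
Proof.
move=> LX LY LZ; apply: le_trans (nrmD_le _ _); [|exact: L2B..].
by under [in leRHS]eq_fun do rewrite addrA subrK.
Qed.

Lemma nrm_dist X Y : L2 X -> L2 Y -> `|nrm X - nrm Y| <= nrm (fun w => X w - Y w).
Proof.
move=> LX LY; rewrite ler_norml.
have h1 : nrm X <= nrm (fun w => X w - Y w) + nrm Y.
  apply: le_trans (nrmD_le (L2B LX LY) LY).
  by under [in leRHS]eq_fun do rewrite subrK.
have h2 : nrm Y <= nrm (fun w => Y w - X w) + nrm X.
  apply: le_trans (nrmD_le (L2B LY LX) LX).
  by under [in leRHS]eq_fun do rewrite subrK.
by move: h2; rewrite (nrmB Y X); lra.
Qed.

(** Meant for the two coordinates of a graph closure; the denominator [normc c + 1] covers
    [c = 0]. *)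
Lemma nrm_lincomb_lt (c : R[i]) X X' Y Y' (e : R) : L2 X -> L2 X' -> L2 Y -> L2 Y' ->
  nrm (fun w => X' w - X w) < e / 2 -> nrm (fun w => Y' w - Y w) < e / 2 / (normc c + 1) ->
  nrm (fun w => X' w + c * Y' w - (X w + c * Y w)) < e.
Proof.
move=> LX LX' LY LY' hX hY; have c0 : 0 < normc c + 1 by rewrite ltr_wpDl ?normc_ge0.
rewrite (_ : (fun w => _) = (fun w => (X' w - X w) + c * (Y' w - Y w))); last first.
  by apply/funext => w; ring.
apply: le_lt_trans (nrmD_le (L2B LX' LX) (L2Z c (L2B LY' LY))) _.
rewrite nrmZ; last exact: L2B.
move: hY; rewrite ltr_pdivlMr// mulrDr mulr1 mulrC.
have := nrm_ge0 (fun w => Y' w - Y w); lra.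
Qed.

Lemma nsq_ae X Y : cmeas X -> cmeas Y -> {ae m, forall w, X w = Y w} ->
  nsq X = nsq Y.
Proof.
move=> mX mY XY; apply: ge0_ae_eq_integral => //.
- by apply/measurable_EFinP; exact: measurable_sqmod.
- by apply/measurable_EFinP; exact: measurable_sqmod.
- by move=> w _; rewrite lee_fin sqmod_ge0.
- by move=> w _; rewrite lee_fin sqmod_ge0.
- by apply: filterS XY => w -> _.
Qed.

Lemma L2_ae X Y : L2 X -> cmeas Y -> {ae m, forall w, X w = Y w} -> L2 Y.
Proof.
move=> LX [Y1 Y2] XY; split => //; rewrite -(nsq_ae _ _ XY)//; first by case: LX.
exact: L2_cmeas.
Qed.

Lemma nrm_ae0 X Y : L2 X -> L2 Y -> {ae m, forall w, X w = Y w} ->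
  nrm (fun w => X w - Y w) = 0.
Proof.
move=> LX LY XY; rewrite -nrm0 /nrm; congr (Num.sqrt (fine _)).
apply: nsq_ae; [exact: L2_cmeas (L2B LX LY)|exact: cmeas_cst|].
by apply: filterS XY => w ->; rewrite subrr.
Qed.

(** By Cauchy-Schwarz. This replaces the identification of functions that are equal almost
    everywhere. *)
Lemma ip_nrm0r X Y Z : L2 X -> L2 Y -> L2 Z -> nrm (fun w => X w - Y w) = 0 ->
  ip Z X = ip Z Y.
Proof.
move=> LX LY LZ XY; apply/eqP; rewrite -subr_eq0 -ipBr//; apply/eqP/eq0_normc.
apply/eqP; rewrite eq_le normc_ge0 andbT.
by rewrite (le_trans (cauchy_schwarz LZ (L2B LX LY)))// XY mulr0.
Qed.

Lemma ae_null_setC (S : set T) (Q : T -> Prop) : measurable S -> m (~` S) = 0%E ->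
  (forall w, S w -> Q w) -> {ae m, forall w, Q w}.
Proof.
move=> mS S0 SQ; exists (~` S); split => //; first exact: measurableC.
by move=> w /= nQ Sw; apply: nQ; exact: SQ.
Qed.

Lemma L2_indic_bound X (A : set T) (C : R) : measurable A -> (m A < +oo)%E ->
  cmeas X -> 0 <= C -> (forall w, normc (X w) <= C * \1_A w) ->
  L2 X /\ nrm X <= C * Num.sqrt (fine (m A)).
Proof.
move=> mA mAoo mX C0 XC.
have XC2 w : sqmod (X w) <= C ^+ 2 * \1_A w.
  have -> : C ^+ 2 * \1_A w = (C * \1_A w) ^+ 2.
    by rewrite exprMn indicE; case: (w \in A); rewrite ?expr1n ?expr0n.
  by rewrite sqmodE ler_sqr ?nnegrE ?normc_ge0 ?mulr_ge0.
have iA : m.-integrable setT (fun w => (C ^+ 2)%:E * (\1_A w)%:E)%E.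
  apply: integrableZl => //; apply/integrableP; split; first exact/measurable_EFinP.
  by under eq_integral do rewrite gee0_abs ?lee_fin//; rewrite integral_indic// setIT.
have LX : L2 X by apply: (L2_le mX _ XC2); exact: iA.
split => //; rewrite -ler_sqr ?nnegrE ?mulr_ge0 ?nrm_ge0 ?sqrtr_ge0//.
rewrite exprMn [X in _ <= _ * X]sqr_sqrtr ?fine_ge0// -lee_fin -nsqE//.
rewrite EFinM fineK ?ge0_fin_numE//.
apply: (@le_trans _ _ (\int[m]_w ((C ^+ 2)%:E * (\1_A w)%:E))%E).
  apply: ge0_le_integral => //.
  - by move=> w _; rewrite lee_fin sqmod_ge0.
  - by apply/measurable_EFinP; exact: measurable_sqmod.
  - by case/integrableP : iA.
  - by move=> w _; rewrite -EFinM lee_fin.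
rewrite ge0_integralZl//; last 2 first.
  - exact/measurable_EFinP.
  - by rewrite lee_fin sqr_ge0.
by rewrite integral_indic// setIT.
Qed.

(** As [m] is carried by [S], multiplying [X] by the indicator of [S] does not change its norm. *)
Lemma nrm_bound X (S : set T) (C : R) : measurable S -> m (~` S) = 0%E ->
  (m S < +oo)%E -> L2 X -> 0 <= C -> (forall w, S w -> normc (X w) <= C) ->
  nrm X <= C * Num.sqrt (fine (m S)).
Proof.
move=> mS S0 mSoo LX C0 XC.
have mX := L2_cmeas LX.
have mX' : cmeas (fun w => X w * (\1_S w)%:C).
  by apply: cmeasM => //; apply: cmeas_real.
have [|LX' +] := L2_indic_bound mS mSoo mX' C0.
  move=> w; rewrite indicE normcM normcR; have [Sw|_] := boolP (w \in S).
    by rewrite normr1 ?mulr1 XC//; rewrite inE in Sw.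
  by rewrite normr0 !mulr0.
have ->// : nrm (fun w => X w * (\1_S w)%:C) = nrm X.
  rewrite /nrm; congr (Num.sqrt (fine _)); apply: nsq_ae => //.
  apply: (ae_null_setC mS S0) => w Sw.
  by rewrite indicE mem_set// mulr1.
Qed.

Lemma cvg_nrm_sq (X : nat -> T -> R[i]) : (forall n, L2 (X n)) ->
  (nsq (X n) @[n --> \oo] --> 0%E) <-> (nrm (X n) @[n --> \oo] --> 0).
Proof.
move=> LX; split.
  move=> /fine_cvgP[_]; rewrite -[X in _ --> X]/(fine 0) => h.
  have -> : 0 = Num.sqrt 0 :> R by rewrite sqrtr0.
  by apply: (cvg_comp _ _ h); exact: sqrt_continuous.
move=> h; under eq_fun do rewrite nsqE//.
apply: cvg_EFin; first by near=> n.
have -> : 0 = 0 ^+ 2 :> R by rewrite expr0n.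
exact: (cvg_comp _ _ h (@exprn_continuous R 2 0)).
Unshelve. all: by end_near. Qed.

Lemma nrm_cvg0_bounded (X : nat -> T -> R[i]) (C : R) : (m setT < +oo)%E ->
  (forall n, cmeas (X n)) -> (forall n w, normc (X n w) <= C) ->
  {ae m, forall w, sqmod (X n w) @[n --> \oo] --> 0} ->
  nrm (X n) @[n --> \oo] --> 0.
Proof.
move=> mT mX XC X0; have LX n := L2_bounded mT (mX n) (XC n).
apply/(cvg_nrm_sq LX).
have := @dominated_convergence _ _ _ m setT measurableT
  (fun n w => (sqmod (X n w))%:E) (cst 0%E) (cst (C ^+ 2)%:E).
rewrite integral_cst//= mul0e; case => //.
- by move=> n; apply/measurable_EFinP; exact: measurable_sqmod.
- by apply: filterS X0 => w Xw _; apply: cvg_EFin => //; near=> n.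
- apply: (@measurable_bounded_integrable _ _ _ m (cst (C ^+ 2))) => //.
  exists (C ^+ 2); split; first by rewrite num_real.
  by move=> ? ? ? _ /=; rewrite ger0_norm ?sqr_ge0// ltW.
- apply: aeW => w n _ /=; rewrite lee_fin ger0_norm ?sqmod_ge0// sqmodE.
  by rewrite ler_sqr ?nnegrE ?normc_ge0// (le_trans _ (XC n w))// normc_ge0.
Unshelve. all: by end_near. Qed.

End L2.

Lemma cvg_bounded_variation (R : realType) (f : nat -> R) (B : R) :
  (forall k, \sum_(0 <= i < k) `|f i.+1 - f i| <= B) -> cvgn f.
Proof.
move=> fB; have : cvgn (series (fun i => f i.+1 - f i)).
  apply: normed_cvg; apply: nondecreasing_is_cvgn.
    apply: (@nondecreasing_series _ (fun i => `|f i.+1 - f i|) xpredT) => n _ _.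
    exact: normr_ge0.
  by exists B => _ [k _ <-]; exact: fB.
move=> /(@is_cvgD _ _ _ _ _ (cst (f 0)) _ (is_cvg_cst _)).
rewrite (_ : _ + _ = f)//; apply/funext => n.
by rewrite /= /cst /series/= addrfctE telescope_sumr// addrC subrK.
Qed.

(** * Completeness of the space of square-integrable functions *)

Section L2_complete.
Context d (T : measurableType d) (R : realType).
Variable m : {measure set T -> \bar R}.

(** Riesz-Fischer: pointwise convergence off a null set, then Fatou's lemma for the rate. The series
    of increments is controlled through weighted squares, whose integrals are known even when [m] is
    infinite; the integrals of the increments themselves are not. *)
Lemma L2_complete (X : nat -> T -> R[i]) : (forall n, L2 m (X n)) ->
  (forall n, nrm m (fun w => X n.+1 w - X n w) <= 4^-1 ^+ n) ->
  exists Y, L2 m Y /\ forall n, nrm m (fun w => X n w - Y w) <= 2 * 4^-1 ^+ n.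
Proof.
move=> LX Xcauchy.
pose D n w := X n.+1 w - X n w.
have LD n : L2 m (D n) by exact: L2B.
pose g w : \bar R := (\sum_(n <oo) (2 ^+ n * sqmod (D n w))%:E)%E.
have mg n : measurable_fun setT (fun w => (2 ^+ n * sqmod (D n w))%:E).
  apply/measurable_EFinP; apply: measurable_funM => //.
  exact: measurable_sqmod (L2_cmeas (LD n)).
have g0 n w : (0 <= (2 ^+ n * sqmod (D n w))%:E)%E.
  by rewrite lee_fin mulr_ge0 ?exprn_ge0 ?sqmod_ge0.
have half n : \sum_(0 <= i < n) (2^-1 : R) ^+ i <= 2.
  have := @geometric_le_lim R n 1 (2^-1) ler01.
  rewrite /series/=; under eq_bigr do rewrite mul1r.
  have -> : 1 / (1 - 2^-1) = 2 :> R by field.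
  by apply; [lra|rewrite ger0_norm; lra].
have ig : m.-integrable setT g.
  apply/integrableP; split.
    have := @ge0_emeasurable_sum _ _ _ setT
      (fun n w => (2 ^+ n * sqmod (D n w))%:E) xpredT (fun k w _ _ => g0 k w)
      (fun k _ => mg k).
    by [].
  rewrite (eq_integral g); last first.
    by move=> w _; rewrite gee0_abs//; apply: nneseries_ge0.
  rewrite integral_nneseries//.
  apply: (@le_lt_trans _ _ 2%:E); last exact: ltry.
  apply: lime_le; first by apply: is_cvg_nneseries => n _ _; exact: integral_ge0.
  apply: nearW => n; rewrite (le_trans _ (_ : ((\sum_(0 <= i < n) (2^-1 : R) ^+ i)%:E <= _)%E))//.
  rewrite -sumEFin; apply: lee_sum => k _.
  under eq_integral do rewrite EFinM.
  rewrite ge0_integralZl//; last 2 first.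
  - by apply/measurable_EFinP; exact: measurable_sqmod (L2_cmeas (LD k)).
  - by move=> w _; rewrite lee_fin sqmod_ge0.
  rewrite -/(nsq m _) (nsqE (LD k)) -EFinM lee_fin.
  (* The product is [8 ^ -k], weakened to [2 ^ -k] in order to use [half]. *)
  apply: (@le_trans _ _ (2 ^+ k * (4^-1 ^+ k) ^+ 2)).
    by rewrite ler_pM2l ?exprn_gt0// ler_sqr ?nnegrE ?nrm_ge0 ?exprn_ge0 ?invr_ge0//; exact: Xcauchy.
  rewrite -exprM mulnC exprM -exprMn; have -> : 2 * 4^-1 ^+ 2 = 8^-1 :> R by field.
    by rewrite lerXn2r ?nnegrE ?invr_ge0//; lra.
  by rewrite lee_fin; exact: half.
have [N [mN N0 gN]] := integrable_ae measurableT ig.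
pose S := ~` N.
have mS : measurable S by exact: measurableC.
have S0 : m (~` S) = 0%E by rewrite setCK.
have Sg w : S w -> g w \is a fin_num.
  by move=> Sw; apply: contrapT => gw; apply: Sw; apply: gN => /= /(_ I).
(* With [a = 2 ^ i], from [2 x <= a^-1 + a x ^ 2]: finiteness of [g] bounds the total variation of
   the sequence at [w]. *)
have DB w k : S w -> \sum_(0 <= i < k) normc (D i w) <= (2 + fine (g w)) / 2.
  move=> Sw; apply: (@le_trans _ _ (\sum_(0 <= i < k) (2^-1 ^+ i + 2 ^+ i * sqmod (D i w)) / 2)).
    apply: ler_sum => i _; rewrite ler_pdivlMr// sqmodE.
    rewrite exprVn; set a : R := 2 ^+ i; set x := normc _.
    have a0 : 0 < a by rewrite exprn_gt0.
    rewrite -subr_ge0 (_ : _ - _ = a^-1 * (1 - a * x) ^+ 2); last by field; rewrite gt_eqF.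
    by rewrite mulr_ge0 ?sqr_ge0// invr_ge0 ltW.
  rewrite -mulr_suml ler_pM2r ?invr_gt0// big_split/= lerD//.
  rewrite -lee_fin fineK ?Sg// -sumEFin; apply: nneseries_lim_ge => n _ _; exact: g0.
(* Set to 0 on the null set, the sequence converges everywhere, so its limit is measurable. *)
pose X' n w := X n w * (\1_S w)%:C.
have mX' n : cmeas (X' n).
  by apply: cmeasM; [exact: L2_cmeas (LX n)|exact: cmeas_real].
have X'X n : {ae m, forall w, X n w = X' n w}.
  by apply: (ae_null_setC mS S0) => w Sw; rewrite /X' indicE mem_set// mulr1.
have LX' n : L2 m (X' n) by exact: (L2_ae (LX n) (mX' n) (X'X n)).
have X'D w k : \sum_(0 <= i < k) normc (X' i.+1 w - X' i w) <=
    (2 + fine (g w)) / 2 * \1_S w.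
  rewrite indicE; case: (boolP (w \in S)) => [wS|wS].
    rewrite inE in wS; rewrite mulr1 (le_trans _ (DB w k wS))//.
    by apply: ler_sum => i _; rewrite /X' indicE mem_set// !mulr1.
  by rewrite big1 ?mulr0// => i _; rewrite /X' indicE (negbTE wS) !mulr0 subrr normc0.
have cR w : cvgn (fun n => Re (X' n w)).
  apply: (@cvg_bounded_variation _ _ ((2 + fine (g w)) / 2 * \1_S w)) => k.
  apply: le_trans (X'D w k); apply: ler_sum => i _.
  by rewrite -ReN -ReD Re_le_normc.
have cI w : cvgn (fun n => Im (X' n w)).
  apply: (@cvg_bounded_variation _ _ ((2 + fine (g w)) / 2 * \1_S w)) => k.
  apply: le_trans (X'D w k); apply: ler_sum => i _.
  by rewrite -ImN -ImD Im_le_normc.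
pose Y w := limn (fun n => Re (X' n w)) +i* limn (fun n => Im (X' n w)).
have mY : cmeas Y.
  split.
    apply: (@measurable_fun_cvg _ _ _ _ (fun n w => Re (X' n w))).
      by move=> n; case: (mX' n).
    by move=> w _; exact: cR.
  apply: (@measurable_fun_cvg _ _ _ _ (fun n w => Im (X' n w))).
    by move=> n; case: (mX' n).
  by move=> w _; exact: cI.
have distX n k : (n <= k)%N -> nrm m (fun w => X n w - X k w) <= 2 * 4^-1 ^+ n.
  move=> /subnK <-; set j := (k - n)%N.
  (* The exact value of the geometric sum, which the induction on [j] requires; [4 / 3] is then
     weakened to 2. *)
  have : nrm m (fun w => X n w - X (j + n)%N w) <= 4 / 3 * (1 - 4^-1 ^+ j) * 4^-1 ^+ n.
    elim: j => [|j ih].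
      rewrite add0n; under eq_fun do rewrite subrr.
      by rewrite nrm0 expr0 subrr mulr0 mul0r.
    apply: le_trans (nrm_triangle (LX n) (LX (j + n)%N) (LX (j.+1 + n)%N)) _.
    apply: le_trans (lerD ih _) _; first by rewrite nrmB; exact: Xcauchy.
    rewrite exprD -mulrDl ler_pM2r ?exprn_gt0 ?invr_gt0// exprS; lra.
  move=> /le_trans; apply; rewrite ler_wpM2r ?exprn_ge0 ?invr_ge0//.
  have : 0 <= (4^-1 : R) ^+ j by rewrite exprn_ge0 ?invr_ge0.
  lra.
have key n : (nsq m (fun w => X' n w - Y w)%R <= ((2 * 4^-1 ^+ n) ^+ 2)%:E)%E.
  have E w : (sqmod (X' n w - Y w))%:E =
      limn_einf (fun k => (sqmod (X' n w - X' k w))%:E).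
    have h : (sqmod (X' n w - X' k w))%:E @[k --> \oo] --> (sqmod (X' n w - Y w))%:E.
      apply: cvg_EFin; first by near=> k.
      rewrite /sqmod; under eq_fun do rewrite /= !(ReD, ImD, ReN, ImN).
      rewrite !(ReD, ImD, ReN, ImN); apply: cvgD; apply: (@cvg_comp _ _ _ _ (fun x : R => x ^+ 2));
        try exact: exprn_continuous; apply: cvgB => //; exact: cvg_cst.
    by rewrite is_cvg_limn_einfE ?(cvg_lim _ h)//; apply/cvg_ex; eexists; exact: h.
  rewrite /nsq (eq_integral _ _ (fun w _ => E w)).
  apply: le_trans (fatou _ _ _ _) _ => //.
  - move=> k; apply/measurable_EFinP; apply: measurable_sqmod.
    exact: cmeasD (mX' n) (cmeasN (mX' k)).
  - by move=> k w _; rewrite lee_fin sqmod_ge0.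
  rewrite limn_einf_lim; apply: lime_le; first exact: is_cvg_einfs.
  (* An index beyond [k] bounds the infimum; [maxn n k] is also beyond [n], as [distX] demands. *)
  apply: nearW => k; apply: (@le_trans _ _ (nsq m (fun w => X' n w - X' (maxn n k) w))).
    by apply: ereal_inf_lbound; exists (maxn n k) => //=; exact: leq_maxr.
  rewrite (@nsq_ae _ _ _ _ _ (fun w => X n w - X (maxn n k) w)).
  - rewrite nsqE; last exact: L2B.
    rewrite lee_fin ler_sqr ?nnegrE ?nrm_ge0 ?mulr_ge0 ?exprn_ge0 ?invr_ge0//.
    by apply: distX; exact: leq_maxl.
  - exact: cmeasD (mX' n) (cmeasN (mX' _)).
  - exact: L2_cmeas (L2B (LX _) (LX _)).
  - by apply: filterS2 (X'X n) (X'X (maxn n k)) => w -> ->.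
have LXY n : L2 m (fun w => X' n w - Y w).
  have [h1 h2] := cmeasD (mX' n) (cmeasN mY).
  by split => //; apply: le_lt_trans (key n) _; exact: ltry.
have LY : L2 m Y.
  have := L2B (LX' 0%N) (LXY 0%N); congr L2; apply/funext => w.
  by rewrite opprB addrC subrK.
exists Y; split => // n.
have -> : nrm m (fun w => X n w - Y w) = nrm m (fun w => X' n w - Y w).
  rewrite /nrm; congr (Num.sqrt (fine _)); apply: nsq_ae.
  - exact: L2_cmeas (L2B (LX n) LY).
  - exact: L2_cmeas (LXY n).
  - by apply: filterS (X'X n) => w ->.
rewrite -ler_sqr ?nnegrE ?nrm_ge0 ?mulr_ge0 ?exprn_ge0 ?invr_ge0//.
by rewrite -lee_fin -nsqE//; exact: key.
Unshelve. all: by end_near. Qed.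

End L2_complete.

(** * Trigonometric polynomials and their density *)

Section expi.
Context (R : realType).
Implicit Types x y : R.

Lemma expi0 : expi (0 : R) = 1. Proof. by rewrite /expi cos0 sin0. Qed.

Lemma expiD x y : expi (x + y) = expi x * expi y.
Proof. by apply: complexP; rewrite !reimE /= ?cosD ?sinD; ring. Qed.

Lemma expiN x : expi (- x) = conjc (expi x).
Proof. by rewrite /expi cosN sinN. Qed.

Lemma sqmod_expi x : sqmod (expi x) = 1.
Proof. by rewrite /sqmod /= cos2Dsin2. Qed.

Lemma normc_expi x : normc (expi x) = 1.
Proof. by rewrite normcE sqmod_expi sqrtr1. Qed.

Lemma expi2pi : expi (2 * pi : R) = 1.
Proof. by rewrite /expi mulrC mulr_natr cos2pi sin2pi. Qed.

Lemma expiMn x n : expi (x * n%:R) = expi x ^+ n.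
Proof.
elim: n => [|n ih]; first by rewrite mulr0 expi0 expr0.
by rewrite -natr1 mulrDr mulr1 expiD ih exprSr.
Qed.

Lemma expi_periodic (k m : int) x :
  expi ((x + 2 * pi * m%:~R) * k%:~R) = expi (x * k%:~R).
Proof.
have h (n : nat) : expi (2 * pi * n%:R : R) = 1 by rewrite expiMn expi2pi expr1n.
have h' (z : int) : expi (2 * pi * z%:~R : R) = 1.
  case: z => n; first by rewrite h.
  by rewrite NegzE mulrNz mulrN expiN h conjc1.
by rewrite mulrDl expiD -mulrA -intrM h' mulr1.
Qed.

Lemma lipschitz_of_bounded_derive (f df : R -> R) (C : R) x y :
  (forall z, is_derive z (1 : R) f (df z)) -> (forall z, `|df z| <= C) ->
  `|f x - f y| <= C * `|x - y|.
Proof.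
move=> fdf dfC; wlog xy : x y / y <= x.
  move=> h; have [/h//|/ltW/h] := leP y x.
  by rewrite distrC (distrC x).
have fc : {within `[y, x], continuous f}%classic.
  by apply: derivable_within_continuous => z _; apply: ex_derive; exact: fdf.
have [c _ ->] := @MVT_segment R f df y x xy (fun z _ => fdf z) fc.
by rewrite normrM ler_wpM2r.
Qed.

Lemma expi_lipschitz x y : normc (expi x - expi y) <= 2 * `|x - y|.
Proof.
apply: le_trans (normc_le_ReIm _) _.
rewrite !reimE/= mulrDl mul1r lerD// -[leRHS]mul1r.
  apply: (@lipschitz_of_bounded_derive _ (fun z => - sin z)) => z.
  by rewrite normrN sin_max.
by apply: (@lipschitz_of_bounded_derive _ cos) => z; rewrite cos_max.
Qed.

Lemma cmeas_expi (k : R) : @cmeas _ (measurableTypeR R) R (fun x => expi (x * k)).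
Proof.
split; apply: continuous_measurable_fun => x /=.
  apply: (@continuous_comp _ _ _ (fun x => x * k) cos); last exact: continuous_cos.
  exact: mulrr_continuous.
apply: (@continuous_comp _ _ _ (fun x => x * k) sin); last exact: continuous_sin.
exact: mulrr_continuous.
Qed.

End expi.

Section trigonometric_polynomials.
Context (R : realType).
Implicit Types (s t : seq (R[i] * int)) (x : R).

(* A list of pairs (coefficient, frequency); frequencies may repeat. *)
Definition trig s x : R[i] := \sum_(c <- s) c.1 * expi (x * c.2%:~R).

(** The value at [trig s] of the linear map sending [e^(ikx)] to [X k]. It is defined on lists,
    since independence from the list holds only up to null functions. *)
Definition trig_apply (T : Type) (X : int -> T -> R[i]) s (w : T) : R[i] :=
  \sum_(c <- s) c.1 * X c.2 w.

Definition trig_scale (a : R[i]) s := [seq (a * c.1, c.2) | c <- s].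
Definition trig_mul s t := [seq (c.1 * d.1, c.2 + d.2) | c <- s, d <- t].
Definition trig_conj s := [seq (conjc c.1, - c.2) | c <- s].

Lemma trig_cat s t x : trig (s ++ t) x = trig s x + trig t x.
Proof. by rewrite /trig big_cat. Qed.

Lemma trig_scaleE a s x : trig (trig_scale a s) x = a * trig s x.
Proof. by rewrite /trig big_map mulr_sumr; apply: eq_bigr => c _; rewrite mulrA. Qed.

Lemma trig_mulE s t x : trig (trig_mul s t) x = trig s x * trig t x.
Proof.
rewrite /trig big_allpairs_dep/= mulr_suml; apply: eq_bigr => c _.
rewrite mulr_sumr; apply: eq_bigr => e _.
by rewrite /= intrD mulrDr expiD; ring.
Qed.

Lemma trig_conjE s x : trig (trig_conj s) x = conjc (trig s x).
Proof.
rewrite /trig big_map conjc_sum; apply: eq_bigr => c _.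
by rewrite conjcM /= mulrNz mulrN expiN.
Qed.

Lemma trig_bound s x : normc (trig s x) <= \sum_(c <- s) normc c.1.
Proof.
apply: le_trans (le_normc_sum _ _ _) _.
by apply: ler_sum => c _; rewrite normcM normc_expi mulr1.
Qed.

Lemma cmeas_trig s : @cmeas _ (measurableTypeR R) R (trig s).
Proof.
rewrite /trig; elim: s => [|c s ih].
  by under eq_fun do rewrite big_nil; exact: cmeas_cst.
under eq_fun do rewrite big_cons.
by apply: cmeasD => //; apply: cmeasM; [exact: cmeas_cst|exact: cmeas_expi].
Qed.

Lemma trig_periodic s x (m : int) : trig s (x + 2 * pi * m%:~R) = trig s x.
Proof. by apply: eq_bigr => c _; rewrite expi_periodic. Qed.

Definition real_trig (f : R -> R) := exists s, forall x, (f x)%:C = trig s x.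

Lemma real_trigD f g : real_trig f -> real_trig g -> real_trig (fun x => f x + g x).
Proof.
by move=> [s fs] [t gt]; exists (s ++ t) => x; rewrite trig_cat -fs -gt rmorphD.
Qed.

Lemma real_trigM f g : real_trig f -> real_trig g -> real_trig (fun x => f x * g x).
Proof.
by move=> [s fs] [t gt]; exists (trig_mul s t) => x; rewrite trig_mulE -fs -gt rmorphM.
Qed.

Lemma real_trig_cst a : real_trig (fun=> a).
Proof.
by exists [:: (a%:C, 0)] => x; rewrite /trig big_seq1/= mulr0 expi0 mulr1.
Qed.

Lemma real_trig_cos (a : R) : real_trig (fun x => cos (x - a)).
Proof.
exists [:: (2^-1%:C * expi (- a), 1); (2^-1%:C * expi a, -1)] => x.
rewrite /trig big_cons big_seq1/= mulr1 mulrN mulr1 expiN (expiN x).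
by apply: complexP; rewrite !reimE/= ?cosB; field.
Qed.

Lemma real_trigX f n : real_trig f -> real_trig (fun x => f x ^+ n).
Proof.
move=> rf; elim: n => [|n ih]; first exact: real_trig_cst.
by under eq_fun do rewrite exprS; exact: real_trigM.
Qed.

End trigonometric_polynomials.

Section sign_iteration.
Context (R : realType).
Implicit Types u : R.

(* The iterates of [u |-> (3 u - u^3) / 2] on [-1, 1] converge to the sign. *)
Fixpoint sgn_approx (n : nat) u : R :=
  if n is n.+1 then (3 * sgn_approx n u - sgn_approx n u ^+ 3) / 2 else u.

Lemma sgn_approxN n u : sgn_approx n (- u) = - sgn_approx n u.
Proof. by elim: n => //= n ->; rewrite exprNn; ring. Qed.

Lemma sgn_approx_itv n u : 0 <= u -> u <= 1 -> u <= sgn_approx n u <= 1.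
Proof.
move=> u0 u1; elim: n => [|n /andP[ih1 ih2]]/=; first by rewrite lexx.
set v := sgn_approx n u in ih1 ih2 *.
have v0 : 0 <= v by exact: le_trans ih1.
apply/andP; split; last first.
  have : 0 <= (1 - v) ^+ 2 * (2 + v) by rewrite mulr_ge0 ?sqr_ge0 ?addr_ge0.
  lra.
apply: le_trans ih1 _; have : 0 <= v * (1 - v) * (1 + v).
  by rewrite mulr_ge0 ?addr_ge0// mulr_ge0// subr_ge0.
lra.
Qed.

Lemma sgn_approx_bound n u : `|u| <= 1 -> `|sgn_approx n u| <= 1.
Proof.
move=> u1; have [u0|u0] := leP 0 u.
  have /andP[h1 h2] := sgn_approx_itv n u0 (le_trans (ler_norm _) u1).
  by rewrite ger0_norm// (le_trans u0).
have nu0 : 0 <= - u by rewrite oppr_ge0 ltW.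
have nu1 : - u <= 1 by rewrite (le_trans (ler_norm _))// normrN.
have /andP[h1 h2] := sgn_approx_itv n nu0 nu1.
by rewrite -[u]opprK sgn_approxN normrN ger0_norm// (le_trans nu0).
Qed.

(** One step multiplies the distance [1 - v] by [1 - v / 2 - v ^ 2 / 2], which is at most
    [1 - u / 2] because the iterates stay above [u]. *)
Lemma cvg_sgn_approx_gt0 u : 0 < u -> u <= 1 -> sgn_approx n u @[n --> \oo] --> (1 : R).
Proof.
move=> u0 u1; pose r := 1 - u / 2.
have h n : 1 - sgn_approx n u <= r ^+ n.
  elim: n => [|n ih]; first by rewrite expr0 /= gerBl ltW.
  have /andP[v1 v2] := sgn_approx_itv n (ltW u0) u1.
  rewrite exprS /=; set v := sgn_approx n u in ih v1 v2 *.
  apply: (@le_trans _ _ (r * (1 - v))); last by rewrite ler_wpM2l// /r; lra.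
  rewrite /r -subr_ge0.
  rewrite (_ : _ - _ = (1 - v) * ((v - u) / 2 + v ^+ 2 / 2)); last by field.
  by rewrite mulr_ge0 ?subr_ge0// addr_ge0 ?divr_ge0 ?subr_ge0 ?sqr_ge0.
have r0 : r ^+ n @[n --> \oo] --> 0.
  by apply: cvg_expr; rewrite ger0_norm /r; lra.
suff h0 : 1 - sgn_approx n u @[n --> \oo] --> (0 : R).
  rewrite (_ : (fun n => _) = (fun n => 1 - (1 - sgn_approx n u))); last first.
    by apply/funext => n; rewrite subKr.
  by rewrite -[X in _ --> X](subr0 1); apply: cvgB => //; exact: cvg_cst.
apply: (squeeze_cvgr _ (cvg_cst 0) r0).
apply: nearW => n; rewrite h andbT subr_ge0.
by have /andP[] := sgn_approx_itv n (ltW u0) u1.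
Qed.

Lemma sgn_approx0 n : sgn_approx n 0 = 0.
Proof. by elim: n => //= n ->; rewrite expr0n/= mulr0 subr0 mul0r. Qed.

(** The map [s |-> (s + s ^ 2) / 2] sends -1, 0, 1 to 0, 0, 1: it turns the sign into the indicator
    of positive numbers. *)
Lemma cvg_pos_approx u : `|u| <= 1 ->
  (sgn_approx n u + sgn_approx n u ^+ 2) / 2 @[n --> \oo] --> (if 0 < u then 1 : R else 0).
Proof.
move=> u1.
have key (l : R) : sgn_approx n u @[n --> \oo] --> l ->
    (sgn_approx n u + sgn_approx n u ^+ 2) / 2 @[n --> \oo] --> (l + l ^+ 2) / 2.
  move=> h; apply: cvgMl; apply: cvgD => //.
  exact: (cvg_comp _ _ h (@exprn_continuous R 2 l)).
have [u0|u0|->] := ltrgt0P u.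
- have h := key 1 (cvg_sgn_approx_gt0 u0 (le_trans (ler_norm _) u1)).
  by rewrite (_ : (1 + 1 ^+ 2) / 2 = 1) in h; [exact: h|field].
- have h : sgn_approx n u @[n --> \oo] --> (-1 : R).
    rewrite (_ : (fun n => _) = (fun n => - sgn_approx n (- u))); last first.
      by apply/funext => n; rewrite sgn_approxN opprK.
    apply: cvgN; apply: cvg_sgn_approx_gt0; first by rewrite oppr_gt0.
    by rewrite (le_trans (ler_norm _))// normrN.
  by have {}h := key _ h; rewrite (_ : (-1 + (-1) ^+ 2) / 2 = 0) in h; [exact: h|field].
- under eq_fun do rewrite sgn_approx0 expr0n/= addr0 mul0r.
  exact: cvg_cst.
Qed.

End sign_iteration.

Lemma sum_indic_trivIset (R : realType) (T : Type) (F : nat -> set T) n x :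
  trivIset setT F ->
  \sum_(i < n) (\1_(F i) x)%:C = (\1_(\big[setU/set0]_(i < n) F i) x)%:C :> R[i].
Proof.
move=> tF; elim: n => [|n ih]; first by rewrite !big_ord0 indic0.
rewrite !big_ord_recr/= ih -rmorphD; congr (_%:C); rewrite !indicE in_setU.
case: (boolP (x \in F n)) => xF; last by rewrite orbF addr0.
rewrite (_ : x \in \big[setU/set0]_(i < n) F i = false) ?add0r//.
apply/negbTE/negP; rewrite inE -bigcup_mkord => -[k /= kn Fk].
rewrite inE in xF; have /trivIsetP/(_ k n I I) := tF.
rewrite ltn_eqF// => /(_ isT); apply/eqP/set0P; by exists x.
Qed.

Lemma indic_bigcup_cvg d (T : measurableType d) (R : realType)
    (m : {measure set T -> \bar R}) (F : nat -> set T) : (m setT < +oo)%E ->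
  (forall n, measurable (F n)) -> trivIset setT F ->
  nrm m (fun x => \sum_(i < n) (\1_(F i) x)%:C - (\1_(\bigcup_n F n) x)%:C)
    @[n --> \oo] --> 0.
Proof.
move=> m_fin mF tF; apply: (@nrm_cvg0_bounded _ _ _ _ _ 1 m_fin) => [n|n x|].
- apply: cmeasD; last by apply/cmeasN/cmeas_real/measurable_indic/bigcup_measurable.
  have : L2 m (fun x => \sum_(i < n) (\1_(F i) x)%:C).
    by apply: L2_sum => i; exact: L2_indic.
  exact: L2_cmeas.
- rewrite sum_indic_trivIset// -rmorphB normcR.
  by rewrite !indicE; do 2 case: (_ \in _); rewrite ?subrr ?subr0 ?sub0r ?normrN ?normr0 ?normr1.
- apply: aeW => x; have [[k _ Fk]|nF] := pselect ((\bigcup_n F n) x).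
    apply: cvg_near_cst; exists k.+1 => // n /= kn.
    rewrite sum_indic_trivIset// indicE mem_set; last first.
      by rewrite -bigcup_mkord; exists k.
    by rewrite indicE mem_set ?subrr ?sqmodR ?expr0n//; exists k.
  apply: cvg_near_cst; exists 0%N => // n _ /=.
  rewrite sum_indic_trivIset// indicE memNset; last first.
    by rewrite -bigcup_mkord => -[k _ Fk]; apply: nF; exists k.
  by rewrite indicE memNset ?subrr ?sqmodR ?expr0n.
Qed.

Section trigonometric_density.
Context (R : realType) (m : measureR R).
Hypothesis m_fin : (m setT < +oo)%E.
Hypothesis m_supp : m (~` (@spectral_interval R)) = 0%E.
Local Notation S := (@spectral_interval R).
Implicit Types f g : R -> R[i].

Definition trig_limit f :=
  L2 m f /\ forall e : R, 0 < e -> exists s, nrm m (fun x => trig s x - f x) < e.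

Lemma L2_trig s : L2 m (trig s).
Proof. by apply: (L2_bounded m_fin (cmeas_trig s)); exact: trig_bound. Qed.

Lemma measurable_spectral_interval : measurable (S : set (measurableTypeR R)).
Proof. exact: measurable_itv. Qed.

Lemma L2_expi (k : int) : L2 m (expk k).
Proof. by apply: (L2_bounded m_fin (cmeas_expi _)) => x; rewrite normc_expi. Qed.

Lemma nrm_spectral_bound f (C : R) : L2 m f -> 0 <= C -> (forall x, S x -> normc (f x) <= C) ->
  nrm m f <= C * Num.sqrt (fine (m S)).
Proof.
have mS := measurable_spectral_interval.
exact: nrm_bound mS m_supp (measure_lty m_fin mS).
Qed.

Lemma trig_limit_trig s : trig_limit (trig s).
Proof.
split; first exact: L2_trig.
by move=> e e0; exists s; under eq_fun do rewrite subrr; rewrite nrm0.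
Qed.

Lemma trig_limit1 : trig_limit (fun=> 1).
Proof.
have [s hs] := real_trig_cst (1 : R).
have -> : (fun=> 1) = trig s by apply/funext => x; rewrite -hs.
exact: trig_limit_trig.
Qed.

Lemma trig_limitD f g : trig_limit f -> trig_limit g -> trig_limit (fun x => f x + g x).
Proof.
move=> [Lf hf] [Lg hg]; split; first exact: L2D.
move=> e e0; have e2 : 0 < e / 2 by rewrite divr_gt0.
have [s hs] := hf _ e2; have [t ht] := hg _ e2; exists (s ++ t).
under eq_fun do rewrite trig_cat.
have Ls := L2B (L2_trig s) Lf; have Lt := L2B (L2_trig t) Lg.
have -> : (fun x => trig s x + trig t x - (f x + g x)) =
   (fun x => (trig s x - f x) + (trig t x - g x)) by apply/funext => x; ring.
apply: le_lt_trans (nrmD_le Ls Lt) _; lra.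
Qed.

Lemma trig_limitZ a f : trig_limit f -> trig_limit (fun x => a * f x).
Proof.
move=> [Lf hf]; split; first exact: L2Z.
move=> e e0; have a0 : 0 < normc a + 1 by rewrite ltr_wpDl ?normc_ge0.
have [s hs] := hf _ (divr_gt0 e0 a0); exists (trig_scale a s).
under eq_fun do rewrite trig_scaleE -mulrBr.
rewrite nrmZ; last exact: L2B (L2_trig s) Lf.
rewrite ltr_pdivlMr// in hs; apply: le_lt_trans hs.
by rewrite mulrC ler_wpM2l ?nrm_ge0// lerDl.
Qed.

Lemma trig_limitN f : trig_limit f -> trig_limit (fun x => - f x).
Proof. by move=> /(trig_limitZ (-1)); under eq_fun do rewrite mulN1r. Qed.

Lemma trig_limit_cvg (F : nat -> R -> R[i]) f : (forall n, trig_limit (F n)) ->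
  L2 m f -> nrm m (fun x => F n x - f x) @[n --> \oo] --> 0 -> trig_limit f.
Proof.
move=> hF Lf Ff; split => // e e0; have e2 : 0 < e / 2 by rewrite divr_gt0.
have /cvgn0P/(_ _ e2)[N /(_ N (leqnn N))] := Ff.
rewrite ger0_norm ?nrm_ge0// => hN.
have [LF /(_ _ e2)[s hs]] := hF N; exists s.
have := nrm_triangle (L2_trig s) LF Lf; lra.
Qed.

Lemma trig_limit_ae f g : trig_limit f -> cmeas g -> {ae m, forall x, f x = g x} ->
  trig_limit g.
Proof.
move=> hf mg fg; have Lf := hf.1; have Lg := L2_ae Lf mg fg.
by apply: (@trig_limit_cvg (fun=> f)) => //; rewrite nrm_ae0//; exact: cvg_cst.
Qed.

(** A polynomial in a trigonometric polynomial is again one, so the sign iteration applied to [q]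
    stays in the class; it is bounded, and converges at every point. *)
Lemma trig_limit_pos (q : R -> R) : real_trig q -> (forall x, `|q x| <= 1) ->
  measurable_fun setT (q : measurableTypeR R -> R) ->
  trig_limit (fun x => (if 0 < q x then 1 else 0 : R)%:C).
Proof.
move=> rq q1 mq.
pose F n x : R := (sgn_approx n (q x) + sgn_approx n (q x) ^+ 2) / 2.
have rF n : real_trig (F n).
  have rs : real_trig (fun x => sgn_approx n (q x)).
    elim: n => [//|n ih] /=; apply: real_trigM; last exact: real_trig_cst.
    apply: real_trigD; first by apply: real_trigM => //; exact: real_trig_cst.
    under eq_fun do rewrite -mulN1r.
    by apply: real_trigM; [exact: real_trig_cst|exact: real_trigX].
  apply: real_trigM; last exact: real_trig_cst.
  by apply: real_trigD => //; exact: real_trigX.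
have FB n x : `|F n x| <= 1.
  have h := sgn_approx_bound n (q1 x).
  rewrite /F normrM normfV (ger0_norm (_ : 0 <= 2))// ler_pdivrMr// mul1r.
  apply: le_trans (ler_normD _ _) _; rewrite normrX -[leRHS]/(1 + 1) lerD//.
  by rewrite exprn_ile1.
have mpos : measurable_fun setT (fun x : measurableTypeR R => if 0 < q x then 1 else 0 : R).
  apply: measurable_fun_if => //.
  by apply: measurable_fun_ltr => //.
apply: (@trig_limit_cvg (fun n x => (F n x)%:C)).
- by move=> n; have [s hs] := rF n; under eq_fun do rewrite hs; exact: trig_limit_trig.
- apply: (@L2_bounded _ _ _ _ _ 1 m_fin (cmeas_real mpos)) => x.
  by rewrite normcR; case: ifP => _; rewrite ?normr1 ?normr0.
- apply: (@nrm_cvg0_bounded _ _ _ _ _ 2 m_fin) => [n|n x|].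
  + have [s hs] := rF n; apply: cmeasD; last by apply/cmeasN/cmeas_real.
    by under eq_fun do rewrite hs; exact: cmeas_trig.
  + rewrite -rmorphB normcR; apply: le_trans (ler_normB _ _) _.
    by rewrite -[leRHS]/(1 + 1) lerD//; case: ifP => _; rewrite ?normr1 ?normr0.
  + apply: aeW => x; have := cvg_pos_approx (q1 x).
    set l := (if 0 < q x then 1 : R else 0) => h.
    have h0 : (F n x - l) @[n --> \oo] --> (0 : R).
      by rewrite -(subrr l); apply: cvgB => //; exact: cvg_cst.
    have := cvg_comp _ _ h0 (@exprn_continuous R 2 0); rewrite expr0n/=.
    by under [in X in _ -> X]eq_fun do rewrite -rmorphB sqmodR.
Qed.

(** The half difference of cosines is [sin (x / 2) * sin ((a - x) / 2)]. On the circle the first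
    factor vanishes only at 0 and the second has the sign of [a - x]; so an open arc is the
    positivity set of a trigonometric polynomial bounded by 1. *)
Lemma cos_arc_gt0 (a x : R) : 0 < a <= 2 * pi -> S x ->
  (0 < (cos (x - a / 2) - cos (a / 2)) / 2) = (0 < x < a).
Proof.
move=> /andP[a0 a2]; rewrite /spectral_interval /= in_itv /= => /andP[x0 x2].
have -> : (cos (x - a / 2) - cos (a / 2)) / 2 = sin (x / 2) * sin ((a - x) / 2).
  have -> : x - a / 2 = x / 2 - (a - x) / 2 by field.
  have -> : cos (a / 2) = cos (x / 2 + (a - x) / 2) by congr cos; field.
  by rewrite cosB cosD; field.
have [->|x0'] := eqVneq x 0; first by rewrite mul0r sin0 mul0r ltxx.
have xgt0 : 0 < x by rewrite lt_neqAle eq_sym x0'.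
rewrite xgt0 pmulr_rgt0; last by apply: sin_gt0_pi; lra.
have [xa|xa|->] := ltgtP x a.
- by apply/sin_gt0_pi; lra.
- apply/negbTE; rewrite -leNgt -oppr_ge0 -sinN; apply: sin_ge0_pi; lra.
- by rewrite subrr mul0r sin0 ltxx.
Qed.

Lemma trig_limit_open_arc (a : R) : 0 < a <= 2 * pi ->
  trig_limit (cindic (`]0, a[%classic : set R)).
Proof.
move=> a02; apply: (@trig_limit_ae
    (fun x => (if 0 < (cos (x - a / 2) - cos (a / 2)) / 2 then 1 else 0 : R)%:C)).
- apply: trig_limit_pos.
  + apply: real_trigM; last exact: real_trig_cst.
    by apply: real_trigD; [exact: real_trig_cos|exact: real_trig_cst].
  + move=> x; rewrite normrM normfV (ger0_norm (_ : 0 <= 2))// ler_pdivrMr// mul1r.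
    apply: le_trans (ler_normB _ _) _.
    by rewrite -[leRHS]/(1 + 1) lerD// cos_max.
  + apply: measurable_funM => //; apply: measurable_funB => //.
    apply: continuous_measurable_fun => x.
    apply: (@continuous_comp _ _ _ (fun x => x - a / 2) cos); last exact: continuous_cos.
    by apply: cvgB => //; exact: cvg_cst.
- by apply: cmeas_real; apply: measurable_indic; exact: measurable_itv.
- apply: (ae_null_setC measurable_spectral_interval m_supp) => x Sx.
  rewrite cos_arc_gt0// indicE mem_setE in_itv/=.
  by case: ifP.
Qed.

Lemma trig_limit_ray (a : R) : trig_limit (cindic (`]-oo, a[%classic : set R)).
Proof.
have mray (b : R) : @cmeas _ (measurableTypeR R) R (cindic (`]-oo, b[%classic : set R)).
  by apply: cmeas_real; apply: measurable_indic; exact: measurable_itv.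
have [a0|a0] := leP a 0.
  apply: (@trig_limit_ae (fun=> 0) _ _ (mray a)).
    by have := trig_limitZ 0 trig_limit1; under eq_fun do rewrite mul0r.
  apply: (ae_null_setC measurable_spectral_interval m_supp) => x.
  rewrite /spectral_interval /= in_itv /= => /andP[x0 _].
  by rewrite indicE mem_setE in_itv/= ltNge (le_trans a0).
have pi0 := pi_gt0 R.
have [a2|a2] := leP a (2 * pi); last first.
  apply: (@trig_limit_ae (fun=> 1) _ trig_limit1 (mray a)).
  apply: (ae_null_setC measurable_spectral_interval m_supp) => x.
  rewrite /spectral_interval /= in_itv /= => /andP[_ x2].
  by rewrite indicE mem_setE in_itv/= (lt_trans x2).
have h1 := @trig_limit_open_arc (2 * pi); have h2 := @trig_limit_open_arc a.
(* On the circle the ray is [[0, a[]: the point 0, which is the complement of []0, 2 pi[], together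
   with []0, a[]. *)
have := trig_limitD (trig_limitD trig_limit1 (trig_limitN (h1 _))) (h2 _).
move=> /(_ _ _)/trig_limit_ae; apply; [lra|lra|exact: mray|].
apply: (ae_null_setC measurable_spectral_interval m_supp) => x.
rewrite /spectral_interval /= in_itv /= => /andP[x0 x2].
rewrite !indicE !mem_setE !in_itv/= x2 andbT; have [x0'|x0'] := ltP 0 x.
  by rewrite /= subrr add0r.
have -> : x = 0 by lra.
by rewrite a0 /= subr0 addr0.
Qed.

(** Open left rays are stable under intersection and generate the Borel sets, and the sets with the
    property form a Dynkin class. *)
Lemma trig_limit_indic (A : set (measurableTypeR R)) : measurable A ->
  trig_limit (cindic A).
Proof.
move: A; pose Q := [set A : set (measurableTypeR R) | trig_limit (cindic A)].
suff H : forall A : set (measurableTypeR R), measurable A -> Q A by exact: H.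
move=> A mA; apply: (@dynkin_induction _ (measurableTypeR R) (@RGenInftyO.G R) Q
  (RGenInftyO.measurableE R)).
- move=> _ _ [a ->] [b ->]; exists (Num.min a b).
  by apply/seteqP; split => x /=; rewrite !in_itv/= lt_min => /andP.
- by rewrite /Q /=; under eq_fun do rewrite indicT; exact: trig_limit1.
- by move=> _ [a ->]; exact: trig_limit_ray.
- move=> {mA}A mA hA; have := trig_limitD trig_limit1 (trig_limitN hA).
  congr trig_limit; apply/funext => x.
  by rewrite !indicE in_setC; case: (_ \in _); rewrite /= ?subrr ?subr0.
- move=> F mF tF hF.
  apply: (@trig_limit_cvg (fun n x => \sum_(i < n) (\1_(F i) x)%:C)).
  + elim=> [|n ih].
      under eq_fun do rewrite big_ord0.
      by have := trig_limitZ 0 trig_limit1; under eq_fun do rewrite mul0r.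
    by under eq_fun do rewrite big_ord_recr/=; exact: (trig_limitD ih (hF n)).
  + by apply: L2_indic => //; exact: bigcup_measurable.
  + exact: indic_bigcup_cvg.
- exact: (eq_ind _ (fun X => X A) mA _ (RGenInftyO.measurableE R)).
Qed.

End trigonometric_density.

(** * Closures of isometries given by their graphs *)

Section isometric_relations.
Context d1 (T1 : measurableType d1) d2 (T2 : measurableType d2) (R : realType).
Variables (m1 : {measure set T1 -> \bar R}) (m2 : {measure set T2 -> \bar R}).
Implicit Types (f g : T1 -> R[i]) (Y Z : T2 -> R[i]).

(* The graph of a linear isometry between subspaces of L^2(m1) and L^2(m2). *)
Definition isometric (G : (T1 -> R[i]) -> (T2 -> R[i]) -> Prop) :=
  [/\ G (fun=> 0) (fun=> 0),
      forall f Y, G f Y -> [/\ L2 m1 f, L2 m2 Y & nrm m1 f = nrm m2 Y]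
    & forall c f Y g Z, G f Y -> G g Z ->
        G (fun x => f x + c * g x) (fun w => Y w + c * Z w)].

(** The extension by continuity of the isometry. One pair [(g, Z)] approximates both coordinates,
    and every representative of the image is related to [f]. *)
Definition graph_closure (G : (T1 -> R[i]) -> (T2 -> R[i]) -> Prop) f Y :=
  [/\ L2 m1 f, L2 m2 Y & forall e : R, 0 < e -> exists g Z,
    [/\ G g Z, nrm m1 (fun x => g x - f x) < e & nrm m2 (fun w => Z w - Y w) < e]].

(** The norm of a linear combination depends only on the Gram matrix. This is why a map prescribed
    on a family with the right inner products extends to an isometry. *)
Lemma nrm_lincomb (I : Type) (s : seq I) (c : I -> R[i])
    (F : I -> T1 -> R[i]) (X : I -> T2 -> R[i]) :
  (forall i, L2 m1 (F i)) -> (forall i, L2 m2 (X i)) ->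
  (forall i j, ip m1 (F i) (F j) = ip m2 (X i) (X j)) ->
  nrm m1 (fun x => \sum_(i <- s) c i * F i x) = nrm m2 (fun w => \sum_(i <- s) c i * X i w).
Proof.
move=> LF LX FX; have LcF i := L2Z (c i) (LF i); have LcX i := L2Z (c i) (LX i).
apply/eqP; rewrite -(@eqrXn2 _ 2) ?nrm_ge0//; apply/eqP/complexI; rewrite -!ip_nrm.
rewrite !ip_sumr//; [|exact: L2_sum..]; apply: eq_bigr => i _.
rewrite !ip_suml//; apply: eq_bigr => j _.
by rewrite !ipZl// !ipZr// FX.
Qed.

Variable G : (T1 -> R[i]) -> (T2 -> R[i]) -> Prop.
Hypothesis isoG : isometric G.

Lemma isometricZ c f Y : G f Y -> G (fun x => c * f x) (fun w => c * Y w).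
Proof.
case: isoG => G0 _ Gl GfY; have := Gl c _ _ _ _ G0 GfY.
by congr G; apply/funext => x; rewrite add0r.
Qed.

Lemma isometricD f Y g Z : G f Y -> G g Z ->
  G (fun x => f x + g x) (fun w => Y w + Z w).
Proof.
case: isoG => _ _ Gl h1 h2; have := Gl 1 _ _ _ _ h1 h2.
by congr G; apply/funext => x; rewrite mul1r.
Qed.

Lemma isometricB f Y g Z : G f Y -> G g Z ->
  G (fun x => f x - g x) (fun w => Y w - Z w).
Proof.
case: isoG => _ _ Gl h1 h2; have := Gl (-1) _ _ _ _ h1 h2.
by congr G; apply/funext => x; rewrite mulN1r.
Qed.

Lemma isometric_sum (I : Type) (s : seq I) (c : I -> R[i])
    (F : I -> T1 -> R[i]) (X : I -> T2 -> R[i]) : (forall i, G (F i) (X i)) ->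
  G (fun x => \sum_(i <- s) c i * F i x) (fun w => \sum_(i <- s) c i * X i w).
Proof.
move=> GFX; elim: s => [|i s ih].
  case: isoG => G0 _ _; under eq_fun do rewrite big_nil.
  by under [X in G _ X]eq_fun do rewrite big_nil.
have := isometricD (isometricZ (c i) (GFX i)) ih.
by congr G; apply/funext => x; rewrite big_cons.
Qed.

(** Polarization: [c = 1] gives the real parts and [c = 'i] the imaginary parts. *)
Lemma isometric_ip f Y g Z : G f Y -> G g Z -> ip m1 f g = ip m2 Y Z.
Proof.
case: isoG => _ Gn Gl h1 h2.
have [Lf LY fY] := Gn _ _ h1; have [Lg LZ gZ] := Gn _ _ h2.
have key c : Re (conjc c * ip m1 f g) = Re (conjc c * ip m2 Y Z).
  have [_ _ h] := Gn _ _ (Gl c _ _ _ _ h1 h2).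
  have := congr1 (fun x => x ^+ 2) h.
  have Lcg := L2Z c Lg; have LcZ := L2Z c LZ.
  rewrite (nrm_sqD Lf Lcg) (nrm_sqD LY LcZ) !nrmZ// fY gZ !ipZr// => /addrI.
  by move=> /(mulfI (_ : 2 != 0)) ->.
apply: complexP; first by have := key 1; rewrite conjc1 !mul1r.
by have := key ('i); rewrite !reimE /=; lra.
Qed.

Lemma graph_closure_sub f Y : G f Y -> graph_closure G f Y.
Proof.
case: isoG => _ Gn _ h; have [Lf LY _] := Gn _ _ h; split => // e e0.
exists f, Y; split => //.
  by under eq_fun do rewrite subrr; rewrite nrm0.
by under eq_fun do rewrite subrr; rewrite nrm0.
Qed.

Lemma isometric_closure : isometric (graph_closure G).
Proof.
case: isoG => G0 Gn Gl; split.
- exact: graph_closure_sub.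
- move=> f Y [Lf LY h]; split => //; apply/eqP; rewrite -subr_eq0 -normr_le0.
  apply/ler_addgt0Pl => e e0; rewrite addr0.
  have e2 : 0 < e / 2 by rewrite divr_gt0.
  have [g [Z [GgZ h1 h2]]] := h _ e2.
  have [Lg LZ gZ] := Gn _ _ GgZ.
  have := nrm_dist Lg Lf; have := nrm_dist LZ LY; rewrite gZ => k1 k2.
  have -> : nrm m1 f - nrm m2 Y = (nrm m2 Z - nrm m2 Y) - (nrm m2 Z - nrm m1 f) by ring.
  by apply: le_trans (ler_normB _ _) _; lra.
- move=> c f Y g Z [Lf LY fY] [Lg LZ gZ]; split.
  + exact: L2D Lf (L2Z c Lg).
  + exact: L2D LY (L2Z c LZ).
  + move=> e e0; have e2 : 0 < e / 2 by rewrite divr_gt0.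
    have c0 : 0 < normc c + 1 by rewrite ltr_wpDl ?normc_ge0.
    have [f' [Y' [G1 h1 h2]]] := fY _ e2.
    have [g' [Z' [G2 h3 h4]]] := gZ _ (divr_gt0 e2 c0).
    have [Lf' LY' _] := Gn _ _ G1; have [Lg' LZ' _] := Gn _ _ G2.
    exists (fun x => f' x + c * g' x), (fun w => Y' w + c * Z' w); split; first exact: Gl.
    * exact: nrm_lincomb_lt.
    * exact: nrm_lincomb_lt.
Qed.

Lemma graph_closure_eqr f Y Z : graph_closure G f Y -> L2 m2 Z ->
  nrm m2 (fun w => Y w - Z w) = 0 -> graph_closure G f Z.
Proof.
case: isoG => _ Gn _ [Lf LY h] LZ YZ; split => // e e0.
have [g [X [GgX h1 h2]]] := h _ e0; exists g, X; split => //.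
have [_ LX _] := Gn _ _ GgX.
by have := nrm_triangle LX LY LZ; lra.
Qed.

Lemma graph_closure_exists f : L2 m1 f ->
  (forall e : R, 0 < e -> exists g Z, G g Z /\ nrm m1 (fun x => g x - f x) < e) ->
  exists Y, graph_closure G f Y.
Proof.
case: isoG => _ Gn _ Lf h.
(* With this rate two consecutive terms differ by at most [4 ^ -n], as [L2_complete] requires. *)
have h' n : exists p : (T1 -> R[i]) * (T2 -> R[i]),
    G p.1 p.2 /\ nrm m1 (fun x => p.1 x - f x) < 2^-1 * 4^-1 ^+ n.
  have [|g [Z [? ?]]] := h (2^-1 * 4^-1 ^+ n); last by exists (g, Z).
  by rewrite mulr_gt0 ?exprn_gt0 ?invr_gt0.
pose p n := projT1 (cid (h' n)).
have Gp n : G (p n).1 (p n).2 by have [] := projT2 (cid (h' n)).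
have pf n : nrm m1 (fun x => (p n).1 x - f x) < 2^-1 * 4^-1 ^+ n.
  by have [] := projT2 (cid (h' n)).
have Lp n : L2 m1 (p n).1 by have [] := Gn _ _ (Gp n).
have LX n : L2 m2 (p n).2 by have [] := Gn _ _ (Gp n).
have [n|Y [LY hY]] := L2_complete LX.
  have [_ _ <-] := Gn _ _ (isometricB (Gp n.+1) (Gp n)).
  apply: le_trans (nrm_triangle (Lp n.+1) Lf (Lp n)) _.
  rewrite (nrmB _ f); have := pf n; have := pf n.+1; rewrite exprS.
  have : 0 <= (4^-1 : R) ^+ n by rewrite exprn_ge0.
  lra.
exists Y; split => // e e0.
have /cvgn0P/(_ e e0)[N /(_ N (leqnn N))] : (2 * 4^-1 ^+ n : R) @[n --> \oo] --> 0.
  rewrite -(mulr0 2); apply: cvgMr; apply: cvg_expr.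
  by rewrite ger0_norm; lra.
have p0 : 0 <= (4^-1 : R) ^+ N by rewrite exprn_ge0.
rewrite ger0_norm ?mulr_ge0// => hN.
exists (p N).1, (p N).2; split => //; last exact: le_lt_trans (hY N) hN.
have := pf N; lra.
Qed.

End isometric_relations.

(** * Expectations as integrals against the probability *)

Section probability_space.
Context d (T : measurableType d) (R : realType) (P : probability T R).
Implicit Types X Y : T -> R[i].

Lemma mean_squareE X : mean_square P X = nsq P X.
Proof. by rewrite /mean_square unlock. Qed.

Lemma cexpectationE X Y : cexpectation P (fun w => X w * conjc (Y w)) = ip P X Y.
Proof. by rewrite /cexpectation unlock. Qed.

Lemma square_integrableE X : square_integrable P X <-> L2 P X.
Proof. by rewrite /square_integrable mean_squareE. Qed.

Lemma cvg_mean_squareE (X : nat -> T -> R[i]) Y : (forall n, L2 P (X n)) -> L2 P Y ->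
  cvg_mean_square P X Y <-> nrm P (fun w => X n w - Y w) @[n --> \oo] --> 0.
Proof.
move=> LX LY; rewrite /cvg_mean_square; under eq_fun do rewrite mean_squareE.
by apply: cvg_nrm_sq => n; exact: L2B.
Qed.

End probability_space.

(** * Arcs and step functions on the circle *)

Section arcs.
Context (R : realType).
Implicit Types (a b x y t : R) (m : int).
Local Notation S := (@spectral_interval R).

Let twopi_gt0 : 0 < 2 * pi :> R. Proof. by rewrite mulr_gt0 ?pi_gt0. Qed.

(** The window []y, y + 2 pi]] is open on the left, like the arcs, so that lifts into it are
    unique. *)
Lemma arc_lift_exists y t : exists m, y < t + 2 * pi * m%:~R <= y + 2 * pi.
Proof.
exists (Num.floor ((y - t) / (2 * pi)) + 1).
set z := (y - t) / (2 * pi); have yz : y = t + 2 * pi * z by rewrite /z [2 * pi * _]mulrC divfK ?gt_eqF// addrCA subrr addr0.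
have /andP[h1 h2] := floor_itv z.
have e1 : (Num.floor z + 1)%:~R = (Num.floor z)%:~R + 1 :> R by rewrite intrD.
rewrite e1 in h2 *.
have : 2 * pi * (Num.floor z)%:~R <= 2 * pi * z by rewrite ler_pM2l.
have : 2 * pi * z < 2 * pi * ((Num.floor z)%:~R + 1) by rewrite ltr_pM2l.
by rewrite yz; move=> *; apply/andP; split; lra.
Qed.

Lemma arc_lift_unique y t m n : y < t + 2 * pi * m%:~R <= y + 2 * pi ->
  y < t + 2 * pi * n%:~R <= y + 2 * pi -> m = n.
Proof.
wlog mn : m n / (m <= n)%R.
  move=> h h1 h2; have [/h|/ltW/h] := leP m n; first exact.
  by move=> /(_ h2 h1).
move=> /andP[m1 m2] /andP[n1 n2]; apply/eqP; rewrite eq_le mn /= -ltzD1 -(ltr_int R).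
have -> : (m + 1)%:~R = m%:~R + 1 :> R by rewrite intrD.
rewrite -(ltr_pM2l twopi_gt0); lra.
Qed.

Lemma arcP y a b t m : y <= a -> b <= y + 2 * pi -> S t ->
  y < t + 2 * pi * m%:~R <= y + 2 * pi ->
  arc a b t <-> a < t + 2 * pi * m%:~R <= b.
Proof.
move=> ya byy St tm; split=> [[_ [n tn]]|h]; last by split => //; exists m.
rewrite (arc_lift_unique tm (_ : y < t + 2 * pi * n%:~R <= y + 2 * pi))//.
by move: tn => /andP[tn1 tn2]; apply/andP; split; lra.
Qed.

Lemma spectral_set_arc a b : spectral_set (arc a b).
Proof.
split; last by move=> x [].
have -> : arc a b = S `&`
    (\bigcup_(m : int) [set` `]a - 2 * pi * m%:~R, b - 2 * pi * m%:~R]]).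
  apply/seteqP; split => x; rewrite /arc /=.
    move=> [Sx [m /andP[h1 h2]]]; split => //; exists m => //=.
    by rewrite in_itv/=; apply/andP; split; lra.
  move=> [Sx [m _ /=]]; rewrite in_itv/= => /andP[h1 h2]; split => //; exists m.
  by apply/andP; split; lra.
apply: measurableI; first exact: measurable_itv.
by apply: countable_bigcupT_measurable => [|m]; [exact: countableP|exact: measurable_itv].
Qed.

Lemma arc_split a b c : a <= b -> b <= c -> c <= a + 2 * pi ->
  arc a c = arc a b `|` arc b c /\ arc a b `&` arc b c = set0.
Proof.
move=> ab bc ca; split; apply/seteqP; split => t //.
- move=> [St [m /andP[h1 h2]]]; have [h|h] := leP (t + 2 * pi * m%:~R) b.
    by left; split => //; exists m; rewrite h1.
  by right; split => //; exists m; rewrite h.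
- move=> [] [St [m /andP[h1 h2]]]; split => //; exists m; apply/andP; split; lra.
- move=> [[St [m tm]] [_ [n tn]]]; suff mn : m = n by rewrite mn in tm; lra.
  apply: (@arc_lift_unique a t); move: tm tn => /andP[? ?] /andP[? ?];
    apply/andP; split; lra.
Qed.

Section arc_steps.
Variables (f : R -> R[i]) (y : R) (n : nat).

Definition arc_node (i : nat) := y + 2 * pi * i%:R / n%:R.

(** Each arc carries the value of [f] at its left end. The origin [y] of the subdivision is free: it
    is 0 for the exponentials and [x - pi] for a kernel centred at [x]. *)
Definition arc_step : step_function R :=
  @StepFunction R n (fun i => f (arc_node i))
    (fun i => arc (arc_node i) (arc_node i.+1)) (fun i => spectral_set_arc _ _).

Lemma arc_node_le i j : (i <= j)%N -> arc_node i <= arc_node j.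
Proof.
move=> ij; rewrite lerD2l ler_wpM2r ?invr_ge0// ler_pM2l// ler_nat//.
Qed.

Lemma arc_node0 : arc_node 0 = y. Proof. by rewrite /arc_node mulr0 mul0r addr0. Qed.

Lemma arc_nodeS i : arc_node i.+1 = arc_node i + 2 * pi / n%:R.
Proof. by rewrite /arc_node -natr1; ring. Qed.

Hypothesis n_gt0 : (0 < n)%N.

Lemma arc_noden : arc_node n = y + 2 * pi.
Proof. by rewrite /arc_node mulfK// pnatr_eq0 -lt0n. Qed.

(** The lift [u] of [t] lies in exactly one arc, that of the least [i] with [u <= arc_node i.+1];
    the step value is then taken at a node at most one mesh away. *)
Lemma arc_step_value (C : R) t : 0 <= C ->
  (forall u v, normc (f u - f v) <= C * `|u - v|) ->
  (forall u m, f (u + 2 * pi * m%:~R) = f u) ->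
  S t -> normc (f t - step_value arc_step t) <= C * (2 * pi / n%:R).
Proof.
move=> C0 fC fper St; have [m tm] := arc_lift_exists y t.
set u := t + _ in tm; move: (tm) => /andP[u1 u2].
have ex : exists i, u <= arc_node i.+1 by exists n.-1; rewrite prednK// arc_noden.
case: (ex_minnP ex) => i iu imin.
have lein : (i < n)%N by rewrite -[n]prednK// ltnS imin// prednK// arc_noden.
have ui : arc_node i < u.
  case: i iu imin lein => [|i] iu imin lein; first by rewrite arc_node0.
  by rewrite ltNge; apply/negP => /imin; rewrite ltnn.
have arcE j : (j < n)%N -> arc (arc_node j) (arc_node j.+1) t <->
    arc_node j < u <= arc_node j.+1.
  move=> jn; apply: (@arcP y) => //.
    by rewrite -{1}arc_node0 arc_node_le.
  by rewrite -arc_noden arc_node_le.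
rewrite /step_value /= (bigD1 (Ordinal lein))//= big1 ?addr0; last first.
  move=> j /eqP ji; rewrite indicE memNset ?mulr0// => /arcE => /(_ (ltn_ord j)) /andP[j1 j2].
  apply: ji; apply/val_inj => /=; apply/eqP; rewrite eqn_leq imin// andbT.
  rewrite leqNgt; apply/negP => /arc_node_le; lra.
rewrite indicE mem_set ?mulr1; last by apply/arcE => //; rewrite ui.
rewrite -(fper t m) -/u; apply: le_trans (fC _ _) _; rewrite ler_wpM2l//.
by rewrite arc_nodeS in iu; rewrite ger0_norm ?subr_ge0 ?lerBlDl// ltW.
Qed.

End arc_steps.

Lemma arc_step_approx (f : R -> R[i]) y (C e : R) : 0 <= C -> 0 < e ->
  (forall u v, normc (f u - f v) <= C * `|u - v|) ->
  (forall u m, f (u + 2 * pi * m%:~R) = f u) ->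
  exists N, forall n t, (N < n)%N -> S t ->
    normc (f t - step_value (arc_step f y n) t) <= e.
Proof.
move=> C0 e0 fC fper; pose N := Num.truncn (C * (2 * pi) / e); exists N => n t Nn St.
have n0 : (0 < n)%N by exact: leq_ltn_trans Nn.
apply: (le_trans (arc_step_value y n0 C0 fC fper St)).
rewrite mulrA ler_pdivrMr ?ltr0n// [e * _]mulrC -ler_pdivrMr//.
have : C * (2 * pi) / e < N.+1%:R by rewrite truncnS_gt.
have : (N.+1%:R : R) <= n%:R by rewrite ler_nat.
lra.
Qed.

Lemma measurable_step_value (s : step_function R) :
  @cmeas _ (measurableTypeR R) R (step_value s).
Proof.
have : forall n (c : 'I_n -> R[i]) (A : 'I_n -> set R), (forall i, spectral_set (A i)) ->
    @cmeas _ (measurableTypeR R) R (fun x => \sum_(i < n) c i * (\1_(A i) x)%:C).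
  elim=> [|n ih] c A hA; first by under eq_fun do rewrite big_ord0; exact: cmeas_cst.
  under eq_fun do rewrite big_ord_recl.
  apply: cmeasD; last by apply: (ih _ (fun i => A (lift ord0 i))) => i; exact: hA.
  apply: cmeasM; first exact: cmeas_cst.
  by apply: cmeas_real; apply: measurable_indic; have [] := hA ord0.
by apply; exact: step_setP.
Qed.

Lemma step_value_bound (s : step_function R) x :
  normc (step_value s x) <= \sum_(i < step_size s) normc (step_coef i).
Proof.
apply: le_trans (le_normc_sum _ _ _) _; apply: ler_sum => i _.
rewrite normcM normcR indicE ler_piMr ?normc_ge0//.
by case: (_ \in _); rewrite ?normr1 ?normr0.
Qed.

Lemma expi_int_lipschitz (k : int) (u v : R) :
  normc (expi (u * k%:~R) - expi (v * k%:~R)) <= 2 * `|k%:~R| * `|u - v|.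
Proof.
by apply: le_trans (expi_lipschitz _ _) _; rewrite -mulrBl normrM mulrA mulrAC.
Qed.

End arcs.

Lemma ip_indic d (T : measurableType d) (R : realType) (m : {measure set T -> \bar R})
    (A B : set T) : measurable A -> measurable B ->
  ip m (cindic A) (cindic B) = (fine (m (A `&` B)))%:C.
Proof.
move=> mA mB; apply: complexP; rewrite /ip /Rintegral [LHS]/=.
  rewrite (eq_integral (fun x => (\1_(A `&` B) x)%:E)) => [|x _]; last by rewrite indicI/=; congr EFin; ring.
  by rewrite integral_indic ?setIT//; exact: measurableI.
by rewrite (eq_integral (cst 0%E)) => [|x _]; rewrite ?integral_cst//= ?mul0e//; congr EFin; ring.
Qed.

(** * Integration against a random spectral measure *)

Section control_measure.
Context d (T : measurableType d) (R : realType) (P : probability T R).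
Variable phi : set R -> T -> R[i].
Hypothesis phi_rsm : random_spectral_measure P phi.
Local Notation S := (@spectral_interval R).

Lemma rsm_L2 A : spectral_set A -> L2 P (phi A).
Proof. by case: phi_rsm => h _ _ /h/square_integrableE. Qed.

Lemma rsm_orth A B : spectral_set A -> spectral_set B -> A `&` B = set0 ->
  ip P (phi A) (phi B) = 0.
Proof. by case: phi_rsm => _ _ h sA sB /h; rewrite cexpectationE; exact. Qed.

Lemma spectral_set0 : spectral_set (set0 : set R).
Proof. by split => //; exact: measurable0. Qed.

Lemma spectral_setT : spectral_set S.
Proof. by split => //; exact: measurable_spectral_interval. Qed.

Lemma spectral_setU (A B : set R) : spectral_set A -> spectral_set B ->
  spectral_set (A `|` B).
Proof. by move=> [mA AS] [mB BS]; split; [exact: measurableU|rewrite subUset]. Qed.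

Lemma spectral_set_bigcup (F : nat -> set R) : (forall n, spectral_set (F n)) ->
  spectral_set (\bigcup_n F n).
Proof.
move=> sF; split; first by apply: bigcup_measurable => n _; case: (sF n).
by move=> x [n _]; case: (sF n) => _; exact.
Qed.

Lemma spectral_setI (A : set (measurableTypeR R)) : measurable A -> spectral_set (A `&` S).
Proof.
move=> mA; split; last exact: subIsetr.
by apply: measurableI => //; exact: measurable_spectral_interval.
Qed.

Lemma rsm_sigma (F : nat -> set R) : (forall n, spectral_set (F n)) -> trivIset setT F ->
  nrm P (fun w => \sum_(i < n) phi (F i) w - phi (\bigcup_n F n) w) @[n --> \oo] --> 0.
Proof.
move=> sF tF; case: phi_rsm => _ /(_ _ sF tF) h _; apply/cvg_mean_squareE => //.
- by move=> n; apply: L2_sum => i; exact: rsm_L2.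
- exact/rsm_L2/spectral_set_bigcup.
Qed.

(** Taking the proof as an argument gives a term to which the measure structure declared below can
    be attached. *)
Definition ctrl of random_spectral_measure P phi := control_measure P phi.

Lemma ctrlE A : ctrl phi_rsm A = nsq P (phi (A `&` S)).
Proof. by rewrite /ctrl /control_measure mean_squareE. Qed.

Let ctrl0 : ctrl phi_rsm set0 = 0%E.
Proof.
rewrite ctrlE set0I nsqE; last exact: rsm_L2 spectral_set0.
(* The empty set is disjoint from itself, so its image is orthogonal to itself. *)
have := rsm_orth spectral_set0 spectral_set0 (setI0 _); rewrite ip_nrm.
by move=> /complexI ->.
Qed.

Let ctrl_ge0 A : (0 <= ctrl phi_rsm A)%E.
Proof. by rewrite ctrlE nsq_ge0. Qed.

Let nrm_sum (F : nat -> set R) n : (forall n, spectral_set (F n)) -> trivIset setT F ->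
  nrm P (fun w => \sum_(i < n) phi (F i) w) ^+ 2 = \sum_(i < n) nrm P (phi (F i)) ^+ 2.
Proof.
move=> sF tF; elim: n => [|n ih].
  by under eq_fun do rewrite big_ord0; rewrite big_ord0 nrm0 expr0n.
under eq_fun do rewrite big_ord_recr.
rewrite big_ord_recr/= nrm_sqD; [|by apply: L2_sum => i; exact: rsm_L2|exact: rsm_L2].
rewrite ih ip_suml; [|exact: rsm_L2|by move=> i; exact: rsm_L2].
rewrite [X in Re X]big1 ?mulr0 ?addr0// => i _; apply: rsm_orth => //.
by have /trivIsetP := tF; apply => //; rewrite ltn_eqF.
Qed.

Let ctrl_sigma : semi_sigma_additive (ctrl phi_rsm).
Proof.
move=> F mF tF mUF; pose F' n := F n `&` S.
have sF n : spectral_set (F' n) by exact: spectral_setI.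
have tF' : trivIset setT F' by apply: trivIset_setIr.
have UF : (\bigcup_n F n) `&` S = \bigcup_n F' n by rewrite setI_bigcupl.
have LU : L2 P (phi (\bigcup_n F' n)) by rewrite -UF; exact/rsm_L2/spectral_setI.
rewrite ctrlE UF (nsqE LU).
rewrite (_ : (fun n => _) = (fun n => (nrm P (fun w => \sum_(i < n) phi (F' i) w) ^+ 2)%:E)).
  apply: cvg_EFin; first by near=> n.
  suff h : nrm P (fun w => \sum_(i < n) phi (F' i) w) @[n --> \oo] -->
      nrm P (phi (\bigcup_n F' n)).
    exact: (cvg_comp _ _ h (@exprn_continuous R 2 _)).
  apply/cvgrPdist_lt => e e0.
  have /cvgn0P/(_ e e0)[N hN] := rsm_sigma sF tF'; exists N => // n /= Nn; rewrite distrC.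
  apply: le_lt_trans (hN n Nn); rewrite (ger0_norm (nrm_ge0 _ _)).
  by apply: nrm_dist => //; apply: L2_sum => i; exact: rsm_L2.
apply/funext => n; rewrite nrm_sum// big_mkord -sumEFin; apply: eq_bigr => i _.
by rewrite ctrlE nsqE//; exact: rsm_L2 (sF i).
Unshelve. all: by end_near. Qed.

HB.instance Definition _ := isMeasure.Build _ (measurableTypeR R) R (ctrl phi_rsm)
  ctrl0 ctrl_ge0 ctrl_sigma.

Lemma ctrl_fin : (ctrl phi_rsm setT < +oo)%E.
Proof. by rewrite ctrlE setTI nsqE ?ltry//; exact: rsm_L2 spectral_setT. Qed.

Lemma ctrl_supp : ctrl phi_rsm (~` S) = 0%E.
Proof. by rewrite ctrlE setICl -(setI0 S) setIC -ctrlE. Qed.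

(** Finite additivity has to be extracted from countable additivity: [A] is the union of its two
    parts followed by empty sets. The images of the latter are null without being the zero function,
    whence the induction in [key]. *)
Lemma rsm_split A B : spectral_set A -> measurable (B : set (measurableTypeR R)) ->
  [/\ spectral_set (A `&` B), spectral_set (A `\` B) &
     nrm P (fun w => phi A w - (phi (A `&` B) w + phi (A `\` B) w)) = 0].
Proof.
move=> sA mB.
have sI : spectral_set (A `&` B).
  by split; [apply: measurableI => //; case: sA|move=> x [/(sA.2)]].
have sD : spectral_set (A `\` B).
  by split; [apply: measurableD => //; case: sA|move=> x [/(sA.2)]].
split => //.
pose F n := if n is n.+1 then if n is n.+1 then set0 : set R else A `\` B else A `&` B.
have sF n : spectral_set (F n) by case: n => [|[|n]] //; exact: spectral_set0.
have ID : (A `&` B) `&` (A `\` B) = set0 by apply/seteqP; split => // x [[_ ?] [_]].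
have tF : trivIset setT F.
  by apply/trivIsetP => -[|[|i]] [|[|j]] _ _ //= _; rewrite ?set0I ?setI0// setIC.
have UF : \bigcup_n F n = A.
  apply/seteqP; split => [x [[|[|n]] _ []//]|x Ax].
  by have [Bx|nBx] := pselect (B x); [exists 0%N|exists 1%N].
have L0 : nrm P (phi set0) = 0.
  have := rsm_orth spectral_set0 spectral_set0 (setI0 _); rewrite ip_nrm.
  by move=> /complexI/eqP; rewrite sqrf_eq0 => /eqP.
have LF n : L2 P (phi (F n)) by exact: rsm_L2.
have Ls k : L2 P (fun w => \sum_(i < k) phi (F i) w) by apply: L2_sum => i; exact: LF.
have LA := rsm_L2 sA; have LID := L2D (rsm_L2 sI) (rsm_L2 sD).
have key n : nrm P (fun w => \sum_(i < n.+2) phi (F i) w -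
    (phi (A `&` B) w + phi (A `\` B) w)) = 0.
  elim: n => [|n ih].
    rewrite -(nrm0 P); congr nrm; apply/funext => w.
    by rewrite !big_ord_recl big_ord0 /= addr0 subrr.
  apply/eqP; rewrite eq_le nrm_ge0 andbT -[leRHS]addr0 -{1}ih -{1}L0.
  apply: le_trans (nrmD_le (L2B (Ls _) LID) (LF n.+2)); rewrite le_eqVlt.
  apply/orP; left; apply/eqP; congr nrm; apply/funext => w.
  by rewrite big_ord_recr /= addrAC.
apply/eqP; rewrite eq_le nrm_ge0 andbT; apply/ler_addgt0Pl => e e0; rewrite addr0.
have /cvgn0P/(_ e e0)[N /(_ N.+2)] := rsm_sigma sF tF.
rewrite UF ger0_norm ?nrm_ge0// => /(_ (leq_trans (leqnSn _) (leqnSn _))) hN.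
have := nrm_triangle LA (Ls N.+2) LID; rewrite key addr0 => /le_trans; apply.
by rewrite nrmB ltW.
Qed.

(** Cut along their intersection, [A] and [B] give three mutually disjoint pieces, and only the
    common one contributes. *)
Lemma ip_ctrl_indic A B : spectral_set A -> spectral_set B ->
  ip (ctrl phi_rsm) (cindic A) (cindic B) =
  ip P (phi A) (phi B).
Proof.
move=> sA sB; have [sI sAB hA] := rsm_split sA sB.1.
have [sI' sBA hB] := rsm_split sB sA.1.
rewrite ip_indic; [|by case: sA|by case: sB].
rewrite (setIC B A) in sI' hB.
have LI := rsm_L2 sI; have LAB := rsm_L2 sAB; have LBA := rsm_L2 sBA.
rewrite (ip_nrm0r _ _ _ hB)//; [|exact: rsm_L2|exact: L2D|exact: rsm_L2].
rewrite (ipJ (L2D LI LBA)); last exact: rsm_L2.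
rewrite (ip_nrm0r _ _ _ hA)//; [|exact: rsm_L2|exact: L2D|exact: L2D].
rewrite ipDl// ?ipDr//; [|exact: L2D..].
rewrite (rsm_orth sI sAB); last by apply/seteqP; split => // x [[_ ?] [_]].
rewrite (rsm_orth sBA sI); last by apply/seteqP; split => // x [[? h] [/h]].
rewrite (rsm_orth sBA sAB); last by apply/seteqP; split => // x [[? h] [/h]].
rewrite !addr0 ip_nrm conjc_real sqr_nrm [X in fine X]ctrlE.
by congr (fine (nsq P (phi _)))%:C; apply/setIidPl => x [/(sA.2)].
Qed.

Lemma L2_ctrl_indic A : spectral_set A -> L2 (ctrl phi_rsm) (cindic A).
Proof.
by move=> [mA _]; exact: L2_indic ctrl_fin mA.
Qed.

Definition step_graph (f : R -> R[i]) (Y : T -> R[i]) := exists s : step_function R,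
  f = step_value s /\ Y = step_integral phi s.

Lemma isometric_step : isometric (ctrl phi_rsm) P step_graph.
Proof.
split.
- have sF (i : 'I_0) : spectral_set (set0 : set R) by exact: spectral_set0.
  exists (StepFunction (fun=> 0) sF).
  by split; apply/funext => w; rewrite /step_value /step_integral big_ord0.
- move=> _ _ [s [-> ->]]; have sA := @step_setP _ s.
  split.
  + by apply: L2_sum => i; apply: L2Z; exact: L2_ctrl_indic.
  + by apply: L2_sum => i; apply: L2Z; exact: rsm_L2.
  + apply: (@nrm_lincomb _ (measurableTypeR R) _ _ _ (ctrl phi_rsm) P _
        (index_enum 'I_(step_size s)) (@step_coef _ s)
        (fun i x => (\1_(@step_set _ s i) x)%:C) (fun i => phi (@step_set _ s i))).
    * by move=> i; exact: L2_ctrl_indic.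
    * by move=> i; exact: rsm_L2.
    * by move=> i j; exact: ip_ctrl_indic.
- move=> c _ _ _ _ [s [-> ->]] [t [-> ->]].
  pose n := (step_size s + step_size t)%N.
  pose co (i : 'I_n) := match fintype.split i with inl j => step_coef j | inr j => c * step_coef j end.
  pose F (i : 'I_n) := match fintype.split i with inl j => step_set j | inr j => step_set j end.
  have sF i : spectral_set (F i) by rewrite /F; case: (fintype.split i) => j; exact: step_setP.
  exists (StepFunction co sF).
  split; apply/funext => w; rewrite /step_value /step_integral /= big_split_ord mulr_sumr /=.
    congr (_ + _); apply: eq_bigr => i _; rewrite /co /F.
      by rewrite (unsplitK (inl i)).
    by rewrite (unsplitK (inr i)) mulrA.
  congr (_ + _); apply: eq_bigr => i _; rewrite /co /F.
    by rewrite (unsplitK (inl i)).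
  by rewrite (unsplitK (inr i)) mulrA.
Qed.

Lemma nsq_ctrl_setT (f : R -> R[i]) : @cmeas _ (measurableTypeR R) R f ->
  (\int[ctrl phi_rsm]_(x in S) (sqmod (f x))%:E)%E = nsq (ctrl phi_rsm) f.
Proof.
move=> mf; have mS := @measurable_spectral_interval R.
have mf' : measurable_fun setT (fun x : measurableTypeR R => (sqmod (f x))%:E).
  by apply/measurable_EFinP; exact: measurable_sqmod.
rewrite /nsq -(setUv S) ge0_integral_setU//.
- rewrite [X in _ = (_ + X)%E](_ : _ = 0%E) ?adde0//.
  apply: null_set_integral; [exact: measurableC| |exact: ctrl_supp].
  exact: measurable_funS mf'.
- exact: measurableC.
- by rewrite setUv.
- by move=> x _; rewrite lee_fin sqmod_ge0.
- by rewrite disj_set2E setICr.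
Qed.

(** The bridge from the definition by sequences to closure up to any tolerance: tolerances
    [1 / (n + 1)] give back a sequence. By [intE] the integral over the circle is a norm, the
    control measure being carried by the circle. *)
Lemma spectral_integral_graph f Y : L2 (ctrl phi_rsm) f ->
  is_spectral_integral P phi f Y <-> graph_closure (ctrl phi_rsm) P step_graph f Y.
Proof.
move=> Lf; have [_ isoL _] := isometric_step.
have Ls s : L2 (ctrl phi_rsm) (step_value s).
  by have [] := isoL _ (step_integral phi s) (ex_intro _ s (conj erefl erefl)).
have LI s : L2 P (step_integral phi s).
  by have [] := isoL (step_value s) _ (ex_intro _ s (conj erefl erefl)).
have intE (s : nat -> step_function R) :
    ((\int[control_measure P phi]_(x in S)
        (sqmod (f x - step_value (s n) x))%:E)%E @[n --> \oo] --> 0%E) <->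
    (nrm (ctrl phi_rsm) (fun x => step_value (s n) x - f x) @[n --> \oo] --> 0).
  under [X in _ <-> (X @ _ --> _)]eq_fun do rewrite nrmB.
  rewrite -cvg_nrm_sq; last by move=> n; exact: L2B.
  rewrite (_ : (fun n => _) = (fun n => nsq (ctrl phi_rsm) (fun x => f x - step_value (s n) x)))//.
  by apply/funext => n; exact: (nsq_ctrl_setT (L2_cmeas (L2B Lf (Ls (s n))))).
split.
- move=> [/square_integrableE LY [s [/intE s1 /(cvg_mean_squareE (fun n => LI (s n)) LY) s2]]].
  split => // e e0; have /cvgn0P/(_ e e0)[N1 h1] := s1.
  have /cvgn0P/(_ e e0)[N2 h2] := s2; pose N := maxn N1 N2.
  exists (step_value (s N)), (step_integral phi (s N)); split; first by exists (s N).
    by have := h1 N (leq_maxl _ _); rewrite ger0_norm ?nrm_ge0.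
  by have := h2 N (leq_maxr _ _); rewrite ger0_norm ?nrm_ge0.
- move=> [_ LY h]; split; first exact/square_integrableE.
  have h' n : exists s : step_function R,
      nrm (ctrl phi_rsm) (fun x => step_value s x - f x) < n.+1%:R^-1 /\
      nrm P (fun w => step_integral phi s w - Y w) < n.+1%:R^-1.
    by have [|_ [_ [[s [-> ->]] h1 h2]]] := h n.+1%:R^-1; [rewrite invr_gt0|exists s].
  pose s n := projT1 (cid (h' n)).
  have hs n := projT2 (cid (h' n)).
  have toz (u : nat -> R) : (forall n, 0 <= u n < n.+1%:R^-1) -> u @ \oo --> 0.
    move=> hu; apply: (squeeze_cvgr _ (cvg_cst 0) (@cvg_harmonic R)).
    by apply: nearW => n; have /andP[-> /ltW ->] := hu n.
  exists s; split.
    by apply/intE; apply: toz => n; rewrite nrm_ge0; have [] := hs n.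
  by apply/cvg_mean_squareE => //; apply: toz => n; rewrite nrm_ge0; have [] := hs n.
Qed.

End control_measure.

(** * Helly selection on the circle *)

Lemma sum_step (R : realType) (z : nat -> R) (n : nat) (c : nat -> R[i]) (t : R) :
  (forall i, z i <= z i.+1) -> z 0%N < t <= z n ->
  exists i, [/\ (i < n)%N, z i < t <= z i.+1 &
    \sum_(j < n) c j * (\1_(`]z j, z j.+1]%classic : set R) t)%:C = c i].
Proof.
move=> zle /andP[z0 zn]; have zmono i j : (i <= j)%N -> z i <= z j.
  by move/(nondecreasing_seqP z).1 : zle => /[apply].
have n0 : (0 < n)%N by case: n zn => // /le_lt_trans /(_ z0); rewrite ltxx.
have ex : exists i, t <= z i.+1 by exists n.-1; rewrite prednK.
case: (ex_minnP ex) => i ti imin.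
have lein : (i < n)%N by rewrite -[n]prednK// ltnS imin// prednK.
have zi : z i < t.
  case: i ti imin lein => [//|i] ti imin lein.
  by rewrite ltNge; apply/negP => /imin; rewrite ltnn.
exists i; split; rewrite ?zi//.
rewrite (bigD1 (Ordinal lein))//= big1 ?addr0; last first.
  move=> j /eqP ji; rewrite indicE memNset ?mulr0// /= in_itv/= => /andP[j1 j2].
  apply: ji; apply/val_inj => /=; apply/eqP; rewrite eqn_leq imin// andbT.
  rewrite leqNgt; apply/negP => /zmono; lra.
by rewrite indicE mem_set ?mulr1//= in_itv/= zi.
Qed.

Lemma fmap_ultra_filter (I J : Type) (U : set_system I) (f : I -> J) :
  UltraFilter U -> UltraFilter (f @ U).
Proof.
move=> UU; have PU : ProperFilter U by exact: ultra_proper.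
split; first exact: fmap_proper_filter.
move=> G PG UG; apply/seteqP; split=> [A GA|]; last exact: UG.
have [//|nA] := in_ultra_setVsetC (f @^-1` A) UU.
have /filter_ex[y []//] : G (A `&` ~` A) by apply: filterI => //; exact: UG.
Qed.

(* Compactness of [0, c]^I. *)
Lemma cluster_function (R : realType) (I : choiceType) (F_ : nat -> I -> R) (c : R) :
  (forall n x, 0 <= F_ n x <= c) ->
  exists F : I -> R, forall (xs : seq I) (e : R) (N : nat), 0 < e ->
    exists n, (N <= n)%N /\ {in xs, forall x, `|F_ n x - F x| < e}.
Proof.
(* Along an ultrafilter finer than [\oo] all coordinates converge at once, with no diagonal
   extraction. *)
move=> F_c; have [U [UU oU]] := ultraFilterLemma (@eventually_filter).
have FU : Filter U by exact: (@ultra_proper _ _ UU).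
have lim x : exists l : R, F_ n x @[n --> U] --> l.
  have := @segment_compact R 0 c; rewrite compact_ultra => /(_ (F_ n x @[n --> U])).
  have UF : UltraFilter (F_ n x @[n --> U]) by exact: fmap_ultra_filter.
  case=> //.
    by apply: oU; exists 0%N => // n _ /=; rewrite in_itv/= F_c.
  by move=> l [_ h]; exists l.
have [F hF] := choice lim; exists F => xs e N e0.
have : U [set n | (N <= n)%N /\ {in xs, forall x, `|F_ n x - F x| < e}].
  elim: xs => [|x xs ih].
    by apply: oU; exists N => // n /= Nn; split.
  have /cvgrPdist_lt/(_ e e0) := hF x; move: ih; apply: filterS2 => n [Nn ih] hx.
  split => // y; rewrite in_cons => /predU1P[->|/ih//]; by rewrite distrC.
have PU : ProperFilter U by exact: ultra_proper.
by move=> /filter_ex[n [h1 h2]]; exists n.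
Qed.

(** * Sums over roots of unity *)

Section discrete_fourier.
Context (R : realType).

Lemma expi_neq1 (t : R) : 0 < `|t| < 2 * pi -> expi t != 1.
Proof.
wlog t0 : t / 0 < t.
  move=> h /andP[t1 t2]; have [t0|t0|t0] := ltrgt0P t.
  - by apply: h; rewrite // t1.
  - have := h (- t); rewrite normrN t1 t2 oppr_gt0 => /(_ t0 isT).
    by rewrite expiN; apply: contra => /eqP ->; rewrite conjc1.
  - by rewrite t0 normr0 ltxx in t1.
rewrite gtr0_norm// => /andP[_ t2]; apply/eqP => /(congr1 (@complex.Re R)) /=.
have -> : t = (t / 2) *+ 2 by rewrite -mulr_natr; field.
rewrite cos_mulr2n cos2sin2; have : 0 < sin (t / 2) ^+ 2.
  by rewrite exprn_gt0// sin_gt0_pi//; lra.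
rewrite -mulr_natr; lra.
Qed.

(** A geometric sum whose ratio is an [N]-th root of unity other than 1. *)
Lemma sum_expi_roots (N : nat) (z : int) : (0 < `|z| < N)%N ->
  \sum_(j < N) expi (2 * pi * j%:R / N%:R * z%:~R : R) = 0.
Proof.
move=> /andP[z0 zN]; have N0 : N%:R != 0 :> R.
  by rewrite pnatr_eq0 -lt0n (leq_trans _ zN).
pose t : R := 2 * pi * z%:~R / N%:R.
have t1 : expi t != 1.
  have Np : 0 < N%:R :> R by rewrite ltr0n (leq_trans _ zN).
  apply: expi_neq1; rewrite /t !normrM (ger0_norm (pi_ge0 R)) normfV.
  rewrite -intr_norm -abszE (ger0_norm (ltW Np)) (ger0_norm (_ : 0 <= 2))//.
  have pi0 := pi_gt0 R; apply/andP; split.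
    by rewrite divr_gt0// !mulr_gt0// ltr0n.
  by rewrite ltr_pdivrMr// ltr_pM2l ?mulr_gt0// ltr_nat.
apply: (mulfI (_ : expi t - 1 != 0)); first by rewrite subr_eq0.
rewrite mulr0 (eq_bigr (fun j : 'I_N => expi t ^+ j)); last first.
  by move=> j _; rewrite -expiMn; congr expi; rewrite /t; field.
rewrite -subrX1 -expiMn /t divfK//.
have := @expi_periodic R 1 z 0; rewrite mul0r add0r !mulr1 => ->.
by rewrite expi0 subrr.
Qed.

End discrete_fourier.

(** * From distribution functions to measures on the circle *)

Section circle_limit.
Context (R : realType).
Local Notation S := (@spectral_interval R).

(** Reduction modulo [2 pi], correct on []-1, 2 pi + 1]], where the Stieltjes measure will live. *)
Definition fold_circle (x : measurableTypeR R) : measurableTypeR R :=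
  if x < 0 then x + 2 * pi else if x < 2 * pi then x else x - 2 * pi.

Lemma measurable_fold_circle : measurable_fun setT fold_circle.
Proof.
have -> : fold_circle = (fun x => x + (2 * pi) * \1_(`]-oo, 0[%classic : set R) x
    - (2 * pi) * \1_(`[2 * pi, +oo[%classic : set R) x).
  have pi0 := pi_gt0 R; apply/funext => x; rewrite !indicE !mem_setE !in_itv/= andbT /fold_circle.
  case: ltP => x0; case: ltP => xp; rewrite ?mulr1 ?mulr0 ?addr0 ?subr0//; lra.
apply: measurable_funB; last first.
  by apply: measurable_funM => //; apply: measurable_indic; exact: measurable_itv.
apply: measurable_funD; first exact: measurable_id.
by apply: measurable_funM => //; apply: measurable_indic; exact: measurable_itv.
Qed.

Lemma expi_fold_circle (k : int) x : expi (fold_circle x * k%:~R) = expi (x * k%:~R).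
Proof.
rewrite /fold_circle; case: ifP => _.
  by have := expi_periodic k 1 x; rewrite mulr1.
case: ifP => // _.
by have := expi_periodic k (-1) x; rewrite mulrNz mulrN mulr1.
Qed.

Lemma fold_circle_spectral x : -1 < x <= 2 * pi + 1 -> S (fold_circle x).
Proof.
move=> /andP[x1 x2]; have pi2 := pi_ge2 R.
rewrite /S /= in_itv/= /fold_circle; case: ltP => x0; first by apply/andP; split; lra.
by case: ltP => xp; apply/andP; split; lra.
Qed.

Section right_regularization.
Variables (F : R -> R) (c : R).
Hypotheses (F_nd : {homo F : x y / x <= y}) (F_ge0 : forall x, 0 <= F x).

(** A pointwise limit of distribution functions is monotone but need not be right-continuous, as a
    Stieltjes measure requires. *)
Definition right_limit (x : R) := inf [set F y | y in [set y | x < y]].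

Let has_inf_F x : has_inf [set F y | y in [set y | x < y]].
Proof.
split; first by exists (F (x + 1)), (x + 1) => //=; rewrite ltrDl.
by exists 0 => _ [y _ <-].
Qed.

Lemma right_limit_le x y : x < y -> right_limit x <= F y.
Proof. by move=> xy; apply: ge_inf; [have [] := has_inf_F x|exists y]. Qed.

Lemma le_right_limit x : F x <= right_limit x.
Proof.
apply: lb_le_inf; first by have [] := has_inf_F x.
by move=> _ [y /= xy <-]; exact/F_nd/ltW.
Qed.

Lemma right_limit_lt x e : 0 < e -> exists y, x < y /\ F y < right_limit x + e.
Proof.
move=> e0; have [_ [y /= xy <-] h] := inf_adherent e0 (has_inf_F x).
by exists y.
Qed.

Lemma right_limit_nd : {homo right_limit : x y / x <= y}.
Proof.
move=> x y xy; apply: lb_le_inf; first by have [] := has_inf_F y.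
by move=> _ [z /= yz <-]; apply: right_limit_le; exact: le_lt_trans yz.
Qed.

Lemma right_limit_rc : right_continuous right_limit.
Proof.
move=> x; apply/cvgrPdist_lt => e e0; have [y [xy Fy]] := right_limit_lt x e0.
near=> z; rewrite distrC ger0_norm; last first.
  by rewrite subr_ge0; apply: right_limit_nd; near: z; exact: nbhs_right_ge.
rewrite ltrBlDl; apply: le_lt_trans Fy; apply: right_limit_le.
by near: z; exact: nbhs_right_lt.
Unshelve. all: by end_near. Qed.

HB.instance Definition _ := isCumulative.Build R _ R right_limit right_limit_nd right_limit_rc.

Definition stieltjes := lebesgue_stieltjes_measure right_limit.
HB.instance Definition _ := Measure.on stieltjes.

Lemma stieltjes_itv a b : a <= b ->
  stieltjes (`]a, b]%classic : set (measurableTypeR R)) = (right_limit b - right_limit a)%:E.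
Proof.
move=> ab; rewrite /stieltjes /lebesgue_stieltjes_measure /measure_extension/=.
by rewrite measurable_mu_extE/= ?wlength_itv_bnd//; exact: is_ocitv.
Qed.

End right_regularization.

End circle_limit.

Section pushforward_ip.
Context d1 d2 (T1 : measurableType d1) (T2 : measurableType d2) (R : realType).
Variables (m : {measure set T1 -> \bar R}) (f : T1 -> T2).
Hypothesis mf : measurable_fun setT f.

Lemma pushforward_is_measure : exists mu : {measure set T2 -> \bar R},
  forall A, mu A = m (f @^-1` A).
Proof. by exists (measure_function_pushforward__canonical__measure_function_Measure m mf). Qed.

Lemma ip_pushforward (mu : {measure set T2 -> \bar R}) (X Y : T2 -> R[i]) :
  (forall A, mu A = m (f @^-1` A)) -> cmeas X -> cmeas Y ->
  L2 m (fun w => X (f w)) -> L2 m (fun w => Y (f w)) ->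
  ip mu X Y = ip m (fun w => X (f w)) (fun w => Y (f w)).
Proof.
move=> muE mX mY LX LY; have [mR mI] := cmeasM mX (cmeasJ mY).
have E : (mu : set T2 -> \bar R) = pushforward m f by apply/funext => A; rewrite muE.
apply: complexP; rewrite /ip /= /Rintegral E integral_pushforward//.
- exact/measurable_EFinP.
- exact: integrable_ReM LX LY.
- exact/measurable_EFinP.
- exact: integrable_ImM LX LY.
Qed.

End pushforward_ip.

Section helly_circle.
Context (R : realType).
Local Notation S := (@spectral_interval R).
Variables (N : nat -> nat) (w p : nat -> nat -> R) (c : R) (gamma : int -> R[i]).
Hypothesis w_ge0 : forall n j, 0 <= w n j.
Hypothesis w_sum : forall n, \sum_(j < N n) w n j = c.
Hypothesis p_itv : forall n j, (j < N n)%N -> 0 <= p n j <= 2 * pi.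
Hypothesis gamma_lim : forall (k : int) (e : R), 0 < e -> exists n0, forall n, (n0 <= n)%N ->
  normc (\sum_(j < N n) (w n j)%:C * expi (p n j * k%:~R) - gamma k) <= e.

Let F_ n x : R := \sum_(j < N n) w n j * (p n j <= x)%R%:R.

Let F_itv n x : 0 <= F_ n x <= c.
Proof.
rewrite /F_ sumr_ge0 => [|j _]; last by rewrite mulr_ge0.
rewrite /= -(w_sum n); apply: ler_sum => j _; rewrite ler_piMr ?w_ge0//.
by case: (p n j <= x); rewrite ?lexx ?ler01.
Qed.

Let F_nd n x y : x <= y -> F_ n x <= F_ n y.
Proof.
move=> xy; apply: ler_sum => j _; rewrite ler_wpM2l// ler_nat.
by case: (leP (p n j) x) => // /le_trans/(_ xy) ->.
Qed.

(** Weak convergence is never stated. For each frequency [z] and tolerance, four quantities are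
    compared in turn: the integral, its Stieltjes sum in [G], a like sum in [F_ n] for one suitable
    [n], and the sum over the atoms. *)
Lemma helly_circle : exists mu : measureR R,
  [/\ (mu setT < +oo)%E, mu (~` S) = 0%E &
    forall k l : int, ip mu (expk k) (expk l) =
      gamma (k - l)].
Proof.
have [F hF] := cluster_function F_itv.
have F_lim x y a : (forall n, F_ n x <= F_ n y + a) -> F x <= F y + a.
  move=> h; apply/ler_addgt0Pl => e e0; have e2 : 0 < e / 2 by rewrite divr_gt0.
  have [n [_ hn]] := hF [:: x; y] (e / 2) 0%N e2.
  have := hn x (mem_head _ _); have := hn y; rewrite !inE eqxx orbT => /(_ isT).
  by rewrite !ltr_norml => /andP[? ?] /andP[? ?]; have := h n; lra.
have Fnd : {homo F : x y / x <= y}.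
  by move=> x y xy; have := F_lim x y 0; rewrite addr0; apply => n; rewrite addr0 F_nd.
have F_cst x a : (forall n, F_ n x = a) -> F x = a.
  move=> h; apply/eqP; rewrite -subr_eq0 -normr_le0; apply/ler_addgt0Pl => e e0.
  have [n [_ hn]] := hF [:: x] e 0%N e0; have := hn x (mem_head _ _).
  by rewrite h distrC addr0 => /ltW.
have Fneg x : x < 0 -> F x = 0.
  move=> x0; apply: F_cst => n; rewrite /F_ big1// => j _.
  have /andP[pj _] := p_itv (ltn_ord j).
  by rewrite leNgt (lt_le_trans x0)// mulr0.
have Fbig x : 2 * pi <= x -> F x = c.
  move=> x0; apply: F_cst => n; rewrite /F_ -(w_sum n); apply: eq_bigr => j _.
  have /andP[_ pj] := p_itv (ltn_ord j).
  by rewrite (le_trans pj)// mulr1.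
have F_ge0 x : 0 <= F x.
  have [x0|x0] := ltP x 0; first by rewrite Fneg.
  by rewrite -(Fneg (-1)) ?ltrN10// Fnd// (le_trans _ x0)// lerN10.
have F_lec x : F x <= c.
  have [x0|x0] := ltP x (2 * pi); first by rewrite -(Fbig (2 * pi))// Fnd// ltW.
  by rewrite Fbig.
have c0 : 0 <= c by rewrite (le_trans (F_ge0 0)).
have pi0 := pi_gt0 R; have pi2 := pi_ge2 R.
pose G := right_limit F.
have G0 : G (-1) = 0.
  apply/eqP; rewrite eq_le -{1}(Fneg (- 2^-1)) ?oppr_lt0 ?invr_gt0//.
  rewrite (right_limit_le F_ge0) /=; last by lra.
  by rewrite (le_trans (F_ge0 (-1)))// le_right_limit.
have Gc : G (2 * pi + 1) = c.
  apply: le_anti; apply/andP; split.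
    by apply: le_trans (F_lec (2 * pi + 2)); apply: right_limit_le => //; lra.
  by rewrite -{1}(Fbig (2 * pi + 1)) ?le_right_limit//; lra.
pose nu : measureR R := stieltjes F_ge0.
have nuI a b : a <= b -> nu (`]a, b]%classic : set (measurableTypeR R)) = (G b - G a)%:E.
  by move=> ab; exact: stieltjes_itv.
have nu0 : nu set0 = 0%E by exact: measure0.
(* The margins keep possible atoms at 0 and [2 pi] away from the ends, so that the interval has the
   whole mass [c]. *)
pose Dom : set (measurableTypeR R) := `]-1, 2 * pi + 1]%classic.
have mDom : measurable Dom by exact: measurable_itv.
have nuDom : nu Dom = c%:E by rewrite nuI ?Gc ?G0 ?subr0//; lra.
pose nuD : measureR R := mrestr nu mDom.
have nuDT : nuD setT = c%:E by rewrite /nuD /= /mrestr setTI.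
have nuDC : nuD (~` Dom) = 0%E by rewrite /nuD /= /mrestr setICl nu0.
have nuDD : nuD Dom = c%:E by rewrite /nuD /= /mrestr setIid.
have nuDfin : (nuD setT < +oo)%E by rewrite nuDT ltry.
have [mu muE] := pushforward_is_measure nuD (@measurable_fold_circle R).
exists mu; split; first by rewrite muE.
  rewrite muE -[RHS]nu0 -[LHS]/(nu (@fold_circle R @^-1` (~` S) `&` Dom)); congr (nu _).
  apply/seteqP; split => // x [/= nS]; rewrite /Dom /= in_itv/= => xD.
  exact/nS/fold_circle_spectral.
have Le := L2_expi nuDfin.
move=> k l; have Lf (z : int) : L2 nuD (fun x => expi (fold_circle x * z%:~R)).
  by under eq_fun do rewrite expi_fold_circle.
rewrite (ip_pushforward (@measurable_fold_circle R) muE (cmeas_expi _) (cmeas_expi _) (Lf _) (Lf _)).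
pose one (x : R) : R[i] := (\1_(setT : set R) x)%:C.
have L1 : L2 nuD one.
  exact: L2_indic.
set z := (k - l)%R.
have -> : ip nuD (fun x => expi (fold_circle x * k%:~R)) (fun x => expi (fold_circle x * l%:~R))
    = ip nuD (expk z) one.
  have E x : expi (fold_circle x * k%:~R) * conjc (expi (fold_circle x * l%:~R)) =
      expi (x * z%:~R) * conjc (one x).
    by rewrite !expi_fold_circle -expiN -expiD /one indicT conjc1 mulr1 /z rmorphB/= mulrBr.
  rewrite /ip; congr (_ +i* _); apply: eq_Rintegral => x _; by rewrite E.
pose K : R := 2 * `|z%:~R|; have K0 : 0 <= K by rewrite mulr_ge0.
apply/eqP; rewrite -subr_eq0; apply/eqP/normc_le_eps => e' e'0.
(* Eight shares: 1 for replacing the integrand by steps, 4 for passing from [G] to [F_ n], 2 for the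
   atoms, 1 for [gamma_lim]. *)
pose e := e' / 8; have e0 : 0 < e by rewrite divr_gt0.
have KceP : 0 <= K * c / e + 2 by rewrite addr_ge0// divr_ge0 ?mulr_ge0// ltW.
(* The term [K * c / e] makes the discretization error [K * h * c] at most [e]; the term 2 gives
   [h * 2 < 1], which keeps [y 0] to the left of the atoms. *)
pose M := (Num.truncn ((2 * pi + 2) * (K * c / e + 2))).+1.
have M0 : 0 < M%:R :> R by rewrite ltr0n.
pose h : R := (2 * pi + 2) / M%:R.
have h0 : 0 < h by rewrite divr_gt0//; lra.
have hsmall : h * (K * c / e + 2) < 1.
  by rewrite /h mulrAC ltr_pdivrMr// mul1r truncnS_gt.
have h2 : h * 2 < 1.
  apply: le_lt_trans hsmall; rewrite ler_pM2l// lerDr.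
  by rewrite divr_ge0 ?mulr_ge0// ltW.
have Khc : K * h * c <= e.
  rewrite (_ : K * h * c = h * (K * c / e) * e); last by field; rewrite gt_eqF.
  apply: ltW; rewrite gtr_pMl//; apply: le_lt_trans hsmall.
  by rewrite ler_pM2l// lerDl.
pose zz (i : nat) : R := -1 + h * i%:R.
have zzS i : zz i.+1 = zz i + h by rewrite /zz -natr1; ring.
have zz0 : zz 0%N = -1 by rewrite /zz mulr0 addr0.
have zzM : zz M = 2 * pi + 1 by rewrite /zz /h divfK ?gt_eqF//; ring.
have zzle i j : (i <= j)%N -> zz i <= zz j.
  by move=> ij; rewrite lerD2l ler_pM2l// ler_nat.
pose I (i : nat) : set (measurableTypeR R) := `]zz i, zz i.+1]%classic.
have mI i : measurable (I i) by exact: measurable_itv.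
have LI i : L2 nuD (cindic (I i)).
  exact: L2_indic.
pose st x : R[i] := \sum_(i < M) expi (zz i * z%:~R) * (\1_(I i) x)%:C.
have Lst : L2 nuD st by apply: L2_sum => i; exact: L2Z.
have est x : Dom x -> normc (expi (x * z%:~R) - st x) <= K * h.
  rewrite /Dom /= in_itv/= -zz0 -zzM => xD.
  have [|i [iM /andP[xi1 xi2] E]] := @sum_step R zz M (fun i => expi (zz i * z%:~R)) x _ xD.
    by move=> i; rewrite zzS lerDl ltW.
  rewrite /st E; apply: le_trans (expi_int_lipschitz _ _ _) _; rewrite ler_wpM2l//.
  by rewrite ger0_norm ?lerBlDl -?zzS// subr_ge0 ltW.
have B1 : normc (ip nuD (expk z) one - ip nuD st one) <= e.
  rewrite -ipBl//; apply: le_trans (cauchy_schwarz (L2B (Le z) Lst) L1) _.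
  have n1 : nrm nuD (fun x => expi (x * z%:~R) - st x) <= K * h * Num.sqrt c.
    have := nrm_bound mDom nuDC _ (L2B (Le z) Lst) (mulr_ge0 K0 (ltW h0)) est.
    by rewrite nuDD ltry => /(_ isT).
  have n2 : nrm nuD one <= 1 * Num.sqrt c.
    have := nrm_bound mDom nuDC _ L1 ler01 (fun x _ => _).
    rewrite nuDD ltry; apply => //.
    by move=> x; rewrite /one indicT normc1.
  apply: le_trans (ler_pM (nrm_ge0 _ _) (nrm_ge0 _ _) n1 n2) _.
  have -> : K * h * Num.sqrt c * (1 * Num.sqrt c) = K * h * Num.sqrt c ^+ 2 by ring.
  by rewrite sqr_sqrtr.
have B2 : ip nuD st one = \sum_(i < M) expi (zz i * z%:~R) * (G (zz i.+1) - G (zz i))%:C.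
  rewrite ip_suml// => [|i]; last exact: L2Z.
  apply: eq_bigr => i _; rewrite ipZl// ip_indic// setIT.
  rewrite (_ : nuD (I i) = (G (zz i.+1) - G (zz i))%:E)//.
  rewrite /nuD /= /mrestr (_ : I i `&` Dom = I i) ?nuI//.
    by rewrite zzS lerDl ltW.
  apply/setIidPl => x; rewrite /I /Dom /= !in_itv/= => /andP[x1 x2].
  rewrite (le_lt_trans _ x1) ?(le_trans x2)//; first by rewrite -zzM zzle.
  by rewrite -zz0 zzle.
(* Each of the [M] cells has two ends with error [2 * eta], for a total of [4 * e]. *)
pose eta : R := e / M%:R; have eta0 : 0 < eta by rewrite divr_gt0.
(* [F_ n] approximates [F], which may differ from [G] at a jump. Slightly to the right of [zz i]
   there is a point where [F] is close to [G (zz i)]; the cap [h / 2] keeps it inside the cell. *)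
have y_ex i : exists y, zz i < y < zz i.+1 /\ G (zz i) <= F y <= G (zz i) + eta.
  have [y [zy yG]] := right_limit_lt F_ge0 (zz i) eta0.
  have zzi : zz i < zz i + h / 2 by rewrite ltrDl divr_gt0.
  exists (Num.min y (zz i + h / 2)); split.
    by rewrite lt_min zy zzi/= zzS gt_min ltrD2l; apply/orP; right; lra.
  rewrite (right_limit_le F_ge0) ?lt_min ?zy//=.
  by apply: le_trans (ltW yG); apply: Fnd; rewrite ge_min lexx.
have [y hy] := choice y_ex.
have [n0 hn0] := gamma_lim z e0.
have [n [n0n hn]] := hF [seq y i | i <- iota 0 M.+1] eta n0 eta0.
have FG i : (i <= M)%N -> `|G (zz i) - F_ n (y i)| <= 2 * eta.
  move=> iM; have : `|F_ n (y i) - F (y i)| < eta.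
    by apply: hn; apply/map_f; rewrite mem_iota add0n ltnS.
  have [_ /andP[g1 g2]] := hy i.
  rewrite ltr_norml ler_norml => /andP[k1 k2].
  by clear -g1 g2 k1 k2; apply/andP; split; lra.
have B3 : normc (\sum_(i < M) expi (zz i * z%:~R) * (G (zz i.+1) - G (zz i))%:C -
    \sum_(i < M) expi (zz i * z%:~R) * (F_ n (y i.+1) - F_ n (y i))%:C) <= 4 * e.
  rewrite -sumrB; apply: le_trans (le_normc_sum _ _ _) _.
  apply: (@le_trans _ _ (\sum_(i < M) 4 * eta)); last first.
    by rewrite sumr_const card_ord -(mulr_natr (4 * eta)) -mulrA /eta divfK ?gt_eqF.
  apply: ler_sum => i _; rewrite -mulrBr normcM normc_expi mul1r -rmorphB normcR.
  have := FG i (ltnW (ltn_ord i)); have := FG i.+1 (ltn_ord i).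
  rewrite !ler_norml => /andP[k1 k2] /andP[k3 k4].
  by clear -k1 k2 k3 k4; apply/andP; split; lra.
have yle i : y i <= y i.+1.
  by have [/andP[_ h1] _] := hy i; have [/andP[h3 _] _] := hy i.+1; rewrite ltW// (lt_trans h1).
have B4 : \sum_(i < M) expi (zz i * z%:~R) * (F_ n (y i.+1) - F_ n (y i))%:C =
    \sum_(j < N n) (w n j)%:C *
      \sum_(i < M) expi (zz i * z%:~R) * (\1_(`]y i, y i.+1]%classic : set R) (p n j))%:C.
  under [RHS]eq_bigr do rewrite mulr_sumr; rewrite exchange_big/=; apply: eq_bigr => i _.
  rewrite /F_ -sumrB rmorph_sum mulr_sumr; apply: eq_bigr => j _.
  rewrite mulrCA -rmorphM; congr (_ * _%:C); rewrite -mulrBr; congr (_ * _).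
  rewrite indicE mem_setE in_itv/=; case: (ltP (y i) (p n j)) => h1 /=; first by rewrite subr0.
  by rewrite (le_trans h1)// subrr.
(* The interval []y i, y i.+1]] meets only two consecutive cells, whence [2 * h]. *)
have B5 : normc (\sum_(i < M) expi (zz i * z%:~R) * (F_ n (y i.+1) - F_ n (y i))%:C -
    \sum_(j < N n) (w n j)%:C * expi (p n j * z%:~R)) <= 2 * e.
  rewrite B4 -sumrB; apply: le_trans (le_normc_sum _ _ _) _.
  apply: (@le_trans _ _ (\sum_(j < N n) w n j * (K * (2 * h)))); last first.
    rewrite -mulr_suml w_sum; have -> : c * (K * (2 * h)) = 2 * (K * h * c) by ring.
    by rewrite ler_pM2l.
  apply: ler_sum => j _; rewrite -mulrBr normcM normcR ger0_norm// ler_wpM2l//.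
  have pM : y 0%N < p n j <= y M.
    have /andP[p0 p1] := p_itv (ltn_ord j).
    have [/andP[_ h1] _] := hy 0%N; have [/andP[h3 _] _] := hy M.
    by move: h1 h3; rewrite zzS zz0 zzM => h1 h3; clear -h1 h3 p0 p1 h0 h2 pi0; apply/andP; split; lra.
  have [i [iM /andP[i1 i2] ->]] := sum_step (fun i => expi (zz i * z%:~R)) yle pM.
  apply: le_trans (expi_int_lipschitz _ _ _) _; rewrite ler_wpM2l//.
  have [/andP[h1 _] _] := hy i; have [/andP[_ h3] _] := hy i.+1.
  move: h3; rewrite !zzS ler_norml => h3.
  by clear -h1 h3 i1 i2 h0; apply/andP; split; lra.
rewrite B2 in B1.
set a := ip nuD _ one in B1 *.
set s1 := (\sum_(i < M) expi (zz i * z%:~R) * (G (zz i.+1) - G (zz i))%:C) in B1 B3.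
set s2 := (\sum_(i < M) expi (zz i * z%:~R) * (F_ n (y i.+1) - F_ n (y i))%:C) in B3 B5.
set s3 := (\sum_(j < N n) (w n j)%:C * expi (p n j * z%:~R)) in B5.
have B6 : normc (s3 - gamma z) <= e by exact: hn0.
have -> : a - gamma z = (a - s1) + ((s1 - s2) + ((s2 - s3) + (s3 - gamma z))) by ring.
have -> : e' = e + (4 * e + (2 * e + e)) by rewrite /e; field.
by do 3 apply: (le_trans (le_normcD _ _) (lerD _ _)) => //.
Qed.

End helly_circle.

Lemma real_complexM (R : realType) (a b : R) : (a * b)%:C = a%:C * b%:C :> R[i].
Proof. exact: rmorphM. Qed.

Lemma real_complexB (R : realType) (a b : R) : (a - b)%:C = a%:C - b%:C :> R[i].
Proof. exact: rmorphB. Qed.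

Lemma real_complex_sum (R : realType) (I : Type) (s : seq I) (Q : pred I) (F : I -> R) :
  (\sum_(i <- s | Q i) F i)%:C = \sum_(i <- s | Q i) (F i)%:C :> R[i].
Proof. exact: rmorph_sum. Qed.

(** * Herglotz' theorem and existence of the spectral measures *)

Section herglotz.
Context d (T : measurableType d) (R : realType) (P : {measure set T -> \bar R}).
Local Notation S := (@spectral_interval R).
Variables (xi : int -> T -> R[i]) (gamma : int -> R[i]).
Hypothesis L2_xi : forall k, L2 P (xi k).
Hypothesis ip_xi : forall k l, ip P (xi k) (xi l) = gamma (k - l).

(** The frequencies [m - k + l] met in [moment] have modulus at most [2 * n + 1]; with [2 * n.+1]
    nodes none of them is aliased to 0. *)
Let node (n j : nat) : R := 2 * pi * j%:R / (2 * n.+1)%:R.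

(* The weights [periodogram n j] at the points [node n j] have trigonometric moments
   [(1 - m / (n + 1)) gamma m], by orthogonality of the roots of unity. *)
Let periodogram (n j : nat) : R :=
  nrm P (fun w => \sum_(k < n.+1) expi (- node n j * k%:R) * xi k w) ^+ 2
    / (n.+1 * (2 * n.+1))%:R.

Let periodogramE n j : (periodogram n j)%:C = ((n.+1 * (2 * n.+1))%:R^-1)%:C *
  \sum_(k < n.+1) \sum_(l < n.+1)
     expi (- node n j * k%:R) * conjc (expi (- node n j * l%:R)) * gamma (k%:Z - l%:Z).
Proof.
rewrite /periodogram mulrC real_complexM; congr (_ * _).
rewrite -ip_nrm ip_suml; last by move=> i; exact: L2Z.
  apply: eq_bigr => k _; rewrite ip_sumr; [|exact: L2Z|by move=> i; exact: L2Z].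
  by apply: eq_bigr => l _; rewrite ipZl ?ipZr ?ip_xi//; [ring|exact: L2Z].
by apply: L2_sum => i; exact: L2Z.
Qed.

Let count_lt (M m : nat) : (\sum_(l < M) (l + m < M) = M - m)%N.
Proof.
under eq_bigr do rewrite addnC -ltn_subRL.
by rewrite -big_mkcond/= -(big_ord_widen _ (fun=> 1%N)) ?leq_subr// sum1_card card_ord.
Qed.

Let moment (n m : nat) : (m <= n.+1)%N ->
  \sum_(j < 2 * n.+1) (periodogram n j)%:C * expi (node n j * m%:R) =
  ((n.+1 - m)%:R / n.+1%:R)%:C * gamma m%:Z.
Proof.
move=> mn; set M := n.+1 in mn *; pose N := (2 * M)%N.
have M0 : M%:R != 0 :> R by rewrite pnatr_eq0.
have N0 : N%:R != 0 :> R by rewrite pnatr_eq0 muln_eq0.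
(* Only the pairs with [k = l + m] survive; there are [n.+1 - m] of them. *)
have term (k l : 'I_M) :
    \sum_(j < N) expi (- node n j * k%:R) * conjc (expi (- node n j * l%:R)) *
      expi (node n j * m%:R) = (N%:R * (k == (l + m)%N :> nat)%:R)%:C.
  pose z : int := m%:Z - k%:Z + l%:Z.
  have E (j : 'I_N) : expi (- node n j * k%:R) * conjc (expi (- node n j * l%:R)) *
      expi (node n j * m%:R) = expi (2 * pi * j%:R / N%:R * z%:~R).
    rewrite -expiN -!expiD; congr expi; rewrite /node /z rmorphD rmorphB/=; ring.
  under eq_bigr do rewrite E; have [klm|klm] := eqVneq (k : nat) (l + m)%N.
    rewrite (_ : z = 0); last by rewrite /z klm PoszD; ring.
    under eq_bigr do rewrite mulr0 expi0.
    by rewrite sumr_const card_ord mulr1 rmorph_nat.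
  rewrite mulr0 sum_expi_roots//; have := ltn_ord k; have := ltn_ord l.
  rewrite /N /z; lia.
under eq_bigr do rewrite periodogramE -mulrA mulr_suml.
rewrite -mulr_sumr exchange_big/=.
under eq_bigr => k _.
  under eq_bigr do rewrite mulr_suml.
  rewrite exchange_big/=.
  under eq_bigr => l _.
    under eq_bigr do rewrite mulrAC.
    rewrite -mulr_suml term.
    over.
  over.
have -> : \sum_(k < M) \sum_(l < M) (N%:R * (k == (l + m)%N :> nat)%:R)%:C * gamma (k%:Z - l%:Z) =
    (N%:R * (M - m)%:R)%:C * gamma m%:Z.
  rewrite -(count_lt M m) exchange_big/= natr_sum mulr_sumr real_complex_sum mulr_suml.
  apply: eq_bigr => l _; case: ltnP => lm /=; last first.
    rewrite mulr0 mul0r big1// => k _; rewrite (_ : _ == _ = false) ?mulr0 ?mul0r//.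
    by apply/negbTE; rewrite neq_ltn (leq_trans (ltn_ord k) lm).
  rewrite (bigD1 (Ordinal lm))//= eqxx big1 ?addr0.
    by congr (_ * gamma _); rewrite PoszD; ring.
  move=> k /eqP kl; rewrite (_ : _ == _ = false) ?mulr0 ?mul0r//.
  by apply/negbTE/eqP => h; apply: kl; exact/val_inj.
rewrite mulrA -real_complexM; congr (_%:C * _).
have -> : (M * (2 * M))%:R = M%:R * N%:R :> R by rewrite natrM.
by move: (M - m)%:R (N%:R) (M%:R) N0 M0 => a b c b0 c0; field; rewrite b0 c0.
Qed.

Lemma herglotz : exists mu : measureR R,
  [/\ (mu setT < +oo)%E, mu (~` S) = 0%E &
    forall k l : int, ip mu (expk k) (expk l) =
      ip P (xi k) (xi l)].
Proof.
have gammaN k : gamma (- k) = conjc (gamma k).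
  by rewrite -(subr0 k) -ip_xi -ipJ// ip_xi subr0 sub0r.
have p_ge0 n j : 0 <= periodogram n j by rewrite divr_ge0 ?sqr_ge0.
have p_sum n : \sum_(j < 2 * n.+1) periodogram n j = nrm P (xi 0) ^+ 2.
  apply: complexI; rewrite -ip_nrm ip_xi subrr real_complex_sum.
  have := moment (leq0n n.+1); rewrite subn0 divff ?pnatr_eq0// mul1r => <-.
  by apply: eq_bigr => j _; rewrite mulr0 expi0 mulr1.
have node_itv n j : (j < 2 * n.+1)%N -> 0 <= node n j <= 2 * pi.
  move=> jn; have pi0 := pi_ge0 R; rewrite /node divr_ge0 ?mulr_ge0//=.
  by rewrite ler_pdivrMr ?ltr0n ?muln_gt0// ler_wpM2l ?mulr_ge0// ler_nat ltnW.
have lim_nat (m : nat) (e : R) : 0 < e -> exists n0, forall n, (n0 <= n)%N ->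
    normc (\sum_(j < 2 * n.+1) (periodogram n j)%:C * expi (node n j * m%:R) - gamma m%:Z) <= e.
  move=> e0; pose B := m%:R * normc (gamma m%:Z) / e.
  exists (maxn m (Num.truncn B)) => n; rewrite geq_max => /andP[mn Bn].
  rewrite (moment (leqW mn)) -{2}[gamma m%:Z]mul1r -mulrBl normcM.
  rewrite -(real_complexB _ 1) normcR natrB ?leqW//.
  have n0 : 0 < n.+1%:R :> R by rewrite ltr0n.
  have -> : (n.+1%:R - m%:R) / n.+1%:R - 1 = - (m%:R / n.+1%:R) :> R.
    by field; rewrite gt_eqF.
  rewrite normrN ger0_norm ?divr_ge0// mulrAC ler_pdivrMr// [leRHS]mulrC -ler_pdivrMr//.
  apply: (@le_trans _ _ (Num.truncn B).+1%:R); first exact/ltW/truncnS_gt.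
  by rewrite ler_nat ltnS.
have [|mu [mu1 mu2 mu3]] := helly_circle p_ge0 p_sum node_itv (gamma := gamma); last first.
  by exists mu; split => // k l; rewrite mu3 ip_xi.
move=> k e e0; case: k => m; first exact: lim_nat.
(* Negative frequencies follow by conjugation, as the weights are real. *)
have [n0 hn0] := lim_nat m.+1 e e0; exists n0 => n /hn0.
rewrite -normcJ conjcD conjcN -gammaN conjc_sum NegzE; congr (normc (_ - _) <= _).
by apply: eq_bigr => j _; rewrite conjcM conjc_real -expiN mulrNz mulrN.
Qed.

End herglotz.

(** * Construction of the random spectral measure *)

Section spectral_measure_existence.
Context d (T : measurableType d) (R : realType) (P : probability T R).
Local Notation S := (@spectral_interval R).
Variable xi : int -> T -> R[i].
Hypothesis L2_xi : forall k, L2 P (xi k).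
Variable mu : measureR R.
Hypothesis mu_fin : (mu setT < +oo)%E.
Hypothesis mu_supp : mu (~` S) = 0%E.
Hypothesis ip_mu : forall k l : int,
  ip mu (expk k) (expk l) = ip P (xi k) (xi l).

Definition trig_graph (f : R -> R[i]) (Y : T -> R[i]) := exists s : seq (R[i] * int),
  f = trig s /\ Y = trig_apply xi s.

Lemma isometric_trig : isometric mu P trig_graph.
Proof.
split.
- by exists [::]; split; apply/funext => x; rewrite /trig /trig_apply big_nil.
- move=> _ _ [s [-> ->]]; split.
  + exact: L2_trig.
  + by apply: L2_sum => c; exact: L2Z.
  + have L2e := L2_expi mu_fin; exact: (@nrm_lincomb _ (measurableTypeR R) _ _ _ mu P _ s fst
      (fun c x => expi (x * c.2%:~R)) (fun c => xi c.2)).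
- move=> c _ _ _ _ [s [-> ->]] [t [-> ->]]; exists (s ++ trig_scale c t).
  split; apply/funext => x; first by rewrite trig_cat trig_scaleE.
  rewrite /trig_apply big_cat big_map mulr_sumr; congr (_ + _).
  by apply: eq_bigr => e _; rewrite mulrA.
Qed.

Let J := graph_closure mu P trig_graph.

Let isoJ : isometric mu P J. Proof. exact: isometric_closure isometric_trig. Qed.

Let phi_exists : exists phi : set R -> T -> R[i],
  forall A, spectral_set A -> J (cindic A) (phi A).
Proof.
suff /choice[phi hphi] : forall A, exists Y, spectral_set A -> J (cindic A) Y.
  by exists phi.
move=> A; have [sA|nsA] := pselect (spectral_set A); last by exists (fun=> 0).
have [Lf hf] := trig_limit_indic mu_fin mu_supp sA.1.
have [e e0|Y hY] := graph_closure_exists isometric_trig Lf; last by exists Y.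
by have [s hs] := hf e e0; exists (trig s), (trig_apply xi s); split => //; exists s.
Qed.

(** Additivity and orthogonality hold for indicators in [L2 mu] and are carried over by the isometry
    [J]. For the integral of [e^(ikx)], step functions must converge both for the control measure of
    [phi] and for [mu]. *)
Lemma spectral_measure_exists : exists phi, random_spectral_measure P phi /\
  forall k : int, is_spectral_integral P phi (expk k) (xi k).
Proof.
have [phi hphi] := phi_exists; have [J0 Jn Jl] := isoJ.
have Lphi A : spectral_set A -> L2 P (phi A) by move=> /hphi /Jn[].
have L1 A : spectral_set A -> L2 mu (cindic A) by move=> /hphi /Jn[].
have rsm : random_spectral_measure P phi.
  split.
  - by move=> A /Lphi/square_integrableE.
  - move=> F sF tF; have Ls n : L2 P (fun w => \sum_(i < n) phi (F i) w).
      by apply: L2_sum => i; exact: Lphi.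
    apply/cvg_mean_squareE => //; first exact/Lphi/spectral_set_bigcup.
    have E n : nrm P (fun w => \sum_(i < n) phi (F i) w - phi (\bigcup_n F n) w) =
        nrm mu (fun x => \sum_(i < n) (\1_(F i) x)%:C - (\1_(\bigcup_n F n) x)%:C).
      have Js : J (fun x => \sum_(i < n) (\1_(F i) x)%:C) (fun w => \sum_(i < n) phi (F i) w).
        have := isometric_sum isoJ (index_enum 'I_n) (fun=> 1) (fun i => hphi _ (sF i)).
        by congr J; apply/funext => x; apply: eq_bigr => i _; rewrite mul1r.
      by have [_ _] := Jn _ _ (isometricB isoJ Js (hphi _ (spectral_set_bigcup sF))).
    under eq_fun do rewrite E.
    by apply: indic_bigcup_cvg => // n; case: (sF n).
  - move=> A B sA sB AB; rewrite cexpectationE.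
    rewrite -(isometric_ip isoJ (hphi _ sA) (hphi _ sB)) ip_indic; [|by case: sA|by case: sB].
    by rewrite AB measure0.
exists phi; split => // k.
have Lk := L2_expi (ctrl_fin rsm) k.
apply: (spectral_integral_graph (xi k) Lk).2; split => // e e0.
(* Arc steps approximate uniformly on the circle, so one of them serves both measures and only the
   total masses enter; the 1 keeps [C] positive. *)
pose C := Num.sqrt (fine (ctrl rsm S)) + Num.sqrt (fine (mu S)) + 1.
have C0 : 0 < C by rewrite ltr_wpDl// addr_ge0 ?sqrtr_ge0.
have eC : 0 < e / C / 2 by rewrite !divr_gt0.
have K0 : 0 <= 2 * `|k%:~R| :> R by rewrite mulr_ge0.
have [N hN] := arc_step_approx 0 K0 eC (@expi_int_lipschitz R k)
  (fun u m => expi_periodic k m u).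
pose st := arc_step (fun x : R => expi (x * k%:~R)) 0 N.+1.
have bound (nu : measureR R) : (nu setT < +oo)%E ->
    nu (~` S) = 0%E -> Num.sqrt (fine (nu S)) <= C ->
    nrm nu (fun x => step_value st x - expi (x * k%:~R)) < e.
  move=> nuT nuS nuC; rewrite nrmB.
  apply: (@le_lt_trans _ _ (e / C / 2 * Num.sqrt (fine (nu S)))).
    apply: nrm_spectral_bound => //; [|exact: ltW|by move=> x Sx; exact: hN].
    apply: L2B; first exact: L2_expi.
    exact: (L2_bounded nuT (measurable_step_value _) (step_value_bound _)).
  apply: (@le_lt_trans _ _ (e / C / 2 * C)); first by rewrite ler_pM2l.
  rewrite mulrAC divfK ?gt_eqF//; lra.
exists (step_value st), (step_integral phi st); split; first by exists st.
  apply: bound; [exact: ctrl_fin|exact: ctrl_supp|].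
  by rewrite /C -addrA lerDl addr_ge0 ?sqrtr_ge0.
have Jst : J (step_value st) (step_integral phi st).
  exact: (isometric_sum isoJ (index_enum 'I_(step_size st)) (@step_coef _ st)
    (fun i => hphi _ (@step_setP _ st i))).
have Jk : J (expk k) (xi k).
  apply: (graph_closure_sub isometric_trig); exists [:: (1, k)].
  by split; apply/funext => x; rewrite /trig /trig_apply big_seq1 mul1r.
have [_ _ <-] := Jn _ _ (isometricB isoJ Jst Jk).
apply: bound => //; rewrite /C addrAC lerDr addr_ge0 ?sqrtr_ge0//.
Qed.

End spectral_measure_existence.

Section L2_more.
Context d (T : measurableType d) (R : realType).
Implicit Types (m : {measure set T -> \bar R}) (X Y : T -> R[i]).

Lemma nrm_le m X Y : cmeas X -> L2 m Y -> (forall w, normc (X w) <= normc (Y w)) ->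
  L2 m X /\ nrm m X <= nrm m Y.
Proof.
move=> mX LY XY; have XY2 w : sqmod (X w) <= sqmod (Y w).
  by rewrite !sqmodE ler_sqr ?nnegrE ?normc_ge0.
have [mY iY] := (L2_intsq m Y).1 LY; have LX : L2 m X by exact: L2_le iY XY2.
split => //; rewrite -ler_sqr ?nnegrE ?nrm_ge0// -lee_fin -!nsqE//.
apply: ge0_le_integral => //.
- by move=> w _; rewrite lee_fin sqmod_ge0.
- by apply/measurable_EFinP; exact: measurable_sqmod.
- by apply/measurable_EFinP; exact: measurable_sqmod.
- by move=> w _; rewrite lee_fin.
Qed.

Lemma nrmM_le m X Y (C : R) : cmeas X -> L2 m Y -> (forall w, normc (X w) <= C) ->
  nrm m (fun w => X w * Y w) <= C * nrm m Y.
Proof.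
move=> mX LY XC; have [C0|C0] := leP 0 C; last first.
  (* A negative [C] leaves no point [w], so both functions equal the zero function. *)
  rewrite (_ : nrm m _ = 0); last first.
    rewrite -(nrm0 m); congr nrm; apply/funext => w.
    by have := le_lt_trans (XC w) C0; rewrite ltNge normc_ge0.
  rewrite (_ : nrm m Y = 0) ?mulr0// -(nrm0 m); congr nrm; apply/funext => w.
  by have := le_lt_trans (XC w) C0; rewrite ltNge normc_ge0.
have [|_ h] := nrm_le (cmeasM mX (L2_cmeas LY)) (L2Z C%:C LY) _.
  by move=> w; rewrite !normcM normcR ger0_norm// ler_wpM2r ?normc_ge0.
by rewrite nrmZ// normcR ger0_norm in h.
Qed.

Lemma nsq_measure_add (m1 m2 : {measure set T -> \bar R}) X : cmeas X ->
  nsq (measure_add m1 m2) X = (nsq m1 X + nsq m2 X)%E.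
Proof.
move=> mX; rewrite /nsq ge0_integral_measure_add//.
  by move=> w _; rewrite lee_fin sqmod_ge0.
by apply/measurable_EFinP; exact: measurable_sqmod.
Qed.

Lemma nrm_measure_add (m1 m2 : {measure set T -> \bar R}) X : L2 (measure_add m1 m2) X ->
  nrm m1 X <= nrm (measure_add m1 m2) X /\ nrm m2 X <= nrm (measure_add m1 m2) X.
Proof.
move=> LX; have mX := L2_cmeas LX; have [_ _] := LX.
have n1 := nsq_ge0 m1 X; have n2 := nsq_ge0 m2 X.
rewrite /nrm nsq_measure_add// => h.
have f1 : nsq m1 X \is a fin_num.
  by rewrite ge0_fin_numE//; apply: le_lt_trans h; rewrite leeDl.
have f2 : nsq m2 X \is a fin_num.
  by rewrite ge0_fin_numE//; apply: le_lt_trans h; rewrite leeDr.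
by rewrite (fineD f1 f2); split; apply: ler_wsqrtr; rewrite ?lerDl ?lerDr fine_ge0.
Qed.

End L2_more.

(** Density in [L2] of [m1 + m2], whose norm dominates the other two. *)
Lemma trig_approx2 (R : realType) (m1 m2 : measureR R)
    (A : set (measurableTypeR R)) (e : R) :
  (m1 setT < +oo)%E -> m1 (~` (@spectral_interval R)) = 0%E ->
  (m2 setT < +oo)%E -> m2 (~` (@spectral_interval R)) = 0%E ->
  measurable A -> 0 < e -> exists s : seq (R[i] * int),
    nrm m1 (fun x => trig s x - (\1_A x)%:C) < e /\
    nrm m2 (fun x => trig s x - (\1_A x)%:C) < e.
Proof.
move=> f1 s1 f2 s2 mA e0; pose m : measureR R := measure_add m1 m2.
have mE B : m B = (m1 B + m2 B)%E by exact: measure_addE.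
have fm : (m setT < +oo)%E by rewrite mE lte_add_pinfty.
have sm : m (~` (@spectral_interval R)) = 0%E by rewrite mE s1 s2 adde0.
have [LA /(_ e e0)[s hs]] := trig_limit_indic fm sm mA; exists s.
have := nrm_measure_add (L2B (L2_trig fm s) LA).
by move=> [h1 h2]; split; [exact: le_lt_trans h1 hs|exact: le_lt_trans h2 hs].
Qed.

(** * Convergence in the plane and regular summation methods *)

Section complex_convergence.
Context (R : realType).

Lemma cvg_complexP (T : Type) (F : set_system T) (FF : Filter F) (f : T -> R[i]) (l : R[i]) :
  (f x : R[i]^o) @[x --> F] --> (l : R[i]^o) <-> normc (f x - l) @[x --> F] --> 0.
Proof.
have nE (z : R[i]^o) : `|z| = (normc z)%:C by case: z.
have E x : `|0 - normc (f x - l)| = normc (l - f x).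
  by rewrite sub0r normrN ger0_norm ?normc_ge0// normcB.
split=> [/cvgrPdist_lt h|/cvgrPdist_lt h]; apply/cvgrPdist_lt => e e0.
  have := h e%:C; rewrite ltcR => /(_ e0); apply: filterS => x.
  by rewrite E nE ltcR.
(* The tolerance is a positive element of [R[i]], hence real. *)
have eE : e = (Re e)%:C by move: e0; case: e {h} => a b; rewrite ltcE/= => /andP[/eqP -> _].
have := h (Re e); move: e0; rewrite {1 2}eE ltcR => e0 /(_ e0); apply: filterS => x.
by rewrite E nE eE ltcR.
Qed.

End complex_convergence.

Lemma real_complex_nat (R : realType) (n : nat) : n%:R%:C = n%:R :> R[i].
Proof. exact: rmorph_nat. Qed.

Lemma real_complexX (R : realType) (a : R) (n : nat) : (a ^+ n)%:C = a%:C ^+ n :> R[i].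
Proof. exact: rmorphXn. Qed.

Lemma sum_symmetric (V : zmodType) (F : int -> V) n :
  \sum_(i < (2 * n).+1) F (i%:Z - n%:Z) =
  F 0 + \sum_(k < n) (F k.+1%:Z + F (- k.+1%:Z)).
Proof.
elim: n => [|n ih]; first by rewrite big_ord_recl !big_ord0 subrr.
rewrite (_ : (2 * n.+1).+1 = (2 * n).+3)%N; last by lia.
rewrite big_ord_recl big_ord_recr [in RHS]big_ord_recr/= !addrA -ih [LHS]addrC addrA addrC.
rewrite -!addrA; congr (_ + (_ + _)); last 2 first.
- by congr F; rewrite /bump/=; lia.
- by congr F; lia.
by apply: eq_bigr => i _; congr F; rewrite /bump/=; lia.
Qed.

Lemma abel_summation (V : comNzRingType) (w b : nat -> V) (a : V) n :
  \sum_(k < n) (w k - w k.+1) * (a + \sum_(l < k) b l) =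
  w 0 * a + \sum_(k < n) w k.+1 * b k - w n * (a + \sum_(k < n) b k).
Proof.
elim: n => [|n ih]; first by rewrite !big_ord0 !addr0 subrr.
by rewrite !big_ord_recr/= ih; ring.
Qed.

Lemma toeplitz (R : realType) (w : nat -> nat -> R) (u : nat -> R[i]) (s : R[i]) :
  (forall n k, 0 <= w n k) -> (forall n, \sum_(k < n.+1) w n k = 1) ->
  (forall k, w n k @[n --> \oo] --> 0) ->
  normc (u n - s) @[n --> \oo] --> 0 ->
  normc (\sum_(k < n.+1) (w n k)%:C * u k - s) @[n --> \oo] --> 0.
Proof.
move=> w0 w1 wk /cvgn0P us; apply/cvgn0P => e e0.
have e2 : 0 < e / 2 by rewrite divr_gt0.
have [N hN] := us _ e2.
have : \sum_(k < N) w n k * normc (u k - s) @[n --> \oo] --> 0.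
  have : \sum_(k < N) w n k * normc (u k - s) @[n --> \oo] -->
      \sum_(k < N) 0 * normc (u k - s).
    by apply: cvg_big => [|k _]; [exact: add_continuous|apply: cvgMl; exact: wk].
  by rewrite [X in _ --> X]big1// => k _; rewrite mul0r.
move=> /cvgn0P/(_ _ e2)[M hM]; exists M => n /hM.
rewrite !ger0_norm ?normc_ge0 ?sumr_ge0// => [|k _]; last by rewrite mulr_ge0 ?normc_ge0.
move=> h; have -> : \sum_(k < n.+1) (w n k)%:C * u k - s =
    \sum_(k < n.+1) (w n k)%:C * (u k - s).
  under [RHS]eq_bigr do rewrite mulrBr.
  by rewrite big_split/= sumrN -mulr_suml -real_complex_sum w1 mul1r.
apply: le_lt_trans (le_normc_sum _ _ _) _.
apply: (@le_lt_trans _ _ (\sum_(k < n.+1) (w n k * (e / 2) +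
    (if (k < N)%N then w n k * normc (u k - s) else 0)))).
  apply: ler_sum => k _; rewrite normcM normcR ger0_norm//.
  case: ltnP => kN; first by rewrite lerDr mulr_ge0// ltW.
  by rewrite addr0 ler_wpM2l//; have := hN _ kN; rewrite ger0_norm ?normc_ge0// => /ltW.
rewrite big_split/= -mulr_suml w1 mul1r [ltRHS]splitr ltrD2l.
apply: le_lt_trans h; rewrite -big_mkcond/=.
rewrite -(big_mkord (fun k => (k < N)%N) (fun k => w n k * normc (u k - s))).
rewrite -(big_mkord xpredT (fun k => w n k * normc (u k - s))).
(* Either of [N] and [n.+1] may be the larger, so both sums are widened to their maximum. *)
rewrite [leRHS](big_nat_widen _ _ (maxn N n.+1)) ?leq_maxl//.
rewrite [leLHS](big_nat_widen _ _ (maxn N n.+1)) ?leq_maxr//.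
rewrite big_mkcond [leRHS]big_mkcond/=; apply: ler_sum => k _.
have := w0 n k; have := normc_ge0 (u k - s).
by case: ifP => [/andP[-> _]//|_]; case: ifP => // _ ? ?; rewrite mulr_ge0.
Qed.

(** * The de la Vallee-Poussin kernel *)

Section vallee_poussin.
Context (R : realType).

(** The Fourier coefficient at frequency [k] of the kernel [vp n], normalized to be 1 at frequency
    0. *)
Definition vp_weight (n k : nat) : R := 'C(2 * n, n + k)%:R / 'C(2 * n, n)%:R.

Let mid_gt0 n : 0 < 'C(2 * n, n)%:R :> R.
Proof. by rewrite ltr0n bin_gt0; lia. Qed.

Lemma vp_weight_ge0 n k : 0 <= vp_weight n k.
Proof. by rewrite divr_ge0. Qed.

Lemma vp_weight0 n : vp_weight n 0 = 1.
Proof. by rewrite /vp_weight addn0 divff// gt_eqF. Qed.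

Lemma vp_weight_gt n : vp_weight n n.+1 = 0.
Proof. by rewrite /vp_weight bin_small ?mul0r//; lia. Qed.

Lemma vp_weightS n k : vp_weight n k.+1 <= vp_weight n k.
Proof.
rewrite ler_wpM2r ?invr_ge0// ler_nat.
have := mul_bin_left (2 * n) (n + k); rewrite -addnS => h.
rewrite -(leq_pmul2l (_ : 0 < n + k.+1)%N) ?addnS// -addnS h leq_mul2r; apply/orP; right; lia.
Qed.

Lemma vp_weight_le1 n k : vp_weight n k <= 1.
Proof. by elim: k => [|k]; [rewrite vp_weight0|exact: le_trans (vp_weightS n k)]. Qed.

(** For [k <= n] the ratio of consecutive weights is [(n - k) / (n + k + 1)], so their difference is
    [(2 k + 1) / (n + k + 1)] times a weight at most 1. *)
Lemma vp_weight_diff n k : vp_weight n k - vp_weight n k.+1 <= (2 * k%:R + 1) / n.+1%:R.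
Proof.
have [kn|nk] := leqP k n; last first.
  have w0 l : (n < l)%N -> vp_weight n l = 0.
    by move=> nl; rewrite /vp_weight bin_small ?mul0r//; lia.
  by rewrite !w0 ?subrr ?divr_ge0 ?addr_ge0 ?mulr_ge0//; lia.
have E : (n + k).+1%:R * vp_weight n k.+1 = (n - k)%:R * vp_weight n k.
  rewrite /vp_weight !mulrA -!natrM addnS mul_bin_left; congr (_%:R / _).
  by congr (_ * _)%N; lia.
rewrite natrB// -addn1 !natrD in E.
have p : 0 < n%:R + 1 :> R by rewrite ltr_wpDl.
rewrite -[n.+1]addn1 natrD ler_pdivlMr//.
have := vp_weight_ge0 n k; have := vp_weight_le1 n k; have := vp_weightS n k; have := ler0n R k.
nra.
Qed.

Lemma cvg_vp_weight_diff k : vp_weight n k - vp_weight n k.+1 @[n --> \oo] --> 0.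
Proof.
apply: (@squeeze_cvgr _ _ _ _ (fun=> 0) (fun n => (2 * k%:R + 1) * n.+1%:R^-1)).
- by near=> n; rewrite subr_ge0 vp_weightS vp_weight_diff.
- exact: cvg_cst.
- rewrite -[X in _ --> X](mulr0 (2 * k%:R + 1)); apply: cvgMr.
  exact: cvg_harmonic.
Unshelve. all: by end_near.
Qed.

(** The constant makes the integral over a period equal to 1, since the mean of
    [cos (h / 2) ^ (2 n)] is the central binomial coefficient over [4 ^ n]. *)
Definition vp (n : nat) (h : R) : R :=
  4 ^+ n / (2 * pi * 'C(2 * n, n)%:R) * cos (h / 2) ^+ (2 * n).

Lemma vp_ge0 n h : 0 <= vp n h.
Proof.
rewrite /vp exprM mulr_ge0//; last by rewrite exprn_ge0// sqr_ge0.
by rewrite divr_ge0 ?mulr_ge0 ?pi_ge0 ?exprn_ge0.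
Qed.

Lemma vpN n h : vp n (- h) = vp n h.
Proof. by rewrite /vp mulNr cosN. Qed.

Lemma vp_pi n : (0 < n)%N -> vp n pi = 0.
Proof. by move=> n0; rewrite /vp cos_pihalf expr0n muln_eq0/= -leqn0 leqNgt n0 mulr0. Qed.

Lemma vp_le n h h' : 0 <= h -> h <= h' -> h' <= pi -> vp n h' <= vp n h.
Proof.
move=> h0 hh h'pi; rewrite ler_wpM2l//.
  by rewrite divr_ge0 ?mulr_ge0 ?pi_ge0 ?exprn_ge0.
have c0 : 0 <= cos (h' / 2) by apply: cos_ge0_pihalf; apply/andP; split; lra.
have cc : cos (h' / 2) <= cos (h / 2).
  by rewrite leNgt ltr_cos ?in_itv/= -?leNgt; [lra|apply/andP; split; lra|apply/andP; split; lra].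
by rewrite lerXn2r ?nnegrE// (le_trans c0).
Qed.

Lemma vp_expi n h : (vp n h)%:C = \sum_(j < (2 * n).+1)
  ((2 * pi)^-1 * ('C(2 * n, j)%:R / 'C(2 * n, n)%:R))%:C * expi (h * (n%:Z - j%:Z)%:~R).
Proof.
have cosE : (cos (h / 2))%:C = 2^-1%:C * (expi (h / 2) + expi (- (h / 2))) :> R[i].
  by apply: complexP; rewrite /expi cosN sinN /=; field.
rewrite /vp real_complexM real_complexX cosE exprMn [(expi _ + _) ^+ _]exprDn !mulr_sumr.
apply: eq_bigr => j _; rewrite -!expiMn -expiD.
rewrite (_ : h / 2 * _ + _ = h * (n%:Z - j%:Z)%:~R); last first.
  rewrite natrB; last by rewrite -ltnS.
  by rewrite rmorphB/= natrM; field.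
rewrite -[expi _ *+ _]mulr_natl -real_complexX -real_complex_nat !mulrA -!real_complexM; congr (_%:C * _).
rewrite exprM -!mulrA [2^-1 ^+ 2](_ : _ = 4^-1); last by field.
rewrite exprVn; have := mid_gt0 n; have := pi_gt0 R.
move: ('C(2 * n, n)%:R) (pi : R) => c p p0 c0.
have f4 : (4 : R) ^+ n != 0 by rewrite expf_neq0.
by field; rewrite f4 !gt_eqF.
Qed.

(** The kernel has degree [n], so on more than [n] equally spaced nodes its Riemann sum is exactly
    its integral. *)
Lemma vp_mean n m : (n < 2 * m)%N ->
  \sum_(i < 2 * m) vp n (- pi + 2 * pi * i%:R / (2 * m)%:R) * (2 * pi / (2 * m)%:R) = 1.
Proof.
move=> nm; apply: (@complexI R); rewrite -mulr_suml real_complexM real_complex_sum.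
under eq_bigr do rewrite vp_expi.
have nn : (n < (2 * n).+1)%N by lia.
rewrite exchange_big/= (bigD1 (Ordinal nn))//= [X in _ + X]big1 ?addr0 => [|j jn].
  under eq_bigr do rewrite subrr mulr0 expi0 mulr1.
  rewrite -real_complex_sum -real_complexM sumr_const card_ord -[_ *+ (2 * m)]mulr_natr; congr (_%:C).
  have p0 : (2 * m)%:R != 0 :> R by rewrite pnatr_eq0; lia.
  rewrite divff ?mulr1 ?gt_eqF//; have := pi_gt0 R.
  by move: (2 * m)%:R p0 (pi : R) => M M0 p p0; field; rewrite M0 gt_eqF.
have jn' : (j : nat) <> n.
  by move=> E; move: jn => /eqP; apply; apply/val_inj.
rewrite -mulr_sumr.
under eq_bigr do rewrite mulrDl expiD.
by rewrite -mulr_sumr sum_expi_roots ?mulr0//; have := ltn_ord j; lia.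
Qed.

(** The central binomial coefficient is the largest of [2 n + 1] coefficients whose sum is
    [4 ^ n]. *)
Lemma vp_le_cos n h : vp n h <= (2 * n%:R + 1) / (2 * pi) * cos (h / 2) ^+ (2 * n).
Proof.
rewrite ler_wpM2r//; first by rewrite exprM exprn_ge0// sqr_ge0.
have h4 : 4 ^+ n <= (2 * n%:R + 1) * 'C(2 * n, n)%:R :> R.
  rewrite -natrX -natrM natr1 -natrM ler_nat.
  rewrite (_ : 4 ^ n = \sum_(i < (2 * n).+1) 'C(2 * n, i))%N; last first.
    have := expnDn 1 1 (2 * n); rewrite expnM => ->; apply: eq_bigr => i _.
    by rewrite !exp1n !muln1.
  rewrite -[X in (_ <= X * _)%N]card_ord -sum_nat_const; apply: leq_sum => i _.
  have mid k : ('C(2 * n, n + k) <= 'C(2 * n, n))%N.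
    by have := vp_weight_le1 n k; rewrite ler_pdivrMr// mul1r ler_nat.
  have [/subnKC <-//|ni] := leqP n i.
  have i2 : (i <= 2 * n)%N by rewrite -ltnS.
  by rewrite -bin_sub// (_ : 2 * n - i = n + (n - i))%N//; lia.
rewrite ler_pdivrMr ?mulr_gt0 ?pi_gt0// [leRHS](_ : _ = (2 * n%:R + 1) * 'C(2 * n, n)%:R)//.
by rewrite mulrA divfK// gt_eqF// mulr_gt0 ?pi_gt0.
Qed.

(** [1 - r ^ n] is [1 - r] times [n] powers of [r], each at least [r ^ n]. It bounds [n * r ^ n] for
    a fixed [r < 1]. *)
Lemma natr_geometric_le (r : R) n : 0 <= r -> r <= 1 -> n%:R * (1 - r) * r ^+ n <= 1 - r ^+ n.
Proof.
move=> r0 r1; elim: n => [|n ih]; first by rewrite expr0 !mul0r subrr.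
rewrite -natr1 exprS; have := exprn_ge0 n r0; have := exprn_ile1 n r0 r1.
move: (r ^+ n) ih => p ih p1 p0.
have : r * (n%:R * (1 - r) * p) <= r * (1 - p) by rewrite ler_wpM2l.
have : 0 <= (1 - r) * (1 - r * p).
  by rewrite mulr_ge0 ?subr_ge0//; apply: le_trans p1; rewrite ler_piMl.
lra.
Qed.

Lemma cvg_vp_ne0 h : 0 < h -> h <= pi -> vp n h @[n --> \oo] --> 0.
Proof.
move=> h0 hpi; set r := cos (h / 2).
have pi0 := pi_gt0 R.
have r0 : 0 <= r by apply: cos_ge0_pihalf; apply/andP; split; lra.
(* In the majorant [cos ^ (2 n)] is split as [r ^ n * r ^ n]: one factor absorbs [2 n + 1], giving
   the constant [c], and the other tends to 0. *)
have r1 : r < 1.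
  by rewrite -(cos0 R) ltr_cos ?in_itv/=; [lra|apply/andP; split; lra|apply/andP; split; lra].
pose c := (2 / (1 - r) + 1) / (2 * pi).
apply: (@squeeze_cvgr _ _ _ _ (fun=> 0) (fun n => c * r ^+ n)).
- near=> n; rewrite vp_ge0/=; apply: le_trans (vp_le_cos n h) _.
  rewrite mulrAC /c [leRHS]mulrAC ler_pM2r ?invr_gt0 ?mulr_gt0//.
  rewrite -/r mulnC exprM expr2 mulrA ler_wpM2r ?exprn_ge0//.
  have := natr_geometric_le n r0 (ltW r1).
  have := exprn_ge0 n r0; have := exprn_ile1 n r0 (ltW r1).
  have d0 : 0 < 1 - r by lra.
  move: (r ^+ n) => p p1 p0 hp; rewrite mulrDl mul1r lerD// -mulrA ler_wpM2l//.
  rewrite -[leRHS]mul1r ler_pdivlMr//; lra.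
- exact: cvg_cst.
- rewrite -[X in _ --> X](mulr0 c); apply: cvgMr; apply: cvg_expr.
  by rewrite ger0_norm.
Unshelve. all: by end_near.
Qed.

(** The coefficient at frequency [z] depends only on its modulus; grouping opposite frequencies
    allows Abel summation. *)
Lemma vp_partial_sums (a : int -> R[i]) n :
  \sum_(j < (2 * n).+1) ((2 * pi)^-1 * ('C(2 * n, j)%:R / 'C(2 * n, n)%:R))%:C *
    a (j%:Z - n%:Z) =
  \sum_(k < n.+1) (vp_weight n k - vp_weight n k.+1)%:C *
    (((2 * pi)^-1)%:C * \sum_(i < (2 * k).+1) a (i%:Z - k%:Z)).
Proof.
have symm (j : nat) : (j < (2 * n).+1)%N ->
    'C(2 * n, j)%:R / 'C(2 * n, n)%:R = vp_weight n `|j%:Z - n%:Z|%N.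
  move=> jn; rewrite /vp_weight; congr (_%:R / _); have [h|h] := leqP n j.
    by congr 'C(_, _); lia.
  by rewrite -bin_sub//; congr 'C(_, _); lia.
pose F (z : int) := (vp_weight n `|z|%N)%:C * a z.
transitivity (((2 * pi)^-1)%:C * \sum_(j < (2 * n).+1) F (j%:Z - n%:Z)).
  by rewrite mulr_sumr; apply: eq_bigr => j _; rewrite symm// real_complexM mulrA.
rewrite sum_symmetric; under [RHS]eq_bigr do rewrite mulrCA sum_symmetric real_complexB.
rewrite -mulr_sumr; congr (_ * _).
rewrite (abel_summation (fun k => (vp_weight n k)%:C) (fun k => a k.+1%:Z + a (- k.+1%:Z))).
rewrite vp_weight_gt mul0r subr0 big_ord_recr/= vp_weight_gt mul0r addr0; congr (_ + _).
by apply: eq_bigr => k _; rewrite /F abszN !absz_nat mulrDr.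
Qed.

End vallee_poussin.

(** * Summation by parts against the kernel *)

Section kernel_steps.
Context (R : realType).

(* Where the error [z] is at most [e |h|], a summation by parts turns the sum into
   [e] times the Riemann sum of [g]; elsewhere [g <= G] and the variation of
   [min g G] is at most [2 G]. *)
Lemma unimodal_step_sum (g h z : nat -> R) (m : nat) (D e K G : R) :
  0 <= e -> 0 <= K -> 0 <= G -> (forall i, 0 <= g i) ->
  (forall i, (i < m)%N -> g i <= g i.+1) ->
  (forall i, (m <= i < 2 * m)%N -> g i.+1 <= g i) ->
  g 0 = 0 -> g (2 * m)%N = 0 ->
  (forall i, (i <= m)%N -> h i <= 0) -> (forall i, (m <= i)%N -> 0 <= h i) ->
  (forall i, h i.+1 = h i + D) ->
  (forall i, (i < 2 * m)%N -> z i.+1 <= e * `|h i.+1| \/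
    [/\ z i.+1 <= K, g i <= G & g i.+1 <= G]) ->
  \sum_(i < 2 * m) z i.+1 * `|g i - g i.+1| <= e * (\sum_(i < 2 * m) g i * D) + K * (2 * G).
Proof.
move=> e0 K0 G0 g0 gup gdn g00 g0m hneg hpos hS hz.
(* The truncated kernel with its decreasing half reflected: [t] is nondecreasing with values in
   [[- G, G]], and where [g <= G] its increments dominate those of [g]. *)
pose t i := if (i < m)%N then Num.min (g i) G - G else G - Num.min (g i) G.
have minE i : Num.min (g i) G <= G /\ 0 <= Num.min (g i) G.
  by rewrite ge_min lexx orbT le_min g0 G0.
have tS i : (i < 2 * m)%N -> t i <= t i.+1.
  move=> im; rewrite /t; have [[? ?] [? ?]] := (minE i, minE i.+1).
  case: ltnP => h1; case: ltnP => h2; [|lra|lia|].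
    by rewrite lerD2r le_min2// gup.
  by rewrite lerD2l lerN2 le_min2// gdn// h1.
have tG i : (i < 2 * m)%N -> g i <= G -> g i.+1 <= G -> `|g i - g i.+1| <= t i.+1 - t i.
  move=> im gi gi1; rewrite /t !min_l//; case: ltnP => h1; case: ltnP => h2; [|lia| |].
  - by rewrite ler0_norm ?subr_le0 ?gup//; lra.
  - by rewrite ler_norml; apply/andP; split; lra.
  - by rewrite ger0_norm ?subr_ge0 ?gdn ?h2//; lra.
have hg i : (i < 2 * m)%N -> `|h i.+1| * `|g i - g i.+1| = h i.+1 * (g i - g i.+1).
  move=> im; have [h1|h1] := ltnP i m.
    by rewrite ler0_norm ?hneg// ler0_norm ?subr_le0 ?gup// mulrNN.
  by rewrite ger0_norm ?hpos ?leqW// ger0_norm// subr_ge0 gdn// h1.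
apply: (@le_trans _ _ (\sum_(i < 2 * m) (e * (h i.+1 * (g i - g i.+1)) + K * (t i.+1 - t i)))).
  apply: ler_sum => i _; have im := ltn_ord i.
  have tS0 : 0 <= t i.+1 - t i by rewrite subr_ge0 tS.
  rewrite -hg//; case: (hz i im) => [hi|[hi g1 g2]].
    rewrite mulrA; apply: (@le_trans _ _ (e * `|h i.+1| * `|g i - g i.+1|)).
      by rewrite ler_wpM2r.
    by rewrite lerDl mulr_ge0.
  apply: (@le_trans _ _ (K * (t i.+1 - t i))).
    by apply: (@le_trans _ _ (K * `|g i - g i.+1|)); [rewrite ler_wpM2r|rewrite ler_wpM2l ?tG].
  by rewrite lerDr !mulr_ge0.
rewrite big_split/= -!mulr_sumr; apply: lerD; apply: ler_wpM2l => //.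
  have -> : \sum_(i < 2 * m) h i.+1 * (g i - g i.+1) =
      \sum_(i < 2 * m) g i * D - \sum_(i < 2 * m) (h i.+1 * g i.+1 - h i * g i).
    by rewrite -sumrB; apply: eq_bigr => i _; rewrite hS; ring.
  rewrite -(big_mkord xpredT (fun i => h i.+1 * g i.+1 - h i * g i)) telescope_sumr//.
  by rewrite g0m g00 !mulr0 !subr0.
rewrite -(big_mkord xpredT (fun i => t i.+1 - t i)) telescope_sumr//.
rewrite /t; have [[? ?] [? ?]] := (minE (2 * m)%N, minE 0); by case: ltnP => ?; case: ltnP => ?; lra.
Qed.

(** By [vp_mean] the linear function [d * h i] contributes exactly [d], so only the deviation [z] is
    left. The kernel vanishes at both ends, hence no boundary term in the summation by parts. *)
Lemma vp_step_sum (n m : nat) (b : nat -> R[i]) (d : R[i]) (e K D : R) :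
  let h i := - pi + 2 * pi * i%:R / (2 * m)%:R in
  (0 < n)%N -> (n < m)%N -> 0 <= e -> 0 < D -> D <= pi -> 2 * pi / (2 * m)%:R <= D / 2 ->
  (forall i, (i <= 2 * m)%N -> normc (b i - d * (h i)%:C) <= K) ->
  (forall i, (i <= 2 * m)%N -> `|h i| <= D -> normc (b i - d * (h i)%:C) <= e * `|h i|) ->
  normc (\sum_(i < 2 * m) (vp n (h i))%:C * (b i.+1 - b i) - d) <= e + K * (2 * vp n (D / 2)).
Proof.
move=> h n0 nm e0 D0 Dpi mD bK be; have pi0 := pi_gt0 R.
have m0 : (2 * m)%:R != 0 :> R by rewrite pnatr_eq0; lia.
have h0 : h 0 = - pi by rewrite /h mulr0 mul0r addr0.
have hM : h (2 * m)%N = pi by rewrite /h mulfK//; ring.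
have hm : h m = 0.
  rewrite /h natrM; have : m%:R != 0 :> R by rewrite pnatr_eq0; lia.
  by move: (pi : R) => p m0'; field.
have hS i : h i.+1 = h i + 2 * pi / (2 * m)%:R by rewrite /h -natr1; ring.
have hle i j : (i <= j)%N -> h i <= h j.
  by move=> ij; rewrite lerD2l ler_wpM2r ?invr_ge0// ler_pM2l ?mulr_gt0// ler_nat.
pose z i := b i - d * (h i)%:C.
have K0 : 0 <= K by apply: le_trans (bK 0 _); rewrite ?normc_ge0.
pose g i := vp n (h i).
have gE : \sum_(i < 2 * m) g i * (2 * pi / (2 * m)%:R) = 1 by apply: vp_mean; lia.
have g00 : g 0 = 0 by rewrite /g h0 vpN vp_pi.
have g0M : g (2 * m)%N = 0 by rewrite /g hM vp_pi.
have -> : \sum_(i < 2 * m) (g i)%:C * (b i.+1 - b i) - d =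
    \sum_(i < 2 * m) z i.+1 * (g i - g i.+1)%:C.
  have -> : \sum_(i < 2 * m) z i.+1 * (g i - g i.+1)%:C =
      \sum_(i < 2 * m) (g i)%:C * (z i.+1 - z i) -
      \sum_(i < 2 * m) ((g i.+1)%:C * z i.+1 - (g i)%:C * z i).
    by rewrite -sumrB; apply: eq_bigr => i _; rewrite real_complexB; ring.
  rewrite -(big_mkord xpredT (fun i => (g i.+1)%:C * z i.+1 - (g i)%:C * z i)) telescope_sumr//.
  rewrite g0M g00 !mul0r !subr0 -[d in LHS]mulr1 (_ : 1 = 1%:C)// -[in LHS]gE real_complex_sum mulr_sumr -sumrB.
  by apply: eq_bigr => i _; rewrite /z hS rmorphD/= !real_complexM; ring.
apply: le_trans (le_normc_sum _ _ _) _.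
under eq_bigr do rewrite normcM normcR.
have -> : e = e * \sum_(i < 2 * m) g i * (2 * pi / (2 * m)%:R) by rewrite gE mulr1.
apply: (unimodal_step_sum (h := h) (z := fun i => normc (z i))) => //.
- exact: vp_ge0.
- by move=> i; exact: vp_ge0.
- move=> i im; rewrite /g -(vpN n (h i)) -(vpN n (h i.+1)).
  have := hle _ _ im; have := hle _ _ (leq0n i); have := hle _ _ (leqnSn i).
  by rewrite hm h0 => *; apply: vp_le; lra.
- move=> i /andP[mi im]; have := hle _ _ mi; have := hle _ _ im; have := hle _ _ (leqnSn i).
  by rewrite hm hM => *; apply: vp_le; lra.
- by move=> i /hle; rewrite hm.
- by move=> i /hle; rewrite hm.
(* The mesh is at most [D / 2]: if [h i.+1] is beyond [D], then [h i] is beyond [D / 2], and both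
   kernel values are at most [vp n (D / 2)]. *)
- move=> i im; have [hD|hD] := leP `|h i.+1| D; first by left; exact: be.
  right; split; first exact: bK.
    have := hle _ _ (leq0n i); have := hle _ _ (ltnW im); rewrite h0 hM => ? ?.
    have vE : g i = vp n `|h i| by rewrite /g; case: ger0P => _; rewrite ?vpN.
    rewrite vE; apply: vp_le; [lra| |by rewrite ler_norml; apply/andP; split; lra].
    have := ler_normD (h i) (2 * pi / (2 * m)%:R); rewrite -hS.
    have r0 : 0 <= 2 * pi / (2 * m)%:R :> R by rewrite divr_ge0// mulr_ge0// ltW.
    rewrite (ger0_norm r0); lra.
  have := hle _ _ (leq0n i.+1); have := hle _ _ im; rewrite h0 hM => ? ?.
  have vE : g i.+1 = vp n `|h i.+1| by rewrite /g; case: ger0P => _; rewrite ?vpN.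
  by rewrite vE; apply: vp_le; [lra|lra|rewrite ler_norml; apply/andP; split; lra].
Qed.

End kernel_steps.

Lemma exists_large_nat (R : realType) (n N : nat) (c : R) :
  exists m : nat, [/\ (n < m)%N, (N < 2 * m)%N & c <= m%:R].
Proof.
exists (maxn (maxn n.+1 N.+1) (Num.truncn c).+1); split; [lia|lia|].
by apply: le_trans (ltW (truncnS_gt c)) _; rewrite ler_nat leq_maxr.
Qed.

Section trigonometric_lipschitz.
Context (R : realType).

Lemma trig_lipschitz (s : seq (R[i] * int)) : exists C : R, 0 <= C /\
  forall u v : R, normc (trig s u - trig s v) <= C * `|u - v|.
Proof.
exists (\sum_(c <- s) normc c.1 * (2 * `|c.2%:~R|)); split.
  by apply: sumr_ge0 => c _; rewrite mulr_ge0 ?normc_ge0 ?mulr_ge0.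
move=> u v; rewrite /trig -sumrB mulr_suml; apply: le_trans (le_normc_sum _ _ _) _.
apply: ler_sum => c _; rewrite -mulrBr normcM -mulrA ler_wpM2l ?normc_ge0//.
exact: expi_int_lipschitz.
Qed.

Definition vp_seq (n : nat) (x : R) : seq (R[i] * int) :=
  [seq (((2 * pi)^-1 * ('C(2 * n, j)%:R / 'C(2 * n, n)%:R))%:C *
        expi (- (x * (n%:Z - j%:Z)%:~R)), n%:Z - j%:Z) | j : 'I_(2 * n).+1 <- index_enum _].

Lemma trig_vp_seq n x t : trig (vp_seq n x) t = (vp n (t - x))%:C.
Proof.
rewrite vp_expi /trig big_map; apply: eq_bigr => j _ /=.
by rewrite -mulrA -expiD; congr (_ * expi _); ring.
Qed.

End trigonometric_lipschitz.

Lemma sum_symmetric_dist (R : realType) (F : int -> R[i]) (N M : nat) : (N <= M)%N ->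
  normc (\sum_(i < (2 * M).+1) F (i%:Z - M%:Z) - \sum_(i < (2 * N).+1) F (i%:Z - N%:Z)) <=
  \sum_(i < (2 * M).+1) normc (F (i%:Z - M%:Z)) - \sum_(i < (2 * N).+1) normc (F (i%:Z - N%:Z)).
Proof.
move=> NM; rewrite !sum_symmetric (sum_symmetric (fun z => normc (F z))).
rewrite (sum_symmetric (fun z => normc (F z))) -(subnKC NM) [normc]lock !big_split_ord/= -lock.
rewrite !opprD !addrA.
rewrite (_ : _ - _ = \sum_(i < M - N) (F (N + i).+1%:Z + F (- (N + i).+1%:Z))); last by ring.
rewrite [leRHS](_ : _ = \sum_(i < M - N) (normc (F (N + i).+1%:Z) + normc (F (- (N + i).+1%:Z)))); last by ring.
by apply: le_trans (le_normc_sum _ _ _) _; apply: ler_sum => i _; exact: le_normcD.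
Qed.

(** * Lebesgue measure on the circle *)

Section circle_measure.
Context (R : realType).
Local Notation S := (@spectral_interval R).
Let pi0 := pi_gt0 R.

Definition circle_measure : set (measurableTypeR R) -> \bar R :=
  mrestr (@lebesgue_measure R) (@measurable_spectral_interval R).
HB.instance Definition _ := Measure.on circle_measure.
Local Notation leb := circle_measure.

Lemma circle_measureT : leb setT = (2 * pi)%:E.
Proof.
rewrite /leb /mrestr setTI /spectral_interval lebesgue_measure_itv/=.
by rewrite lte_fin mulr_gt0// sube0.
Qed.

Lemma circle_measure_fin : (leb setT < +oo)%E.
Proof. by rewrite circle_measureT ltry. Qed.

Lemma circle_measure_supp : leb (~` S) = 0%E.
Proof. by rewrite /leb /mrestr setICl measure0. Qed.

(** The arc is []a, b]], except that for [b = 2 pi] its last point is 0. It is squeezed between []a,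
    b[] and [[a, b]] with the point 0 added. *)
Lemma circle_measure_arc a b : 0 <= a -> a <= b -> b <= 2 * pi ->
  leb (arc a b) = (b - a)%:E.
Proof.
move=> a0 ab b2; have [mA AS] := spectral_set_arc a b.
rewrite /leb /mrestr (_ : _ `&` _ = arc a b); last exact/setIidPl.
have lo : [set` `]a, b[] `<=` arc a b.
  move=> t /=; rewrite in_itv/= => /andP[ta tb]; split.
    rewrite /spectral_interval/= in_itv/=; apply/andP; split; lra.
  by exists 0; rewrite mulr0 addr0 ta ltW.
have up : arc a b `<=` [set 0] `|` [set` `[a, b]].
  move=> t [St [m tm]]; move: St; rewrite /spectral_interval/= in_itv/= => /andP[t0 t2].
  have [m0|[m0|[m0|m0]]] : (m <= -1)%R \/ m = 0 \/ m = 1 \/ (2 <= m)%R by lia.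
  - have : m%:~R <= -1 :> R by rewrite -[-1 : R]/((-1)%:~R) ler_int.
    move: tm => /andP[h _]; nra.
  - by right; rewrite m0 mulr0 addr0 in tm; rewrite /= in_itv/=; lra.
  - by left => /=; rewrite m0 in tm; lra.
  - have : 2 <= m%:~R :> R by rewrite -[2 : R]/(2%:~R) ler_int.
    move: tm => /andP[_ h]; nra.
have itvE (c e : bool) : lebesgue_measure [set` Interval (BSide c a) (BSide e b)] = (b - a)%:E.
  rewrite lebesgue_measure_itv/= lte_fin; case: ltP => [//|ba].
  by have -> : b = a; [apply/eqP; rewrite eq_le ba|rewrite subrr].
apply/eqP; rewrite eq_le; apply/andP; split; last first.
  rewrite -(itvE false true); apply: le_measure; rewrite ?inE//.
apply: (@le_trans _ _ (lebesgue_measure ([set (0 : R)] `|` [set` `[a, b]]))).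
  by apply: le_measure; rewrite ?inE//; exact: measurableU.
apply: (@le_trans _ _ (lebesgue_measure [set (0 : R)%R] + lebesgue_measure [set` `[a, b]])%E).
  exact: measureU2.
by rewrite lebesgue_measure_set1 add0e itvE.
Qed.

(** A density involves the arcs on both sides of [x]. At [x = 0] the arc before [x] wraps around and
    is read near [2 pi]. *)
Lemma circle_measure_small_arc x : S x -> exists2 r : R, 0 < r & forall h, 0 < h -> h <= r ->
  leb (arc x (x + h)) = h%:E /\ leb (arc (x - h) x) = h%:E.
Proof.
rewrite /spectral_interval/= in_itv/= => /andP[x0 x2].
have [xE|xn0] := eqVneq x 0.
  exists (2 * pi) => [|h h0 h2]; first exact: mulr_gt0.
  split; first by rewrite circle_measure_arc; [congr EFin; ring|lra|lra|lra].
  have -> : arc (x - h) x = arc (2 * pi - h) (2 * pi).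
    rewrite xE; apply/seteqP; split => t [St [m tm]]; split => //.
      by exists (m + 1); rewrite (_ : 2 * pi * (m + 1)%:~R = 2 * pi * m%:~R + 2 * pi); [lra|rewrite intrD [LHS]mulrDr mulr1].
    by exists (m - 1); rewrite (_ : 2 * pi * (m - 1)%:~R = 2 * pi * m%:~R - 2 * pi); [lra|rewrite intrB [LHS]mulrBr mulr1].
  by rewrite circle_measure_arc; [congr EFin; ring|lra|lra|lra].
have {}x0 : 0 < x by rewrite lt_def xn0.
exists (Num.min x (2 * pi - x)) => [|h h0]; first by rewrite lt_min x0 subr_gt0.
rewrite le_min => /andP[h1 h2].
by split; rewrite circle_measure_arc; [congr EFin; ring|lra|lra|lra|congr EFin; ring|lra|lra|lra].
Qed.

Lemma L2_circle_indic (A : set (measurableTypeR R)) : measurable A ->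
  L2 leb (cindic A).
Proof. exact: L2_indic circle_measure_fin. Qed.

Lemma ip_circle_indic (A B : set (measurableTypeR R)) : measurable A -> measurable B ->
  ip leb (cindic A) (cindic B) =
  (fine (leb (A `&` B)))%:C.
Proof. exact: ip_indic. Qed.

(** The step approximation on [n] equal arcs has integral exactly 0, being a sum over roots of
    unity, and it converges uniformly to the exponential. *)
Lemma ip_circle_expi0 (z : int) : z != 0 ->
  ip leb (expk z) (fun=> 1) = 0.
Proof.
move=> z0; pose f x : R[i] := expi (x * z%:~R).
have fE : f = trig [:: (1, z)] by apply/funext => x; rewrite /trig big_seq1 mul1r.
have Lf : L2 leb f by exact: L2_expi circle_measure_fin z.
have L1 : L2 leb (fun=> 1).
  apply: (L2_bounded circle_measure_fin (C := 1)); first exact: cmeas_cst.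
  by move=> x; rewrite normc1.
apply: normc_le_eps => e e0.
pose K := Num.sqrt (fine (leb S)) * nrm leb (fun=> 1).
have K0 : 0 <= K by rewrite mulr_ge0 ?sqrtr_ge0 ?nrm_ge0.
have eK : 0 < e / (K + 1) by rewrite divr_gt0// ltr_wpDl.
have [C [C0 fC]] := trig_lipschitz [:: (1 : R[i], z)]; rewrite -fE in fC.
have [N hN] := arc_step_approx 0 C0 eK fC (fun u m => expi_periodic z m u).
pose n := (maxn N `|z|%N).+1; have Nn : (N < n)%N by rewrite ltnS leq_maxl.
have zn : (0 < `|z| < n)%N by rewrite absz_gt0 z0 ltnS leq_maxr.
have n0 : (0 < n)%N by [].
pose st := arc_step f 0 n.
have Lst : L2 leb (step_value st).
  apply: L2_sum => i; apply: L2Z; apply: L2_circle_indic; by case: (step_setP i).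
have ip0 : ip leb (step_value st) (fun=> 1) = 0.
  rewrite ip_suml//; last by move=> i; apply: L2Z; apply: L2_circle_indic; case: (step_setP i).
  have hT : (fun=> 1) = (fun x : measurableTypeR R => (\1_(setT : set R) x)%:C) :> (measurableTypeR R -> R[i]).
    by rewrite indicT.
  rewrite hT (eq_bigr (fun i : 'I_n => expi (2 * pi * i%:R / n%:R * z%:~R) * (2 * pi / n%:R)%:C)).
    by rewrite -mulr_suml sum_expi_roots// mul0r.
  move=> i _; have mA := (spectral_set_arc (arc_node 0 n i) (arc_node 0 n i.+1)).1.
  rewrite ipZl; [|exact: L2_circle_indic|by rewrite -hT].
  rewrite ip_circle_indic// setIT circle_measure_arc.
  - by rewrite /= arc_nodeS [_ + _ / _]addrC addrK /f /arc_node add0r.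
  - by rewrite -{1}(arc_node0 0 n) arc_node_le.
  - exact: arc_node_le.
  - by rewrite -(add0r (2 * pi)) -(arc_noden 0 n0) arc_node_le.
have -> : ip leb f (fun=> 1) =
    ip leb (fun x => f x - step_value st x) (fun=> 1) by rewrite ipBl// ip0 subr0.
apply: le_trans (cauchy_schwarz (L2B Lf Lst) L1) _.
apply: (@le_trans _ _ (e / (K + 1) * K)); last first.
  exact: divD1_mul_le (ltW e0) K0.
rewrite mulrA ler_wpM2r ?nrm_ge0//; apply: (nrm_spectral_bound circle_measure_fin circle_measure_supp).
- exact: L2B.
- exact: ltW.
- by move=> t St; exact: hN.
Qed.

Lemma ip_circle_expi (k l : int) :
  ip leb (expk k) (expk l) =
  (2 * pi * (k == l)%:R)%:C.
Proof.
have -> : ip leb (expk k) (expk l) =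
    ip leb (fun x => expi (x * (k - l)%:~R)) (fun=> 1).
  have h x : expi (x * k%:~R) * conjc (expi (x * l%:~R)) = expi (x * (k - l)%:~R) * conjc 1 :> R[i].
    by rewrite -expiN -expiD conjc1 mulr1; congr expi; ring.
  by rewrite /ip; under eq_Rintegral do rewrite h; congr (_ +i* _); under eq_Rintegral do rewrite h.
have [->|kl] := eqVneq k l; last by rewrite ip_circle_expi0 ?subr_eq0// mulr0.
rewrite subrr mulr1.
have hT c : (fun x : measurableTypeR R => expi (x * c%:~R)) = (fun=> 1) ->
  ip leb (fun x : measurableTypeR R => expi (x * c%:~R)) (fun=> 1) = (2 * pi)%:C.
  move=> ->; have -> : (fun=> 1) = (fun x : measurableTypeR R => (\1_(setT : set R) x)%:C) :> (measurableTypeR R -> R[i]).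
    by rewrite indicT.
  by rewrite ip_circle_indic// setIT circle_measureT.
by apply: hT; apply/funext => x; rewrite mulr0 expi0.
Qed.

Lemma ip_circle_trig u s : ip leb (trig u) (trig s) =
  \sum_(e <- s) conjc e.1 * \sum_(c <- u) c.1 * (2 * pi * (c.2 == e.2)%:R)%:C.
Proof.
have L1 (c : R[i] * int) := L2_expi circle_measure_fin c.2.
rewrite ip_sumr; [|exact: L2_trig circle_measure_fin _|by move=> e; exact: L2Z].
apply: eq_bigr => e _; rewrite ipZr//; last exact: L2_trig circle_measure_fin _.
congr (_ * _); rewrite ip_suml//; last by move=> c; exact: L2Z.
by apply: eq_bigr => c _; rewrite ipZl// ip_circle_expi.
Qed.

(** Once [X] is cut off to [A], both factors of Cauchy-Schwarz carry the square root of the length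
    of [A]. *)
Lemma ip_circle_indic_bound (X : measurableTypeR R -> R[i]) (A : set (measurableTypeR R)) (C : R) :
  measurable A -> L2 leb X -> 0 <= C -> (forall t, A t -> normc (X t) <= C) ->
  normc (ip leb X (cindic A)) <= C * fine (leb A).
Proof.
move=> mA LX C0 XC; have LA := L2_circle_indic mA.
pose Y x := X x * (\1_A x)%:C.
have YC x : normc (Y x) <= normc (C%:C * (\1_A x)%:C).
  rewrite /Y !normcM !normcR indicE; case: (boolP (x \in A)) => xA; last by rewrite normr0 !mulr0.
  by rewrite normr1 !mulr1 ger0_norm// XC// -in_setE.
have [LY nY] := nrm_le (cmeasM (L2_cmeas LX) (L2_cmeas LA)) (L2Z C%:C LA) YC.
have -> : ip leb X (cindic A) = ip leb Y (cindic A).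
  have h x : X x * conjc (\1_A x)%:C = Y x * conjc (\1_A x)%:C.
    by rewrite /Y conjc_real -mulrA -real_complexM indicE; case: (_ \in _); rewrite ?mulr1 ?mulr0.
  by rewrite /ip; under eq_Rintegral do rewrite h; congr (_ +i* _); under eq_Rintegral do rewrite h.
apply: le_trans (cauchy_schwarz LY LA) _.
apply: (@le_trans _ _ (C * nrm leb (cindic A) * nrm leb (cindic A))).
  by rewrite ler_wpM2r ?nrm_ge0//; rewrite nrmZ// normcR ger0_norm in nY.
rewrite -mulrA -expr2; have := ip_circle_indic mA mA.
by rewrite ip_nrm setIid => -[->].
Qed.

End circle_measure.

(** * Symmetric partial sums of summable families *)

Section summable_sequences.
Context (R : realType).

Lemma cvg_complex_bounded_variation (u : nat -> R[i]) (B : R) :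
  (forall k, \sum_(0 <= i < k) normc (u i.+1 - u i) <= B) ->
  exists l, normc (u n - l) @[n --> \oo] --> 0.
Proof.
move=> uB; have cre : cvgn (fun n => Re (u n)).
  apply: (@cvg_bounded_variation _ _ B) => k; apply: le_trans (uB k); apply: ler_sum => i _.
  by rewrite -ReN -ReD; exact: Re_le_normc.
have cim : cvgn (fun n => Im (u n)).
  apply: (@cvg_bounded_variation _ _ B) => k; apply: le_trans (uB k); apply: ler_sum => i _.
  by rewrite -ImN -ImD; exact: Im_le_normc.
pose a := limn (fun n => Re (u n)); pose b := limn (fun n => Im (u n)); exists (a +i* b).
apply: (@squeeze_cvgr _ _ _ _ (fun=> 0) (fun n => `|Re (u n) - a| + `|Im (u n) - b|)).
- near=> n; rewrite normc_ge0/=; apply: le_trans (normc_le_ReIm _) _.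
  by rewrite !(ReD, ImD, ReN, ImN).
- exact: cvg_cst.
- rewrite -[X in _ --> X](addr0 (0 : R)); apply: cvgD.
    have h : Re (u n) - a @[n --> \oo] --> a - a by apply: cvgB => //; exact: cvg_cst.
    by move: h; rewrite subrr => /cvg_norm; rewrite normr0; exact.
  have h : Im (u n) - b @[n --> \oo] --> b - b by apply: cvgB => //; exact: cvg_cst.
  by move: h; rewrite subrr => /cvg_norm; rewrite normr0; exact.
Unshelve. all: by end_near.
Qed.

Definition symmetric_sum (F : int -> R) N := \sum_(i < (2 * N).+1) F (i%:Z - N%:Z).

Lemma symmetric_sum_le (F : int -> R) N M : (forall z, 0 <= F z) -> (N <= M)%N ->
  symmetric_sum F N <= symmetric_sum F M.
Proof.
move=> F0 NM; have := sum_symmetric_dist (fun z => (F z)%:C) NM.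
under [X in _ <= X - _ -> _]eq_bigr do rewrite normcR ger0_norm//.
under [X in _ <= _ - X -> _]eq_bigr do rewrite normcR ger0_norm//.
by move=> h; rewrite -subr_ge0; apply: le_trans h; exact: normc_ge0.
Qed.

Lemma summable_symmetric_sum (F : int -> R) : (forall z, 0 <= F z) ->
  summable [set: int] (fun z => (F z)%:E) -> exists B : R, forall N, symmetric_sum F N <= B.
Proof.
move=> F0 sF; pose E := (\esum_(z in [set: int]) `|(F z)%:E|)%E; exists (fine E) => N.
have E0 : (0 <= E)%E by apply: esum_ge0 => z _; exact: abse_ge0.
have fE : E \is a fin_num by rewrite ge0_fin_numE.
rewrite -lee_fin fineK//; pose r := [seq (i%:Z - N%:Z)%R | i : 'I_(2 * N).+1 <- index_enum _].
apply: esum_ge; exists [set` r]; first by split => //; exact: finite_seq.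
rewrite -fsbig_seq/=; last first.
  rewrite map_inj_uniq ?index_enum_uniq// => i j /= h; apply/val_inj => /=; lia.
rewrite big_map sumEFin lee_fin; apply: ler_sum => i _.
by rewrite ger0_norm.
Qed.

End summable_sequences.

(** * Cross-spectral measures and their densities *)

Section cross_spectrum.
Context d (T : measurableType d) (R : realType) (P : probability T R).
Local Notation S := (@spectral_interval R).
Variables (xi1 xi2 : int -> T -> R[i]) (gamma : int -> R[i]).
Variables (phi1 phi2 : set R -> T -> R[i]).
Hypotheses (rsm1 : random_spectral_measure P phi1) (rsm2 : random_spectral_measure P phi2).
Let m1 := ctrl rsm1.
Let m2 := ctrl rsm2.
Hypothesis xi1_phi1 : forall k,
  graph_closure m1 P (step_graph phi1) (expk k) (xi1 k).
Hypothesis xi2_phi2 : forall k,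
  graph_closure m2 P (step_graph phi2) (expk k) (xi2 k).
Hypothesis ip_xi : forall k l, ip P (xi1 k) (xi2 l) = gamma (k - l).

Let L2_xi1 k : L2 P (xi1 k). Proof. by case: (xi1_phi1 k). Qed.
Let L2_xi2 k : L2 P (xi2 k). Proof. by case: (xi2_phi2 k). Qed.

Lemma trig_apply_graph (xi : int -> T -> R[i]) (phi : set R -> T -> R[i])
    (rsm : random_spectral_measure P phi) (s : seq (R[i] * int)) :
  (forall k, graph_closure (ctrl rsm) P (step_graph phi) (expk k) (xi k)) ->
  graph_closure (ctrl rsm) P (step_graph phi) (trig s) (trig_apply xi s).
Proof.
move=> h; exact: (isometric_sum (isometric_closure (isometric_step rsm)) s fst (fun c => h c.2)).
Qed.

Lemma indic_graph (phi : set R -> T -> R[i]) (rsm : random_spectral_measure P phi) A :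
  spectral_set A -> graph_closure (ctrl rsm) P (step_graph phi) (cindic A) (phi A).
Proof.
move=> sA; apply: (graph_closure_sub (isometric_step rsm)).
exists (@StepFunction R 1 (fun=> 1) (fun=> A) (fun=> sA)).
by split; apply/funext => x; rewrite /step_value /step_integral big_ord_recl big_ord0 addr0 mul1r.
Qed.

Lemma ip_trig_apply s t : ip P (trig_apply xi1 s) (trig_apply xi2 t) =
  ip P (xi1 0) (trig_apply xi2 (trig_mul (trig_conj s) t)).
Proof.
have L1 u : L2 P (trig_apply xi1 u) by apply: L2_sum => c; exact: L2Z.
have L2' u : L2 P (trig_apply xi2 u) by apply: L2_sum => c; exact: L2Z.
rewrite ip_suml//; last by move=> c; exact: L2Z.
rewrite [RHS]ip_sumr//; last by move=> c; exact: L2Z.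
rewrite big_allpairs_dep/= big_map; apply: eq_bigr => c _.
rewrite ip_sumr; [|exact: L2Z|by move=> e; exact: L2Z].
apply: eq_bigr => e _; rewrite ipZl//; last exact: L2Z.
by rewrite !ipZr//= !ip_xi conjcM conjcK mulrA; congr (_ * gamma _); ring.
Qed.

(* Approximating the indicators of [A] and [B] by trigonometric polynomials [h] and [g],
   stationarity moves [h] to the second factor, where [conjc h * g] is small. *)
Lemma cross_orthogonal A B : spectral_set A -> spectral_set B -> A `&` B = set0 ->
  ip P (phi1 A) (phi2 B) = 0.
Proof.
move=> sA sB AB.
have [iso1 iso2] := (isometric_closure (isometric_step rsm1), isometric_closure (isometric_step rsm2)).
have [[_ n1 _] [_ n2 _]] := (iso1, iso2).
have tf1 s := trig_apply_graph s xi1_phi1; have tf2 s := trig_apply_graph s xi2_phi2.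
have iA := indic_graph rsm1 sA; have iB := indic_graph rsm2 sB.
have [LA LphiA _] := n1 _ _ iA; have [LB LphiB _] := n2 _ _ iB.
pose C := nrm P (phi2 B) + Num.sqrt (fine (m1 S)) + 2 * nrm P (xi2 0) + 2 * nrm P (xi1 0).
apply: normc_le_eps => e' e'0.
have C0 : 0 <= C by rewrite !addr_ge0 ?mulr_ge0 ?nrm_ge0 ?sqrtr_ge0.
have C1 : 0 < C + 1 by rewrite ltr_wpDl.
pose e := e' / (C + 1); have e0 : 0 < e by rewrite divr_gt0.
(* The first control measure serves to replace [phi1 A], the second to make [h] small on [B]. *)
have [h [h1 h2]] := trig_approx2 (ctrl_fin rsm1) (ctrl_supp rsm1) (ctrl_fin rsm2)
  (ctrl_supp rsm2) sA.1 e0.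
pose Ch := \sum_(c <- h) normc c.1.
have Ch0 : 0 <= Ch by apply: sumr_ge0 => c _; exact: normc_ge0.
have Ch1 : 0 < Ch + 1 by rewrite ltr_wpDl.
(* [g] is chosen after [h], its tolerance being divided by a bound for [h], by which its error gets
   multiplied. *)
have [_ /(_ _ (divr_gt0 e0 Ch1))[g hg]] :=
  trig_limit_indic (ctrl_fin rsm2) (ctrl_supp rsm2) sB.1.
have hgC : Ch * nrm m2 (fun x => trig g x - (\1_B x)%:C) <= e.
  apply: (@le_trans _ _ (Ch * (e / (Ch + 1)))); first by rewrite ler_wpM2l// ltW.
  by rewrite mulrC divD1_mul_le// ltW.
have [Lth LXh nh] := n1 _ _ (tf1 h); have [Ltg LYg _] := n2 _ _ (tf2 g).
have E1 : nrm P (fun w => phi1 A w - trig_apply xi1 h w) < e.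
  rewrite nrmB; have [_ _ <-] := n1 _ _ (isometricB iso1 (tf1 h) iA); exact: h1.
have E2 : nrm P (fun w => phi2 B w - trig_apply xi2 g w) =
    nrm m2 (fun x => trig g x - (\1_B x)%:C).
  by rewrite nrmB; have [_ _ <-] := n2 _ _ (isometricB iso2 (tf2 g) iB).
have E3 : nrm P (trig_apply xi1 h) <= Ch * Num.sqrt (fine (m1 S)).
  rewrite -nh; apply: (nrm_spectral_bound (ctrl_fin rsm1) (ctrl_supp rsm1)) => // x _.
  exact: trig_bound.
(* On [B] the indicator of [A] vanishes, so [h] is there the error [h - 1_A]; the other part is [h]
   times the error of [g]. *)
have E4 : nrm P (trig_apply xi2 (trig_mul (trig_conj h) g)) <= 2 * e.
  have [_ _ <-] := n2 _ _ (tf2 (trig_mul (trig_conj h) g)).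
  have mh := cmeasJ (cmeas_trig h).
  have -> : trig (trig_mul (trig_conj h) g) =
     (fun x => conjc (trig h x) * (trig g x - (\1_B x)%:C) + conjc (trig h x) * (\1_B x)%:C).
    by apply/funext => x; rewrite trig_mulE trig_conjE; ring.
  have bh x : normc (conjc (trig h x)) <= Ch by rewrite normcJ; exact: trig_bound.
  have LgB := L2B Ltg LB.
  have [|LhB nhB] := nrm_le (cmeasM mh (L2_cmeas LB))
      (L2B (L2_trig (ctrl_fin rsm2) h) (L2_ctrl_indic rsm2 sA)) _.
    move=> x; rewrite normcM normcJ normcR indicE; case: (boolP (x \in B)) => xB.
      rewrite (_ : \1_A x = 0 :> R) ?subr0 ?normr1 ?mulr1//.
      rewrite indicE memNset// => Ax; rewrite inE in xB.
      by have : (A `&` B) x by []; rewrite AB.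
    by rewrite normr0 mulr0 normc_ge0.
  have [|Lm _] := nrm_le (cmeasM mh (L2_cmeas LgB)) (L2Z Ch%:C LgB) _.
    by move=> x; rewrite !normcM normcR ger0_norm// ler_wpM2r ?normc_ge0.
  apply: le_trans (nrmD_le Lm LhB) _; rewrite mulrDl mul1r lerD//.
    exact: le_trans (nrmM_le mh LgB bh) hgC.
  exact: le_trans nhB (ltW h2).
have -> : ip P (phi1 A) (phi2 B) = ip P (fun w => phi1 A w - trig_apply xi1 h w) (phi2 B) +
   (ip P (trig_apply xi1 h) (fun w => phi2 B w - trig_apply xi2 g w) +
    ip P (xi1 0) (trig_apply xi2 (trig_mul (trig_conj h) g))).
  by rewrite -ip_trig_apply ipBl// ipBr//; ring.
have [_ LM _] := n2 _ _ (tf2 (trig_mul (trig_conj h) g)).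
have F1 : normc (ip P (fun w => phi1 A w - trig_apply xi1 h w) (phi2 B)) <= e * nrm P (phi2 B).
  apply: le_trans (cauchy_schwarz (L2B LphiA LXh) LphiB) _.
  by rewrite ler_wpM2r ?nrm_ge0// ltW.
have F2 : normc (ip P (trig_apply xi1 h) (fun w => phi2 B w - trig_apply xi2 g w)) <=
    e * Num.sqrt (fine (m1 S)).
  apply: le_trans (cauchy_schwarz LXh (L2B LphiB LYg)) _; rewrite E2.
  apply: (@le_trans _ _ (Ch * Num.sqrt (fine (m1 S)) * nrm m2 (fun x => trig g x - (\1_B x)%:C))).
    by rewrite ler_wpM2r ?nrm_ge0.
  by rewrite mulrAC ler_wpM2r ?sqrtr_ge0.
have F3 : normc (ip P (xi1 0) (trig_apply xi2 (trig_mul (trig_conj h) g))) <= nrm P (xi1 0) * (2 * e).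
  by apply: le_trans (cauchy_schwarz (L2_xi1 0) LM) _; rewrite ler_wpM2l ?nrm_ge0.
apply: le_trans (le_normcD _ _) _.
have := le_normcD (ip P (trig_apply xi1 h) (fun w => phi2 B w - trig_apply xi2 g w))
  (ip P (xi1 0) (trig_apply xi2 (trig_mul (trig_conj h) g))).
have Ee : e' = e * C + e by rewrite /e -[X in _ + X]mulr1 -mulrDr divfK ?gt_eqF.
have : e * nrm P (phi2 B) + (e * Num.sqrt (fine (m1 S)) + nrm P (xi1 0) * (2 * e)) <= e'.
  rewrite Ee /C; have : 0 <= e * nrm P (xi2 0) by rewrite mulr_ge0 ?nrm_ge0// ltW.
  lra.
lra.
Qed.

Variable D : set R -> R[i].
Hypothesis DE : forall A, spectral_set A -> D A = ip P (phi1 A) (phi2 A).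

(** [xi1 0] is the integral of 1, that is [phi1] of the whole circle, and its part outside [A] is
    orthogonal to [phi2 A]. *)
Lemma cross_measureE A : spectral_set A -> D A = ip P (xi1 0) (phi2 A).
Proof.
move=> sA; rewrite DE//; have [_ sD hA] := rsm_split rsm1 (@spectral_setT R) sA.1.
have [iso1 [_ n1 _]] := (isometric_closure (isometric_step rsm1), isometric_closure (isometric_step rsm1)).
have iS := indic_graph rsm1 (@spectral_setT R).
have SA : S `&` A = A by apply/setIidPr; case: sA.
rewrite SA in hA.
have [LS LphiS _] := n1 _ _ iS.
have LA := rsm_L2 rsm1 sA; have LD := rsm_L2 rsm1 sD; have LA2 := rsm_L2 rsm2 sA.
have h0 : nrm P (fun w => xi1 0 w - phi1 S w) = 0.
  have [Le _ _] := n1 _ _ (xi1_phi1 0).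
  have [_ _ <-] := n1 _ _ (isometricB iso1 (xi1_phi1 0) iS).
  apply: nrm_ae0 => //; apply: (ae_null_setC (@measurable_spectral_interval R) (ctrl_supp rsm1)).
  by move=> x Sx; rewrite mulr0 expi0 indicE mem_set.
rewrite (ipJ LA2 (L2_xi1 0)) (ip_nrm0r (L2_xi1 0) LphiS LA2 h0).
rewrite (ip_nrm0r LphiS (L2D LA LD) LA2 hA) ipDr// conjcD -!ipJ//.
rewrite (cross_orthogonal sD sA) ?addr0//.
by apply/seteqP; split => // x [[_ ?]].
Qed.

Lemma cross_complex_measure : complex_measure D.
Proof.
split.
- move=> F sF tF; have sU := spectral_set_bigcup sF.
  apply/cvg_complexP/cvgn0P => e e0; pose C := nrm P (xi1 0) + 1.
  have C0 : 0 < C by rewrite ltr_wpDl ?nrm_ge0.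
  have /cvgn0P/(_ _ (divr_gt0 e0 C0))[N hN] := rsm_sigma rsm2 sF tF.
  exists N => n /hN; rewrite !ger0_norm ?nrm_ge0 ?normc_ge0// ltr_pdivlMr// => h.
  have LF i : L2 P (phi2 (F i)) by exact: rsm_L2.
  have Ls : L2 P (fun w => \sum_(i < n) phi2 (F i) w) by exact: L2_sum.
  have -> : \sum_(i < n) D (F i) - D (\bigcup_n F n) =
      ip P (xi1 0) (fun w => \sum_(i < n) phi2 (F i) w - phi2 (\bigcup_n F n) w).
    rewrite ipBr//; last exact: rsm_L2.
    rewrite ip_sumr// cross_measureE//; congr (_ - _).
    by apply: eq_bigr => i _; rewrite cross_measureE.
  apply: le_lt_trans (cauchy_schwarz (L2_xi1 0) (L2B Ls (rsm_L2 rsm2 sU))) _.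
  apply: le_lt_trans h; rewrite mulrC ler_wpM2l ?nrm_ge0//.
  by rewrite /C lerDl.
(* The modulus of [D (A i)] is at most a product of two norms, hence at most the sum of their
   squares, which are values of additive measures. *)
- exists (fine (m1 setT) + fine (m2 setT)) => n A sA tA.
  have f1 := ctrl_fin rsm1; have f2 := ctrl_fin rsm2.
  have fin (m : measureR R) B : measurable B ->
      (m setT < +oo)%E -> m B \is a fin_num.
    by move=> mB mT; rewrite ge0_fin_numE//; exact: measure_lty.
  have sumle (m : measureR R) : (m setT < +oo)%E ->
      \sum_(i < n) fine (m (A i)) <= fine (m setT).
    move=> mT; rewrite -lee_fin fineK; last exact: fin.
    have mA i : measurable (A i : set (measurableTypeR R)) by case: (sA i).
    rewrite -sumEFin (eq_bigr (fun i => m (A i))); last by move=> i _; rewrite fineK ?fin.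
    rewrite -(measure_bigsetU_ord _ predT)//; apply: le_measure; rewrite ?inE//.
    by apply: bigsetU_measurable => i _.
  apply: (@le_trans _ _ (\sum_(i < n) (fine (m1 (A i)) + fine (m2 (A i))))).
    apply: ler_sum => i _; rewrite DE//.
    have [LA1 LA2] := (rsm_L2 rsm1 (sA i), rsm_L2 rsm2 (sA i)).
    apply: le_trans (cauchy_schwarz LA1 LA2) _.
    have AS : A i `&` S = A i by apply/setIidPl; case: (sA i).
    rewrite /m1 /m2 !ctrlE AS -!sqr_nrm.
    have := sqr_ge0 (nrm P (phi1 (A i)) - nrm P (phi2 (A i))).
    have := nrm_ge0 P (phi1 (A i)); have := nrm_ge0 P (phi2 (A i)).
    nra.
  by rewrite big_split/= lerD// sumle.
Qed.

Let bound := nrm P (xi1 0) * Num.sqrt (fine (m2 S)).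

Let bound_ge0 : 0 <= bound. Proof. by rewrite mulr_ge0 ?nrm_ge0 ?sqrtr_ge0. Qed.

Lemma trig_apply_ip (s : seq (R[i] * int)) :
  ip P (xi1 0) (trig_apply xi2 s) = \sum_(c <- s) conjc c.1 * gamma (- c.2).
Proof.
rewrite ip_sumr//; last by move=> c; exact: L2Z.
by apply: eq_bigr => c _; rewrite ipZr// ip_xi sub0r.
Qed.

(** Continuity of the integral against [D] for the uniform norm on the circle, with constant
    [bound]. *)
Lemma graph_ip_bound f Y (C : R) : graph_closure m2 P (step_graph phi2) f Y -> 0 <= C ->
  (forall x, S x -> normc (f x) <= C) -> normc (ip P (xi1 0) Y) <= C * bound.
Proof.
move=> fY C0 fC.
have [_ n2 _] := isometric_closure (isometric_step rsm2).
have [Lf LY nfY] := n2 _ _ fY.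
apply: le_trans (cauchy_schwarz (L2_xi1 0) LY) _; rewrite mulrCA ler_wpM2l ?nrm_ge0//.
by rewrite -nfY; apply: (nrm_spectral_bound (ctrl_fin rsm2) (ctrl_supp rsm2)).
Qed.

Lemma cross_measure_bound A : spectral_set A -> normc (D A) <= bound.
Proof.
move=> sA; rewrite cross_measureE// -[leRHS]mul1r; by apply: (graph_ip_bound (indic_graph rsm2 sA)) => // x _; exact: normc_indic_le1.
Qed.

Lemma cross_measureU A B : spectral_set A -> spectral_set B -> A `&` B = set0 ->
  D (A `|` B) = D A + D B.
Proof.
move=> sA sB AB; have sU := spectral_setU sA sB.
have [_ _ h] := rsm_split rsm2 sU sA.1.
have UA : (A `|` B) `&` A = A by apply/setIidPr; exact: subsetUl.
have UB : (A `|` B) `\` A = B.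
  apply/seteqP; split => x; first by move=> [[]].
  by move=> Bx; split; [right|move=> Ax; have : (A `&` B) x by []; rewrite AB].
rewrite UA UB in h; have [LA LB] := (rsm_L2 rsm2 sA, rsm_L2 rsm2 sB).
have LU := rsm_L2 rsm2 sU; rewrite !cross_measureE// -ipDr//.
exact: ip_nrm0r LU (L2D LA LB) (L2_xi1 0) h.
Qed.

Lemma increment0 x : increment D x 0 = 0.
Proof.
rewrite /increment lexx addr0; have -> : arc x x = set0.
  by apply/seteqP; split => // t [_ [m /andP[? ?]]]; lra.
have s0 := @spectral_set0 R.
have := @cross_measureU set0 set0 s0 s0 (setI0 _).
by rewrite setU0 => /eqP; rewrite -subr_eq subrr => /eqP <-.
Qed.

(** With the sign convention the increments at [x] form a primitive of [D]. The range [[- pi, pi]]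
    keeps every arc within one turn. *)
Lemma arc_increment x h h' : - pi <= h -> h <= h' -> h' <= pi ->
  D (arc (x + h) (x + h')) = increment D x h' - increment D x h.
Proof.
move=> hpi hh h'pi; have pi0 := pi_gt0 R.
have add a b c : a <= b -> b <= c -> c <= a + 2 * pi -> D (arc a c) = D (arc a b) + D (arc b c).
  move=> ab bc ca; have [-> I0] := arc_split ab bc ca.
  by rewrite cross_measureU//; exact: spectral_set_arc.
rewrite /increment; case: (leP 0 h) => h0.
  by rewrite (le_trans h0 hh) [in RHS](add x (x + h)); [ring|lra|lra|lra].
case: (leP 0 h') => h'0; first by rewrite opprK [RHS]addrC; apply: add; lra.
by rewrite [D (arc (x + h) x)](add _ (x + h')); [ring|lra|lra|lra].
Qed.

Lemma increment_bound x h : normc (increment D x h) <= bound.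
Proof.
by rewrite /increment; case: ifP => _; rewrite ?normcN; apply: cross_measure_bound; exact: spectral_set_arc.
Qed.

Lemma vp_seq_ip n x : ip P (xi1 0) (trig_apply xi2 (vp_seq n x)) =
  \sum_(k < n.+1) (vp_weight R n k - vp_weight R n k.+1)%:C *
   (((2 * pi)^-1)%:C * \sum_(i < (2 * k).+1)
      expi (- (x * (i%:Z - k%:Z)%:~R)) * gamma (i%:Z - k%:Z)).
Proof.
rewrite trig_apply_ip -(vp_partial_sums (fun z => expi (- (x * z%:~R)) * gamma z)).
rewrite big_map; apply: eq_bigr => j _; rewrite -[(_, _).1]/(_ * expi _) -[(_, _).2]/(n%:Z - j%:Z).
rewrite conjcM -mulrA opprB -expiN conjc_real; congr (_ * (expi _ * _)).
by rewrite opprK -mulrN -rmorphN opprB.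
Qed.

(** Cleared of the denominator, the estimate also holds at [h = 0], a value that nodes of a
    subdivision may take. *)
Lemma is_spectral_densityP x dx : is_spectral_density D x dx -> forall e, 0 < e ->
  exists2 r, 0 < r & forall h, `|h| <= r -> normc (increment D x h - dx * h%:C) <= e * `|h|.
Proof.
move=> /cvg_complexP/cvgrPdist_lt h e e0; have := h e e0.
rewrite near_withinE => /nbhs_ballP[r /= r0 hr]; exists (r / 2); first by rewrite divr_gt0.
move=> y yr; have [->|y0] := eqVneq y 0.
  by rewrite increment0 mulr0 subrr normr0 mulr0 normc0.
have yr' : `|y| < r by apply: le_lt_trans yr _; rewrite ltr_pdivrMr// ltr_pMr//; lra.
have := hr y; rewrite /ball/= sub0r normrN => /(_ yr' y0).
rewrite sub0r normrN (ger0_norm (normc_ge0 _)) => hy.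
have yC : y%:C != 0 by rewrite (inj_eq (@complexI R)).
rewrite -[increment _ _ _](divfK yC) -mulrBl normcM normcR ler_wpM2r//.
exact: ltW.
Qed.

Lemma density_kernel_limit x dx : is_spectral_density D x dx ->
  normc (ip P (xi1 0) (trig_apply xi2 (vp_seq n x)) - dx) @[n --> \oo] --> 0.
Proof.
move=> /is_spectral_densityP Ddx; have pi0 := pi_gt0 R.
(* A crude bound for the deviation of the increments on all of [[- pi, pi]], to be multiplied by
   kernel values far from the peak. *)
pose K := bound + normc dx * pi.
have K0 : 0 <= K by rewrite addr_ge0// mulr_ge0 ?normc_ge0 ?ltW.
apply/cvgn0P => e e0; have e3 : 0 < e / 3 by rewrite divr_gt0.
have [r r0 hr] := Ddx _ e3; pose r' := Num.min r pi.
have r'0 : 0 < r' by rewrite lt_min r0 pi0.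
have [r'r r'pi] : r' <= r /\ r' <= pi by rewrite !ge_min !lexx orbT.
have eK : 0 < e / 3 / (2 * K + 1) by rewrite divr_gt0// ltr_wpDl ?mulr_ge0.
have /cvgn0P/(_ _ eK)[N hN] : vp n (r' / 2) @[n --> \oo] --> 0.
  by apply: cvg_vp_ne0; lra.
exists (maxn 1 N) => n; rewrite geq_max => /andP[n1 /hN].
rewrite !ger0_norm ?normc_ge0 ?vp_ge0// => hn.
pose f t : R[i] := (vp n (t - x))%:C.
have fE : f = trig (vp_seq n x) by apply/funext => t; rewrite trig_vp_seq.
have [C [C0 hC]] := trig_lipschitz (vp_seq n x).
have eb : 0 < e / 3 / (bound + 1) by rewrite divr_gt0// ltr_wpDl.
have fC u v : normc (f u - f v) <= C * `|u - v| by rewrite fE.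
have fper u m : f (u + 2 * pi * m%:~R) = f u by rewrite fE trig_periodic.
(* Starting at [x - pi], the nodes are [x + h] with [h] from [- pi] to [pi], so the peak of the
   kernel falls in the middle. *)
have [N' hN'] := arc_step_approx (x - pi) C0 eb fC fper.
(* Respectively: the Riemann sum of the kernel is exact, the arc steps are fine enough, and the mesh
   is at most [r' / 2]. *)
have [m [nm N'm mr]] := exists_large_nat n N' (2 * pi / (r' / 2)).
have m_gt0 : (0 < m)%N by exact: leq_ltn_trans nm.
pose h i : R := - pi + 2 * pi * i%:R / (2 * m)%:R.
have nodeE i : arc_node (x - pi) (2 * m) i = x + h i by rewrite /arc_node /h addrA.
pose st := arc_step f (x - pi) (2 * m).
have gst : graph_closure m2 P (step_graph phi2) (step_value st) (step_integral phi2 st).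
  by apply: (graph_closure_sub (isometric_step rsm2)); exists st.
have gtr := trig_apply_graph (vp_seq n x) xi2_phi2.
have iso2 := isometric_closure (isometric_step rsm2).
have [_ n2 _] := iso2; have [_ Lst _] := n2 _ _ gst; have [_ Ltr _] := n2 _ _ gtr.
have h1 : normc (ip P (xi1 0) (trig_apply xi2 (vp_seq n x)) -
                 ip P (xi1 0) (step_integral phi2 st)) <= e / 3 / (bound + 1) * bound.
  rewrite -ipBr//; apply: (graph_ip_bound (isometricB iso2 gtr gst)) => [|t St].
    exact: ltW.
  by rewrite -fE; exact: hN'.
have h1' : e / 3 / (bound + 1) * bound <= e / 3.
  exact: divD1_mul_le (ltW e3) bound_ge0.
have hM : h (2 * m)%N = pi.
  rewrite /h mulfK; first by rewrite mulr2n mulrDl mul1r addrA addNr add0r.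
  by rewrite pnatr_eq0 muln_eq0/= -lt0n.
have hle i j : (i <= j)%N -> h i <= h j.
  by move=> ij; rewrite lerD2l ler_wpM2r ?invr_ge0// ler_pM2l ?mulr_gt0// ler_nat.
have h0i i : - pi <= h i.
  by rewrite lerDl divr_ge0// mulr_ge0// mulr_ge0// ltW.
have stE : ip P (xi1 0) (step_integral phi2 st) =
    \sum_(i < 2 * m) (vp n (h i))%:C * (increment D x (h i.+1) - increment D x (h i)).
  rewrite ip_sumr//; last by move=> i; apply: L2Z; apply: rsm_L2 => //; exact: step_setP.
  apply: eq_bigr => i _ /=; rewrite ipZr//; last by apply: rsm_L2 => //; exact: spectral_set_arc.
  rewrite -cross_measureE; last exact: spectral_set_arc.
  rewrite !nodeE arc_increment//; last first.
  - by rewrite -hM hle.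
  - exact: hle.
  by rewrite /f conjc_real [x + _]addrC addrK.
have := @vp_step_sum R n m (fun i => increment D x (h i)) dx (e / 3) K r'.
cbv zeta; rewrite -stE => /(_ n1 nm (ltW e3) r'0 r'pi); set Q := normc _.
have mr' : 2 * pi / (2 * m)%:R <= r' / 2.
  have m0 : 0 < (2 * m)%:R :> R by rewrite ltr0n muln_gt0.
  move: mr; rewrite ler_pdivrMr ?divr_gt0// => mr.
  rewrite ler_pdivrMr// [leRHS]mulrC; apply: le_trans mr _.
  by rewrite ler_pM2r ?divr_gt0// ler_nat leq_pmull.
move=> /(_ mr').
have bK i : (i <= 2 * m)%N -> normc (increment D x (h i) - dx * (h i)%:C) <= K.
  move=> im; apply: le_trans (le_normcD _ _) _; rewrite lerD ?increment_bound//.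
  rewrite normcN normcM normcR ler_wpM2l ?normc_ge0// ler_norml h0i/= -hM; exact: hle.
move=> /(_ bK) hQ; have {hQ} : Q <= e / 3 + K * (2 * vp n (r' / 2)).
  by apply: hQ => i im hi; apply: hr; exact: le_trans r'r.
have : K * (2 * vp n (r' / 2)) < e / 3.
  move: hn; rewrite ltr_pdivlMr ?ltr_wpDl ?mulr_ge0// => hn.
  apply: le_lt_trans hn; have := vp_ge0 n (r' / 2); lra.
have := le_normcD (ip P (xi1 0) (trig_apply xi2 (vp_seq n x)) -
   ip P (xi1 0) (step_integral phi2 st)) (ip P (xi1 0) (step_integral phi2 st) - dx).
rewrite addrA subrK -/Q; move: h1 h1'; set A1 := normc _; set A2 := normc _.
move: (e / 3 / _ * _) (vp _ _) => b1 b2 *.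
have E : e = e / 3 + e / 3 + e / 3 by field.
lra.
Qed.

(** The kernel means tend to [dx]; being averages of the partial sums they also tend to [s]. The
    averaging weights telescope to [vp_weight n 0 - vp_weight n n.+1 = 1]. *)
Lemma spectral_density_unique x dx s : is_spectral_density D x dx ->
  normc (((2 * pi)^-1)%:C * \sum_(i < (2 * n).+1)
      expi (- (x * (i%:Z - n%:Z)%:~R)) * gamma (i%:Z - n%:Z) - s) @[n --> \oo] --> 0 ->
  dx = s.
Proof.
move=> /density_kernel_limit h1 h2.
have h3 : normc (ip P (xi1 0) (trig_apply xi2 (vp_seq n x)) - s) @[n --> \oo] --> 0.
  under eq_cvg do rewrite vp_seq_ip.
  apply: (toeplitz (w := fun n k => vp_weight R n k - vp_weight R n k.+1) _ _ _ h2).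
  - by move=> n k; rewrite subr_ge0 vp_weightS.
  - move=> n; under eq_bigr do rewrite -opprB; rewrite sumrN.
    rewrite -(big_mkord xpredT (fun k => vp_weight R n k.+1 - vp_weight R n k)) telescope_sumr//.
    by rewrite vp_weight_gt vp_weight0 sub0r opprK.
  - exact: cvg_vp_weight_diff.
apply/eqP; rewrite -subr_eq0; apply/eqP/normc_le_eps => e e0; have e2 : 0 < e / 2 by rewrite divr_gt0.
have /cvgn0P/(_ _ e2)[N1 hN1] := h1; have /cvgn0P/(_ _ e2)[N2 hN2] := h3.
have := hN1 _ (leq_maxl N1 N2); have := hN2 _ (leq_maxr N1 N2).
rewrite !ger0_norm ?normc_ge0//; set V := ip _ _ _ => a b.
have := le_normcD (dx - V) (V - s); rewrite addrA subrK normcB; lra.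
Qed.

Variable B : R.
Hypothesis gammaB : forall N, symmetric_sum (fun k => normc (gamma k)) N <= B.

Let pi0 := pi_gt0 R.
Let mu : measureR R := @circle_measure R.
Let muT : (mu setT < +oo)%E := @circle_measure_fin R.

Let g N := symmetric_sum (fun k => normc (gamma k)) N.

Let g_le N M : (N <= M)%N -> g N <= g M.
Proof. by apply: symmetric_sum_le => z; exact: normc_ge0. Qed.

Let density_seq N : seq (R[i] * int) :=
  [seq (((2 * pi)^-1)%:C * gamma (i%:Z - N%:Z), - (i%:Z - N%:Z)) | i : 'I_(2 * N).+1 <- index_enum _].

Lemma trig_density_seq N x : trig (density_seq N) x =
  ((2 * pi)^-1)%:C * \sum_(i < (2 * N).+1) expi (- (x * (i%:Z - N%:Z)%:~R)) * gamma (i%:Z - N%:Z).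
Proof.
rewrite /trig big_map mulr_sumr; apply: eq_bigr => i _ /=.
by rewrite -mulrA; congr (_ * _); rewrite mulrC; congr (expi _ * _); rewrite rmorphN mulrN.
Qed.

Lemma trig_density_seq_dist N M x : (N <= M)%N ->
  normc (trig (density_seq M) x - trig (density_seq N) x) <= (2 * pi)^-1 * (g M - g N).
Proof.
move=> NM; have p0 : 0 <= (2 * pi)^-1 :> R by rewrite invr_ge0 mulr_ge0// ltW.
rewrite !trig_density_seq -mulrBr normcM normcR ger0_norm// ler_wpM2l//.
have := sum_symmetric_dist (fun z => expi (- (x * z%:~R)) * gamma z) NM.
by under [X in _ <= X - _ -> _]eq_bigr do rewrite normcM normc_expi mul1r;
  under [X in _ <= _ - X -> _]eq_bigr do rewrite normcM normc_expi mul1r.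
Qed.

Lemma trig_density_seq_bound N x : normc (trig (density_seq N) x) <= (2 * pi)^-1 * B.
Proof.
have p0 : 0 <= (2 * pi)^-1 :> R by rewrite invr_ge0 mulr_ge0// ltW.
rewrite trig_density_seq normcM normcR ger0_norm// ler_wpM2l//.
apply: le_trans (le_normc_sum _ _ _) (le_trans _ (gammaB N)).
by apply: ler_sum => i _; rewrite normcM normc_expi mul1r.
Qed.

(** Once the partial sum contains every frequency of [s], both sides are the same combination of
    Fourier coefficients; the sum of the moduli of the frequencies bounds each of them. *)
Lemma ip_density_seq (s : seq (R[i] * int)) : exists N0, forall N, (N0 <= N)%N ->
  ip mu (trig (density_seq N)) (trig s) = ip P (xi1 0) (trig_apply xi2 s).
Proof.
exists (\sum_(e <- s) `|e.2|)%N => N hN.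
rewrite trig_apply_ip (ip_circle_trig (density_seq N) s).
rewrite !big_seq; apply: eq_bigr => e es; congr (_ * _).
have eN : (`|e.2| <= N)%N.
  by apply: leq_trans hN; rewrite (big_rem e)//= leq_addr.
have iN : (`|N%:Z - e.2| < (2 * N).+1)%N by lia.
rewrite big_map (bigD1 (Ordinal iN))//= big1 ?addr0 => [|i ii].
  have -> : `|N%:Z - e.2|%:Z - N%:Z = - e.2 by lia.
  rewrite opprK eqxx mulr1 mulrAC -real_complexM mulVf ?mul1r//.
  by rewrite gt_eqF// mulr_gt0.
case: eqP => [h|_]; last by rewrite mulr0 mulr0.
case/eqP: ii; apply/val_inj => /=; lia.
Qed.

(** The indicator of [A] is approximated by trigonometric polynomials for [m2] and for Lebesgue
    measure at once. The partial sum must grow with the polynomial; a rank [M] depending on it is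
    compared with the fixed [N] through the tail bound [t], uniform in [M]. *)
Lemma cross_measure_approx A N (t : R) : spectral_set A ->
  (forall M, (N <= M)%N -> (2 * pi)^-1 * (g M - g N) <= t) ->
  normc (D A - ip mu (trig (density_seq N)) (cindic A)) <= t * fine (mu A).
Proof.
move=> sA ht; have mA := sA.1.
have t0 : 0 <= t by have := ht N (leqnn N); rewrite subrr mulr0.
have B0 : 0 <= B by apply: le_trans (gammaB 0); apply: sumr_ge0 => i _; exact: normc_ge0.
have p0 : 0 <= (2 * pi)^-1 :> R by rewrite invr_ge0 mulr_ge0// ltW.
have L2d n : L2 mu (trig (density_seq n)) by exact: L2_trig.
have LA : L2 mu (cindic A) by exact: L2_circle_indic.
apply/ler_addgt0Pl => e e0.
pose C := nrm P (xi1 0) + (2 * pi)^-1 * B * Num.sqrt (fine (mu S)).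
have C0 : 0 <= C by rewrite addr_ge0 ?mulr_ge0 ?nrm_ge0 ?sqrtr_ge0.
have eC : 0 < e / (C + 1) by rewrite divr_gt0// ltr_wpDl.
have [s [s1 s2]] := trig_approx2 (ctrl_fin rsm2) (ctrl_supp rsm2) muT
   (@circle_measure_supp R) mA eC.
have [N0 hN0] := ip_density_seq s.
pose M := maxn N N0; have NM : (N <= M)%N by exact: leq_maxl.
have iso2 := isometric_closure (isometric_step rsm2); have [_ n2 _] := iso2.
have gs := trig_apply_graph s xi2_phi2; have iA := indic_graph rsm2 sA.
have [_ Ls _] := n2 _ _ gs; have [_ LphiA _] := n2 _ _ iA.
have Lts : L2 mu (trig s) by exact: L2_trig.
have h1 : normc (D A - ip P (xi1 0) (trig_apply xi2 s)) <= nrm P (xi1 0) * (e / (C + 1)).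
  rewrite cross_measureE// -ipBr//; apply: le_trans (cauchy_schwarz (L2_xi1 0) (L2B LphiA Ls)) _.
  rewrite ler_wpM2l ?nrm_ge0// nrmB; have [_ _ <-] := n2 _ _ (isometricB iso2 gs iA).
  exact: ltW.
have h2 : normc (ip mu (trig (density_seq M)) (fun x => trig s x - (\1_A x)%:C)) <=
    (2 * pi)^-1 * B * Num.sqrt (fine (mu S)) * (e / (C + 1)).
  apply: le_trans (cauchy_schwarz (L2d M) (L2B Lts LA)) _.
  apply: ler_pM; rewrite ?nrm_ge0//; last exact: ltW.
  apply: (nrm_spectral_bound muT (@circle_measure_supp R)) => // [|w _].
    exact: mulr_ge0.
  exact: trig_density_seq_bound.
have h3 : normc (ip mu (fun x => trig (density_seq M) x - trig (density_seq N) x)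
    (cindic A)) <= t * fine (mu A).
  apply: (@ip_circle_indic_bound _ _ A t mA (L2B (L2d M) (L2d N)) t0) => w _.
  exact: le_trans (trig_density_seq_dist _ NM) (ht _ NM).
have -> : D A - ip mu (trig (density_seq N)) (cindic A) =
  (D A - ip P (xi1 0) (trig_apply xi2 s)) +
  (ip mu (trig (density_seq M)) (fun x => trig s x - (\1_A x)%:C) +
   ip mu (fun x => trig (density_seq M) x - trig (density_seq N) x) (cindic A)).
  by rewrite ipBr// ipBl// hN0 ?leq_maxr//; ring.
have hC : C * (e / (C + 1)) <= e.
  by rewrite mulrC divD1_mul_le// ltW.
move: hC; rewrite mulrDl => hC.
have := le_normcD (D A - ip P (xi1 0) (trig_apply xi2 s))
  (ip mu (trig (density_seq M)) (fun x => trig s x - (\1_A x)%:C) +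
   ip mu (fun x => trig (density_seq M) x - trig (density_seq N) x) (cindic A)).
have := le_normcD (ip mu (trig (density_seq M)) (fun x => trig s x - (\1_A x)%:C))
   (ip mu (fun x => trig (density_seq M) x - trig (density_seq N) x) (cindic A)).
lra.
Qed.

(** On an arc of length [h] touching [x], the partial sum differs from its value at [x] by at most
    [C * h]. *)
Lemma arc_density_approx x a b N (t C h : R) : S x -> 0 <= C ->
  (forall u v, normc (trig (density_seq N) u - trig (density_seq N) v) <= C * `|u - v|) ->
  (forall M, (N <= M)%N -> (2 * pi)^-1 * (g M - g N) <= t) ->
  x - h <= a -> b <= x + h -> mu (arc a b) = h%:E ->
  normc (D (arc a b) - trig (density_seq N) x * h%:C) <= (t + C * h) * h.
Proof.
move=> Sx C0 fC ht ax bx muh; set A := arc a b.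
have sA : spectral_set A by exact: spectral_set_arc.
have h0 : 0 <= h by rewrite -lee_fin -muh.
have fmu : fine (mu A) = h by rewrite muh.
pose f := trig (density_seq N).
have Lf : L2 mu f by exact: L2_trig.
have LA : L2 mu (cindic A) by apply: L2_circle_indic; exact: sA.1.
have LT : L2 mu (cindic (setT : set R)) by exact: L2_circle_indic.
pose c := fun w : measurableTypeR R => f x * (\1_(setT : set R) w)%:C.
have cE w : c w = f x by rewrite /c indicT mulr1.
have Lc : L2 mu c by exact: L2Z.
have ipc : ip mu c (cindic A) = f x * h%:C.
  rewrite ipZl//; congr (_ * _); rewrite -fmu; have := @ip_circle_indic R setT A measurableT sA.1.
  by rewrite setTI.
have Ch0 : 0 <= C * h by exact: mulr_ge0.
have h1 := cross_measure_approx sA ht; rewrite fmu in h1.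
have h2 : normc (ip mu (fun w => f w - c w) (cindic A)) <= C * h * h.
  rewrite -[X in _ <= _ * X]fmu.
  apply: (ip_circle_indic_bound sA.1 (L2B Lf Lc) Ch0) => w [_ [m /andP[w1 w2]]].
  rewrite cE /f -(trig_periodic _ w m); apply: le_trans (fC _ _) _.
  by rewrite ler_wpM2l// ler_norml; apply/andP; split; lra.
move: h2; rewrite ipBl// ipc => h2.
have := le_normcD (D A - ip mu f (cindic A))
   (ip mu f (cindic A) - f x * h%:C).
by rewrite addrA subrK mulrDl; rewrite -/f in h1; lra.
Qed.

Lemma spectral_density_exists x : S x -> exists dx, is_spectral_density D x dx /\
  normc (((2 * pi)^-1)%:C * \sum_(i < (2 * n).+1)
      expi (- (x * (i%:Z - n%:Z)%:~R)) * gamma (i%:Z - n%:Z) - dx) @[n --> \oo] --> 0.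
Proof.
move=> Sx; have p0 : 0 < (2 * pi)^-1 :> R by rewrite invr_gt0 mulr_gt0.
have [l hl] : exists l, normc (trig (density_seq n) x - l) @[n --> \oo] --> 0.
  apply: (@cvg_complex_bounded_variation _ _ ((2 * pi)^-1 * B)) => k.
  apply: (@le_trans _ _ (\sum_(0 <= i < k) (2 * pi)^-1 * (g i.+1 - g i))).
    by apply: ler_sum => i _; exact: trig_density_seq_dist.
  rewrite -mulr_sumr telescope_sumr// ler_pM2l//.
  apply: le_trans (gammaB k); rewrite lerBlDr lerDl.
  by apply: sumr_ge0 => i _; exact: normc_ge0.
exists l; split; last first.
  by under eq_cvg do rewrite -trig_density_seq.
have cg : cvgn g.
  apply: nondecreasing_is_cvgn; first by move=> n m; exact: g_le.
  by exists B => _ [n _ <-]; exact: gammaB.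
apply/cvg_complexP/cvgrPdist_lt => e e0.
(* Three errors of [e / 4]: the tail of the series, the oscillation of the partial sum on the arc,
   its distance to the limit at [x]. *)
have e4 : 0 < e / 4 by rewrite divr_gt0.
have e4p : 0 < e / 4 / (2 * pi)^-1 by rewrite divr_gt0.
have /cvgn0P/(_ _ e4)[N1 hN1] := hl.
have [N2 hN2] : exists N2, forall n, (N2 <= n)%N -> limn g - g n < e / 4 / (2 * pi)^-1.
  have h : limn g - g n @[n --> \oo] --> limn g - limn g by apply: cvgB => //; exact: cvg_cst.
  rewrite subrr in h; have /cvgn0P/(_ _ e4p)[N2 hN2] := h.
  by exists N2 => n /hN2; apply: le_lt_trans; exact: ler_norm.
pose N := maxn N1 N2.
have htl M : (N <= M)%N -> (2 * pi)^-1 * (g M - g N) <= e / 4.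
  move=> NM; rewrite -ler_pdivlMl// mulrC; apply: le_trans (ltW (hN2 N (leq_maxr _ _))).
  by rewrite lerD2r; apply: nondecreasing_cvgn_le => // n m; exact: g_le.
have hx : normc (trig (density_seq N) x - l) < e / 4.
  by have := hN1 N (leq_maxl _ _); rewrite ger0_norm ?normc_ge0.
have [C [C0 fC]] := trig_lipschitz (density_seq N).
have [r r0 hr] := circle_measure_small_arc Sx.
pose r' := Num.min r (e / 4 / (C + 1)).
have r'0 : 0 < r' by rewrite lt_min r0 divr_gt0// ltr_wpDl.
near=> h.
have h0 : h != 0 by near: h; exact: nbhs_dnbhs_neq.
have hr' : `|h| < r'.
  near: h; rewrite near_withinE; apply/nbhs_ballP; exists r' => //= y.
  by rewrite /ball/= sub0r normrN.
have {}h0' : 0 < `|h| by rewrite normr_gt0.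
move: hr'; rewrite lt_min => /andP[/ltW hhr hC].
have [mr ml] := hr _ h0' hhr.
rewrite sub0r normrN ger0_norm ?normc_ge0//.
have hC' : C * `|h| <= e / 4.
  move: hC; rewrite ltr_pdivlMr ?ltr_wpDl// mulrDr mulr1 mulrC; lra.
have hC0 : h%:C != 0 by rewrite (inj_eq (@complexI R)).
have key : normc (increment D x h - trig (density_seq N) x * h%:C) <= (e / 4 + C * `|h|) * `|h|.
  rewrite /increment; case: (leP 0 h) => hs.
    rewrite ger0_norm// in mr *.
    by apply: (arc_density_approx (h := h) Sx C0 fC htl) => //; lra.
  rewrite ltr0_norm// in ml *; rewrite opprK in ml.
  rewrite -normcN opprB -[_ * h%:C]opprK opprK.
  (* For [h < 0] the arc precedes [x] and has length [- h]; the sign in [increment] is absorbed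
     there. *)
  rewrite (_ : _ * h%:C - _ = D (arc (x + h) x) - trig (density_seq N) x * (- h)%:C); last first.
    by rewrite (_ : (- h)%:C = - h%:C) ?rmorphN//; ring.
  by apply: (arc_density_approx (h := - h) Sx C0 fC htl) => //; lra.
have key2 : normc (increment D x h / h%:C - trig (density_seq N) x) <= e / 4 + C * `|h|.
  rewrite -(ler_pM2r h0') -[X in _ * X <= _](normcR h) -normcM mulrBl divfK//.
have := le_normcD (increment D x h / h%:C - trig (density_seq N) x) (trig (density_seq N) x - l).
rewrite addrA subrK; lra.
Unshelve. all: by end_near.
Qed.

End cross_spectrum.

(** * The stationary counterpart of a self-similar process *)

Section stationary.
Context d (T : measurableType d) (R : realType) (P : probability T R).
Variables (alpha H : R) (q : nat) (W : 'I_q -> R -> {RV P >-> R}).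
Hypotheses (alpha_gt1 : 1 < alpha)
  (W_ss : multi_dt_self_similar H (geometric_space alpha) W)
  (W_zero_mean : forall (j : 'I_q) (k : int), ('E_P[W j (alpha ^ k)%R] = 0)%E).

Let alpha0 : 0 < alpha. Proof. exact: lt_trans alpha_gt1. Qed.

Let geom k : geometric_space alpha (alpha ^ k). Proof. by exists k. Qed.

Definition complex_process (j : 'I_q) (k : int) (w : T) : R[i] := (W j (alpha ^ k) w)%:C.

Definition stationary_process (j : 'I_q) (k : int) (w : T) : R[i] :=
  (stationary_counterpart alpha H (W j) k w)%:C.

Definition stationary_covariance (j r : 'I_q) (n : int) : R[i] :=
  (alpha `^ (- (n%:~R * H)))%:C * cov_fun alpha W j r n.

Lemma stationary_processE j k : stationary_process j k = (fun w => (alpha `^ (- (k%:~R * H)))%:C * complex_process j k w).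
Proof. by apply/funext => w; rewrite /stationary_process /stationary_counterpart real_complexM. Qed.

Lemma L2_complex_process j k : L2 P (complex_process j k).
Proof.
have [_ _ W2 _ _] := (W_ss.1 j); have := W2 _ (geom k); rewrite unlock => h.
split; [exact: measurable_funPT|exact: measurable_cst|].
apply: le_lt_trans h; rewrite /nsq; apply: ge0_le_integral => //.
- by move=> w _; rewrite lee_fin sqmod_ge0.
- apply/measurable_EFinP; apply: measurable_sqmod; split.
    exact: measurable_funPT.
  exact: measurable_cst.
- by apply/measurable_EFinP; apply: measurable_funX; exact: measurable_funPT.
- by move=> w _; rewrite /complex_process sqmodR.
Qed.

Lemma L2_stationary_process j k : L2 P (stationary_process j k).
Proof. by rewrite stationary_processE; apply: L2Z; exact: L2_complex_process. Qed.

(** Zero means make the covariance a second moment, and the processes are real. The first clause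
    also records that the covariance is finite. *)
Lemma ip_complex_process j r k l :
  covariance P (W j (alpha ^ k)) (W r (alpha ^ l)) = (Re (ip P (complex_process j k) (complex_process r l)))%:E /\
  ip P (complex_process j k) (complex_process r l) = (fine (covariance P (W j (alpha ^ k)) (W r (alpha ^ l))))%:C.
Proof.
have covE : covariance P (W j (alpha ^ k)) (W r (alpha ^ l)) =
    (\int[P]_w (Re (complex_process j k w * conjc (complex_process r l w)))%:E)%E.
  rewrite unlock !W_zero_mean unlock; apply: eq_integral => w _; congr EFin.
  rewrite /complex_process conjc_real -real_complexM.
  by rewrite -[LHS]/((W j (alpha ^ k) w - 0) * (W r (alpha ^ l) w - 0)) !subr0.
have fin := integrable_fin_num measurableT (integrable_ReM (L2_complex_process j k) (L2_complex_process r l)).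
split; first by rewrite covE /ip /Rintegral/= fineK.
rewrite covE; apply: complexP; rewrite //= /Rintegral.
rewrite (eq_integral (cst 0%E)) ?integral_cst ?mul0e// => w _.
by congr EFin; rewrite /= oppr0 mulr0 mul0r addr0.
Qed.

Lemma cov_funE j r n : cov_fun alpha W j r n = ip P (complex_process j n) (complex_process r 0).
Proof. by rewrite -cexpectationE /cov_fun /complex_process expr0z. Qed.

Lemma ip_stationary_process j r k l : ip P (stationary_process j k) (stationary_process r l) = stationary_covariance j r (k - l).
Proof.
rewrite !stationary_processE ipZl ?ipZr; [|exact: L2_complex_process|exact: L2_complex_process|exact: L2_complex_process|exact: L2Z (L2_complex_process _ _)].
rewrite /stationary_covariance cov_funE conjc_real !(ip_complex_process _ _ _ _).2 -!real_complexM; congr (_%:C).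
have al : 0 < alpha ^ l by rewrite exprz_gt0.
(* Dilation by [alpha ^ l] takes the indices [(k - l, 0)] to [(k, l)]; the exponents [- k H],
   [- l H] and [2 l H] add up to [- (k - l) H]. *)
have := W_ss.2 j r (alpha ^ l) (alpha ^ (k - l)) (alpha ^ 0) al (geom _) (geom _).
rewrite -!expfzDr ?gt_eqF// addrC subrK addr0 => -> //.
rewrite fineM//; last by rewrite (ip_complex_process _ _ _ _).1.
rewrite /= !mulrA; congr (_ * _).
have an0 : alpha != 0 by rewrite gt_eqF.
rewrite -powR_intmul ?ltW// -powRrM -!powRD ?an0 ?implybT//.
by congr (_ `^ _); rewrite rmorphB/=; ring.
Qed.

Lemma spectral_measure_of_graph (j : 'I_q) (phi : set R -> T -> R[i])
    (rsm : random_spectral_measure P phi) :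
  spectral_measure_of P (stationary_counterpart alpha H (W j)) phi ->
  forall k, graph_closure (ctrl rsm) P (step_graph phi) (expk k) (stationary_process j k).
Proof.
move=> [_ h] k; have [Y [hY ae_Y]] := h k.
have Lk := L2_expi (ctrl_fin rsm) k.
have gY := (spectral_integral_graph Y Lk).1 hY.
have [_ LY _] := gY; have Lx := L2_stationary_process j k.
(* The integral equals the process only almost surely, hence a change of representative. *)
apply: (graph_closure_eqr (isometric_step rsm) gY Lx).
by rewrite nrmB; exact: nrm_ae0.
Qed.

Lemma spectral_measure_of_exists j :
  exists phi, spectral_measure_of P (stationary_counterpart alpha H (W j)) phi.
Proof.
have [mu [f s h]] := herglotz (L2_stationary_process j) (ip_stationary_process j j).
have [phi [rsm hphi]] := spectral_measure_exists (L2_stationary_process j) f s h.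
exists phi; split => // k; exists (stationary_process j k); split => //.
exact: aeW.
Qed.

Lemma density_partial_sumE j r x N : density_partial_sum alpha H W j r x N =
  ((2 * pi)^-1)%:C * \sum_(i < (2 * N).+1)
    expi (- (x * (i%:Z - N%:Z)%:~R)) * stationary_covariance j r (i%:Z - N%:Z).
Proof.
rewrite /density_partial_sum; congr (_ * _); apply: eq_bigr => i _.
by rewrite /density_term /stationary_covariance mulrA [expi _ * _]mulrC.
Qed.

Lemma summable_covariance_bound j r : summable_covariance alpha H W j r ->
  exists B, forall N, symmetric_sum (fun k => normc (stationary_covariance j r k)) N <= B.
Proof.
move=> h; apply: summable_symmetric_sum => [z|]; first exact: normc_ge0.
rewrite (_ : (fun z => _) = (fun n : int => (alpha `^ (- (n%:~R * H)) * normc (cov_fun alpha W j r n))%:E))//.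
by apply/funext => n; rewrite /stationary_covariance normcM normcR ger0_norm ?powR_ge0.
Qed.

End stationary.

Theorem theorem3p1 (d : measure_display) (T : measurableType d) (R : realType)
    (P : probability T R) (H alpha : R) (q : nat)
    (W : 'I_q -> R -> {RV P >-> R})
    (H_gt0 : 0 < H) (alpha_gt1 : 1 < alpha)
    (W_ss : multi_dt_self_similar H (geometric_space alpha) W)
    (W_zero_mean : forall (j : 'I_q) (k : int),
       ('E_P[W j (alpha ^ k)%R] = 0)%E) :
  (exists phi : 'I_q -> set R -> T -> R[i], forall j : 'I_q,
     spectral_measure_of P (stationary_counterpart alpha H (W j)) (phi j)) /\
  (forall phi : 'I_q -> set R -> T -> R[i],
     (forall j : 'I_q,
        spectral_measure_of P (stationary_counterpart alpha H (W j)) (phi j)) ->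
     (forall (j : 'I_q) (k : int), exists Y : T -> R[i],
        is_spectral_integral P (phi j) (fun x => expi (x * k%:~R)) Y /\
        {ae P, forall w,
           (W j (alpha ^ k) w)%:C = (alpha `^ (k%:~R * H))%:C * Y w}) /\
     (exists D : 'I_q -> 'I_q -> set R -> R[i],
        spectral_distribution P phi D /\
        (forall (j r : 'I_q) (x : R), spectral_interval x ->
           (forall dx s : R[i],
              is_spectral_density (D j r) x dx ->
              density_series_sums_to alpha H W j r x s -> dx = s) /\
           (summable_covariance alpha H W j r ->
              exists dx : R[i],
                is_spectral_density (D j r) x dx /\
                density_series_sums_to alpha H W j r x dx)))).
Proof.
split.
  have /choice[phi hphi] := spectral_measure_of_exists alpha_gt1 W_ss W_zero_mean.
  by exists phi.
move=> phi hphi; split.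
  move=> j k; have [_ /(_ k)[Y [hY ae_Y]]] := hphi j; exists Y; split => //.
  apply: filterS ae_Y => w <-; rewrite -real_complexM; congr (_%:C).
  rewrite /stationary_counterpart mulrA -powRD ?addrN ?powRr0 ?mul1r//.
  by rewrite (gt_eqF (lt_trans _ alpha_gt1)) ?implybT.
have rsm j : random_spectral_measure P (phi j) by case: (hphi j).
have gr j := spectral_measure_of_graph W_ss (rsm j) (hphi j).
have ipx j r := ip_stationary_process alpha_gt1 W_ss W_zero_mean j r.
(* On spectral sets the definition of [spectral_distribution] leaves no other choice. *)
exists (fun j r A => ip P (phi j A) (phi r A)); split.
  move=> j r; split.
  - exact: (cross_complex_measure (gr j) (gr r) (ipx j r)).
  - by move=> A _; rewrite cexpectationE.
  - move=> A B sA sB AB; rewrite cexpectationE.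
    exact: (cross_orthogonal (gr j) (gr r) (ipx j r)).
move=> j r x Sx; split.
  move=> dx s h1 /cvg_complexP h2.
  apply: (spectral_density_unique (gr j) (gr r) (ipx j r) _ h1); first by [].
  by under eq_cvg do rewrite -density_partial_sumE.
move=> /summable_covariance_bound[B hB].
have [|dx [h1 h2]] := @spectral_density_exists _ _ _ _ _ _ _ _ _ _ _ (gr j) (gr r) (ipx j r)
  (fun A => ip P (phi j A) (phi r A)) _ B hB x Sx; first by [].
exists dx; split => //; apply/cvg_complexP.
by under eq_cvg do rewrite density_partial_sumE.
Qed.
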